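(* Let $Z_{L_{ll}}=\sum_{\lambda,\mu}H_{\Gamma;\lambda,\mu}(a,q)\,W_{\lambda,\emptyset}\otimes W_{\mu,\emptyset}$ be the HOMFLYPT partition function of the conormal filling $L_{ll}$ of the (negative) Hopf link $\Gamma$. Then $$Z_{L_{ll}}=\Bigl(\bigl(\Psi^{(0)}_{\mathrm{di}}\otimes\Psi^{(0)}_{\mathrm{di}}\bigr)\star_{-1}\widetilde\Psi^{(-1,-1)}_{(0,3)}[a]\Bigr)\star_0\bigl(\Psi^{(1)}_{\mathrm{di}}[a^2]\otimes\Psi^{(1)}_{\mathrm{di}}[a^2]\bigr).$$ (The same expression holds for the filling $L_{mm}$ by the two unknot complements.)
   Context: **Notation.** $z=q-q^{-1}$. For a partition $\lambda$: content $c(\square)=\text{column}-\text{row}$, hook length $h(\square)$, $\kappa(\lambda)=2\sum_{\square\in\lambda}c(\square)$, $C_\lambda(s)=\sum_{\square\in\lambda}s^{c(\square)}$. The HOMFLYPT skein module $\mathrm{Sk}(L)$ of an oriented 3-manifold is generated by framed oriented links modulo: (positive crossing) $-$ (negative crossing) $=z\cdot$(smoothing), split unknot $=(a_L-a_L^{-1})/z$, positive/negative kink $=a_L^{\pm1}$; coefficients are Laurent polynomials over $\mathbb Q$ in $q$, $a$ and the $a_{L_i}$ with all $q^k-q^{-k}$ inverted. $\mathrm{Sk}(S^1\times\mathbb R^2)$ has basis $W_{\lambda,\overline\mu}$ ($\lambda,\mu$ partitions), and $W_\lambda:=W_{\lambda,\emptyset}$ correspond to Schur functions $s_\lambda$ in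 the positive part $\mathrm{Sk}_+(S^1\times\mathbb R^2)\cong$ symmetric functions. The claim is an identity in the completion of $\mathrm{Sk}_+(L_1)\otimes\mathrm{Sk}_+(L_2)$, $L_1,L_2\approx S^1\times\mathbb R^2$, i.e. of formal infinite sums of $W_\lambda\otimes W_\mu$. **Twisted products.** For $f\in\mathbb Z$, $W_\lambda\star_fW_\mu=\sum_\nu c^\nu_{\lambda\mu}\,q^{f(\kappa(\nu)-\kappa(\lambda)-\kappa(\mu))}W_\nu$ with $c^\nu_{\lambda\mu}$ the Littlewood–Richardson coefficients; on tensor products $\star_f$ is applied in each factor. **Building blocks.** $\Psi^{(f)}_{\mathrm{di}}[\xi]=\sum_\lambda\bigl[(-1)^{|\lambda|}q^{\kappa(\lambda)}\bigr]^f\prod_{\square\in\lambda}\frac{-q^{-c(\square)}}{q^{h(\square)}-q^{-h(\square)}}\,\xi^{|\lambda|}W_\lambda$, $\Psi^{(f)}_{\mathrm{di}}=\Psi^{(f)}_{\mathrm{di}}[1]$; and $\widetilde\Psi^{(-1,-1)}_{(0,3)}[a]=\sum_\lambda(-1)^{|\lambda|}\prod_{\square\in\lambda}\bigl(a^2q^{-2c(\square)}-q^{-4c(\square)}\bigr)W_\lambda\otimes W_\lambda$ (sum over all partitions including $\emptyset$). **The Hopf link partition function.** $H_{\Gamma;\lambda,\mu}(a,q)=a^{|\lambda|+|\mu|}\langle\Gamma_{1;\lambda}\cup\Gamma_{2;\mu}\rangle$, where $\langle\cdot\rangle$ is the value in $\mathrm{Sk}(S^3)$ (framing variable $a$, empty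 link $=1$) of the negative Hopf link (linking number $-1$) with zero-framed components decorated by $W_\lambda$ and $W_\mu$. Equivalently, by another theorem of the paper (this characterization may be taken as the definition), $Z_{L_{ll}}$ is the unique element such that the coefficient of $W_{\lambda,\overline\nu}\otimes W_{\mu,\overline\rho}$ vanishes unless $\nu=\rho=\emptyset$, the coefficient of $W_\emptyset\otimes W_\emptyset$ is $1$, and it is annihilated by (with $a_i=a_{L_i}$) $A_1=a_2(P^{(1)}_{0,0}-P^{(1)}_{1,0}-a_1P^{(1)}_{0,1}+a^2P^{(1)}_{1,1})-a_1(P^{(2)}_{0,0}-P^{(2)}_{1,0}-a_2P^{(2)}_{0,1}+a^2P^{(2)}_{1,1})$, $A_2=a_1(-P^{(1)}_{-1,0}+P^{(1)}_{0,0})+a_2^2(a_1P^{(1)}_{-1,1}-a^2P^{(1)}_{0,1})+a_2(a_2^{-1}P^{(2)}_{0,-1}-P^{(2)}_{1,-1}-P^{(2)}_{0,0}+a^2P^{(2)}_{1,0})$, $A_3=a_2(-P^{(2)}_{-1,0}+P^{(2)}_{0,0})+a_1^2(a_2P^{(2)}_{-1,1}-a^2P^{(2)}_{0,1})+a_1(a_1^{-1}P^{(1)}_{0,-1}-P^{(1)}_{1,-1}-P^{(1)}_{0,0}+a^2P^{(1)}_{1,0})$. Here $P^{(k)}_{i,j}$ acts on the $k$-th factor, with $a_L=a_k$, by: $P_{0,0}=\frac{a_L-a_L^{-1}}{z}$; $P_{\pm1,0}$ diagonal with $P_{1,0}W_{\lambda,\overline\mu}=\bigl(\frac{a_L-a_L^{-1}}{z}+z[a_LC_\lambda(q^2)-a_L^{-1}C_\mu(q^{-2})]\bigr)W_{\lambda,\overline\mu}$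 and $P_{-1,0}W_{\lambda,\overline\mu}=\bigl(\frac{a_L-a_L^{-1}}{z}+z[a_LC_\mu(q^2)-a_L^{-1}C_\lambda(q^{-2})]\bigr)W_{\lambda,\overline\mu}$; $P_{0,1}W_{\lambda,\overline\mu}=\sum_{\alpha=\lambda+\square}W_{\alpha,\overline\mu}+\sum_{\beta=\mu-\square}W_{\lambda,\overline\beta}$; $P_{0,-1}W_{\lambda,\overline\mu}=\sum_{\alpha=\lambda-\square}W_{\alpha,\overline\mu}+\sum_{\beta=\mu+\square}W_{\lambda,\overline\beta}$; and $P_{m,n}=[P_{m,0},P_{0,n}]/(q^{mn}-q^{-mn})$ for $m,n\in\{\pm1\}$. The filling $L_{mm}$ consists of the complement fillings of both unknot components; the complement of one component is isotopic to the conormal of the other. *)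

(* Defs.v *)
From HB Require Import structures.
From mathcomp Require Import all_boot all_order all_algebra all_fingroup.
From mathcomp Require Import fraction mpoly zify.

Set Implicit Arguments.
Unset Strict Implicit.
Unset Printing Implicit Defensive.

Import Order.TTheory GRing.Theory Num.Theory.

Local Open Scope ring_scope.

Definition is_part (s : seq nat) : bool := sorted geq s && (0%N \notin s).

Record intpart := IntPart { pseq :> seq nat; _ : is_part pseq }.

HB.instance Definition _ := [isSub for pseq].
HB.instance Definition _ := [Countable of intpart by <:].

Definition part0 : intpart := @IntPart [::] isT.

Definition psize (l : intpart) : nat := sumn l.

Definition part (l : intpart) (i : nat) : nat := nth 0%N l i.

(* Boxes are pairs (row, column), both numbered from 0. *)
Definition boxes (l : intpart) : seq (nat * nat) :=
  [seq (i, j) | i <- iota 0 (size l), j <- iota 0 (part l i)].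

Definition content (b : nat * nat) : int := b.2%:Z - b.1%:Z.

Definition arm (l : intpart) (b : nat * nat) : nat := (part l b.1 - b.2.+1)%N.
Definition leg (l : intpart) (b : nat * nat) : nat :=
  (count (fun r => b.2 < r)%N l - b.1.+1)%N.
Definition hook (l : intpart) (b : nat * nat) : nat := (arm l b + leg l b).+1.

Definition kappa (l : intpart) : int := 2 * \sum_(b <- boxes l) content b.

(* [addbox l m]: m is obtained from l by adding one box. *)
Definition addbox (l m : intpart) : bool :=
  (psize m == (psize l).+1) &&
  all (fun i => part l i <= part m i)%N (iota 0 (size l)).

(* The partitions of n: delete the zeros from all n-tuples with entries at
   most n, and keep the partitions of size n so obtained. *)
Definition intparts (n : nat) : seq intpart :=
  undup [seq l <- pmap insub [seq [seq val k | k <- val t & val k != 0%N]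
                             | t : n.-tuple 'I_n.+1]
        | psize l == n].

Definition intparts_le (n : nat) : seq intpart :=
  flatten [seq intparts k | k <- iota 0 n.+1].

Lemma part_le_sumn (s : seq nat) (x : nat) : x \in s -> (x <= sumn s)%N.
Proof.
elim: s => //= y s IHs; rewrite inE => /predU1P[->|/IHs xs].
  exact: leq_addr.
exact: leq_trans xs (leq_addl _ _).
Qed.

Lemma intpart_sorted (l : intpart) : sorted geq l.
Proof. by case/andP: (valP l). Qed.

Lemma intpart_notin0 (l : intpart) : 0%N \notin (l : seq nat).
Proof. by case/andP: (valP l). Qed.

Lemma size_part_le (l : intpart) : (size l <= psize l)%N.
Proof.
rewrite /psize; have := intpart_notin0 l.
elim: (pseq l) => //= x s IHs; rewrite inE negb_or eq_sym => /andP[x0 /IHs].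
by rewrite -lt0n in x0; rewrite -add1n; apply: leq_add.
Qed.

Lemma intparts_uniq n : uniq (intparts n).
Proof. exact: undup_uniq. Qed.

Lemma mem_intparts n (l : intpart) : (l \in intparts n) = (psize l == n).
Proof.
rewrite mem_undup mem_filter; case: eqP => //= ln.
rewrite mem_pmap_sub; apply/imageP.
have sl : (size l <= n)%N by rewrite -ln size_part_le.
pose f (i : 'I_n) : 'I_n.+1 := inord (part l i).
exists [tuple f i | i < n] => //=.
have hf (i : 'I_n) : val (f i) = part l i.
  rewrite [LHS]inordK // ltnS; move: {i}(val i) => i.
  rewrite -ln; case: (ltnP i (size l)) => hi.
    exact/part_le_sumn/mem_nth.
  by rewrite /part nth_default.
have -> : [seq val k | k <- map f (enum 'I_n) & val k != 0%N] =
          [seq k <- [seq val (f i) | i <- enum 'I_n] | k != 0%N].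
  by rewrite -(filter_map val (fun k => k != 0%N)) -map_comp.
have -> : [seq val (f i) | i <- enum 'I_n] = [seq part l i | i <- iota 0 n].
  by rewrite (eq_map hf) -val_enum_ord -map_comp.
rewrite -(subnKC sl) iotaD map_cat filter_cat.
have -> : [seq part l i | i <- iota 0 (size l)] = l.
  by rewrite /part map_nth_iota0 // take_size.
have /eq_in_map-> : {in iota (0 + size l) (n - size l), part l =1 fun=> 0%N}.
  by move=> i; rewrite mem_iota => /andP[? _]; apply: nth_default.
rewrite [X in _ ++ X](_ : _ = [::]) ?cats0; last by elim: (iota _ _).
apply/esym/all_filterP/allP => x xl.
by apply: contraNneq (intpart_notin0 l) => <-.
Qed.

(* Schur polynomials in n variables over int: hsym k is the complete
   homogeneous symmetric polynomial h_k and schur l = det (h_{l_i - i + j}).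
   Since alternant staircase * schur k = alternant (part_mon k + staircase)
   (lemma alternant_schur), whose only monomial with strictly decreasing
   exponents is that of part_mon k + staircase, schur_coef p k is the
   coefficient of schur k in the expansion of a symmetric p
   (lemma schur_expansion). *)
Section Schur.
Variable n : nat.
Local Notation R := {mpoly int[n]}.

Definition hsym (k : nat) : R :=
  \sum_(m : 'X_{1..n < k.+1} | mdeg m == k) 'X_[m].

Definition hsymB (k j : nat) : R := if (j <= k)%N then hsym (k - j) else 0.

Definition schur (l : intpart) : R :=
  \det (\matrix_(i < size l, j < size l) hsymB (part l i + j) i).

Definition alternant (m : 'X_{1..n}) : R :=
  \det (\matrix_(i < n, j < n) 'X_i ^+ m j).

Definition staircase : 'X_{1..n} := [multinom (n - i.+1)%N | i < n].

Definition part_mon (l : intpart) : 'X_{1..n} := [multinom part l i | i < n].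

Definition schur_coef (p : R) (l : intpart) : int :=
  (alternant staircase * p)@_(part_mon l + staircase).

(* complete symmetric polynomials in a sub-list of variables *)
Let suppin (s : seq 'I_n) (m : 'X_{1..n}) := [forall i, (i \in s) || (m i == 0%N)].
Let hs (s : seq 'I_n) (k : nat) : R :=
  \sum_(m : 'X_{1..n < k.+1} | (mdeg m == k) && suppin s m) 'X_[m].

Let hsE s k m : (hs s k)@_m = ((mdeg m == k) && suppin s m)%:R.
Proof.
rewrite /hs raddf_sum /=.
under eq_bigr => m' _ do rewrite mcoeffX.
case: (boolP (_ && _)) => [/andP[mk ms]|nm].
  have hm : (mdeg m < k.+1)%N by rewrite (eqP mk).
  rewrite (bigD1 (BMultinom hm)) /= ?mk ?ms // eqxx big1 ?addr0 //.
  move=> m' /andP[_ ne]; case: eqP => // e; case/eqP: ne; exact/val_inj.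
rewrite big1 // => m' h; case: eqP => // e.
by rewrite -e h in nm.
Qed.

Let mcoeffXl (k : 'I_n) (p : R) m :
  ('X_k * p)@_m = if (0 < m k)%N then p@_(m - U_(k)) else 0.
Proof.
rewrite mulrC; case: ifP => mk.
  have le : (U_(k) <= m)%MM.
    by apply/mnm_lepP => i; rewrite mnm1E; case: eqP => // <-.
  by rewrite -{1}(submK le) addmC mcoeffMX.
apply/eqP; rewrite mcoeff_eq0; apply/negP => /msuppM_le/allpairsP[[m1 m2]] /=.
rewrite msuppX inE => -[_ /eqP -> e].
by move: mk; rewrite e mnmDE mnm1E eqxx addn1.
Qed.

Let hs_rec k s d : k \notin s ->
  hs (k :: s) d.+1 = hs s d.+1 + 'X_k * hs (k :: s) d.
Proof.
move=> ks; apply/mpolyP => m; rewrite mcoeffD mcoeffXl !hsE.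
case: (posnP (m k)) => mk.
  rewrite addr0; congr (_ && _)%:R.
  apply/eq_forallb => i; rewrite inE; case: eqP => //= ->.
  by rewrite mk eqxx orbT.
have -> : suppin s m = false.
  by apply/negP => /forallP/(_ k); rewrite (negPf ks) /= eqn0Ngt mk.
rewrite andbF add0r; congr (_ && _)%:R.
  have le : (U_(k) <= m)%MM.
    by apply/mnm_lepP => i; rewrite mnm1E; case: eqP => // <-.
  by rewrite -{1}(submK le) mdegD mdeg1 addn1.
apply/eq_forallb => i; rewrite mnmBE mnm1E inE eq_sym.
by case: (k =P i) => //= _; rewrite subn0.
Qed.

Let hs0 s : hs s 0 = 1.
Proof.
apply/mpolyP => m; rewrite hsE mcoeff1 mdeg_eq0; case: eqP => //= ->.
suff -> : suppin s 0%MM by [].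
by apply/forallP => i; rewrite mnm0E eqxx orbT.
Qed.

Let hs_nil d : hs [::] d.+1 = 0.
Proof.
apply/mpolyP => m; rewrite hsE mcoeff0; case: eqP => //= md.
case: (boolP (suppin _ _)) => // /forallP h; move: md.
by rewrite mdegE big1 // => i _; have := h i; rewrite /= => /eqP.
Qed.

Let hs1 k d : hs [:: k] d = 'X_k ^+ d.
Proof.
elim: d => [|d IHd]; first by rewrite hs0.
by rewrite hs_rec // hs_nil add0r IHd exprS.
Qed.

Let hs_mem s t d : s =i t -> hs s d = hs t d.
Proof.
move=> st; apply/mpolyP => m; rewrite !hsE; congr (_ && _)%:R.
by apply/eq_forallb => i; rewrite st.
Qed.

Let hsymE s d : s =i 'I_n -> hs s d = hsym d.
Proof.
move=> st; apply/eq_bigl => m; rewrite [suppin _ _](_ : _ = true) ?andbT //.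
by apply/forallP => i; rewrite st.
Qed.

Let lin (k : 'I_n) : {poly R} := 1 - 'X_k *: 'X.

Let U N s : {poly R} := \poly_(d < N) hs s d.

Let hs_prod N s t d : uniq (s ++ t) -> (d < N)%N ->
  ((\prod_(j <- s) lin j) * U N (s ++ t))`_d = hs t d.
Proof.
elim: s d => [|k s IHs] d /=; first by rewrite big_nil mul1r coef_poly => _ ->.
move=> /andP[ks us] dN; rewrite big_cons (mulrC (lin k)) -mulrA.
have IH d' : (d' < N)%N ->
    (lin k * U N (k :: s ++ t))`_d' = (U N (s ++ t))`_d'.
  move=> hd; rewrite /lin mulrBl mul1r -scalerAl coefB coefZ coefXM.
  case: d' hd => [|d'] hd; first by rewrite mulr0 subr0 !coef_poly hd !hs0.
  by rewrite !coef_poly hd ltnW //= hs_rec // addrK.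
rewrite -(IHs d us dN) !coefM; apply/eq_bigr => i _; rewrite IH //.
by apply: leq_ltn_trans dN; rewrite leq_subr.
Qed.

Let others k := [seq j <- enum 'I_n | j != k].
Let ek k : {poly R} := \prod_(j <- others k) lin j.

Let size_ek k : (size (ek k) <= n)%N.
Proof.
have h s : (size (\prod_(j <- s) lin j)%R <= (size s).+1)%N.
  elim: s => [|j s IHs]; first by rewrite big_nil size_poly1.
  rewrite big_cons; apply: leq_trans (size_polyMleq _ _) _.
  have: (size (lin j) <= 2)%N.
    apply: leq_trans (size_polyD _ _) _; rewrite geq_max size_poly1 /= size_polyN.
    by apply: leq_trans (size_scale_leq _ _) _; rewrite size_polyX.
  by move=> h2; rewrite -subn1 leq_subLR; exact: leq_add h2 IHs.
apply: leq_trans (h _) _.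
rewrite size_filter; have := count_predC (pred1 k) (enum 'I_n).
rewrite count_uniq_mem ?enum_uniq // mem_enum size_enum_ord /= add1n => E.
exact: (eq_leq E).
Qed.

Let powE k d :
  'X_k ^+ d = \sum_(r < n) (ek k)`_r * hsymB d r.
Proof.
rewrite -hs1.
have us : uniq (others k ++ [:: k]).
  rewrite cat_uniq filter_uniq ?enum_uniq //= orbF andbT mem_filter eqxx //.
rewrite -(hs_prod us (ltnSn d)) coefM.
transitivity (\sum_(r < d.+1) (ek k)`_r * hsymB d r).
  apply/eq_bigr => r _; rewrite coef_poly ltnS leq_subr /hsymB leq_ord.
  by rewrite hsymE // => i; rewrite mem_cat mem_filter mem_enum !inE andbT orNb.
pose F r := (ek k)`_r * hsymB d r.
have E a b : (a <= b)%N -> (forall r, (a <= r < b)%N -> F r = 0) ->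
    \sum_(r < b) F r = \sum_(r < a) F r.
  move=> ab Fz; rewrite -!(big_mkord xpredT) (big_cat_nat (n := a)) //=.
  by rewrite [X in _ + X]big_nat [X in _ + X]big1 ?addr0 // => r /Fz.
case: (leqP d.+1 n) => dn.
  by apply/esym/E => // r /andP[dr _]; rewrite /F /hsymB leqNgt dr mulr0.
apply: E; first exact: ltnW.
move=> r /andP[nr _]; rewrite /F nth_default ?mul0r //.
exact: leq_trans (size_ek k) nr.
Qed.

Let jt N (l : intpart) : R :=
  \det (\matrix_(i < N, j < N) hsymB (part l i + j) i).

Let jtS N (l : intpart) : (size l <= N)%N -> jt N.+1 l = jt N l.
Proof.
move=> lN; rewrite /jt (expand_det_row _ ord_max) (bigD1 ord_max) //=.
rewrite [X in _ + X]big1 ?addr0 => [|j jN]; last first.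
  rewrite mxE /part nth_default //= add0n /hsymB leqNgt.
  have -> : (j < N)%N by rewrite ltn_neqAle -ltnS ltn_ord andbT.
  by rewrite mul0r.
rewrite mxE /part nth_default //= add0n /hsymB leqnn subnn.
have -> : hsym 0 = 1 by rewrite -(@hsymE (enum 'I_n)) ?hs0 // => i; rewrite mem_enum.
rewrite mul1r /cofactor addnn -signr_odd odd_double expr0 mul1r.
by congr (\det _); apply/matrixP => i j; rewrite !mxE !lift_max.
Qed.

Let jt_schur (l : intpart) : (size l <= n)%N -> jt n l = schur l.
Proof.
have h k : jt (size l + k) l = schur l.
  by elim: k => [|k IHk]; rewrite ?addn0 // addnS jtS ?leq_addr.
by move=> ln; rewrite -(h (n - size l)%N) subnKC.
Qed.

Let M : 'M[R]_n := \matrix_(k, r) (ek k)`_(n - r.+1).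

Let alternant_jt (l : intpart) :
  alternant (part_mon l + staircase) = \det M * jt n l.
Proof.
rewrite /jt -[X in _ * X]det_tr -det_mulmx; congr (\det _).
apply/matrixP => k j; rewrite !mxE mnmDE !mnmE powE.
rewrite (reindex_inj rev_ord_inj) /=; apply/eq_bigr => r _; rewrite !mxE /=.
congr (_ * _); rewrite /hsymB.
have jn := ltn_ord j; have rn := ltn_ord r.
have -> : (n - r.+1 <= part l j + (n - j.+1))%N = (j <= part l j + r)%N.
  by apply/idP/idP; lia.
by case: ifP => // h; congr hsym; lia.
Qed.

Let det_M : \det M = alternant staircase.
Proof.
have := alternant_jt part0; rewrite jt_schur // /schur det_mx00 mulr1 => <-.
congr alternant; apply/mnmP => i.
by rewrite mnmDE [X in (X + _)%N]mnmE /part nth_nil.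
Qed.

Lemma alternant_schur (l : intpart) : (size l <= n)%N ->
  alternant (part_mon l + staircase) = alternant staircase * schur l.
Proof. by move=> ln; rewrite alternant_jt det_M jt_schur. Qed.

Let msym_hsym s k : msym s (hsym k) = hsym k.
Proof.
have h m : suppin (enum 'I_n) m = true.
  by apply/forallP => i; rewrite mem_enum.
rewrite -(@hsymE (enum 'I_n)) => [|i]; last by rewrite mem_enum.
by apply/mpolyP => m; rewrite mcoeff_sym !hsE mdeg_mperm !h.
Qed.

Lemma schur_sym (l : intpart) s : msym s (schur l) = schur l.
Proof.
rewrite /schur -det_map_mx; congr (\det _); apply/matrixP => i j.
by rewrite !mxE /hsymB; case: ifP => _ /=; rewrite ?raddf0 ?msym_hsym.
Qed.

Lemma alternantE m : alternant m = \sum_(s : 'S_n) (-1) ^+ s *: 'X_[[multinom m (s i) | i < n]].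
Proof.
rewrite /alternant; apply/eq_bigr => s _; rewrite mpolyXE_id -mul_mpolyC.
rewrite rmorphXn rmorphN1; congr (_ * _); apply/eq_bigr => i _.
by rewrite mxE mnmE.
Qed.

Let anti (p : R) := forall s : 'S_n, msym s p = (-1) ^+ s *: p.

Let alternant_anti m : anti (alternant m).
Proof.
move=> s; rewrite !alternantE raddf_sum scaler_sumr (reindex_inj (mulgI s)) /=.
apply/eq_bigr => t _; rewrite msymZ msymX odd_permM signr_addb scalerA.
congr (_ *: 'X_[_]).
apply/mnmP => i; rewrite !mnmE permM permKV //.
Qed.

Let psize_sum (l : intpart) : psize l = (\sum_(i < size l) part l i)%N.
Proof. by rewrite /psize sumnE (big_nth 0%N) big_mkord. Qed.

Lemma schur_homog (l : intpart) : schur l \is (psize l).-homog.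
Proof.
rewrite /schur; apply: rpred_sum => s _.
have -> : (-1) ^+ s = ((-1) ^+ s)%:MP :> R by rewrite rmorphXn rmorphN1.
rewrite mul_mpolyC; apply: rpredZ.
pose ok := [forall i : 'I_(size l), (i <= part l i + s i)%N].
case: (boolP ok) => [/forallP h|]; last first.
  move=> /forallPn[i hi]; rewrite (bigD1 i) //= mxE /hsymB (negPf hi) mul0r.
  exact: rpred0.
have -> : psize l = (\sum_(i < size l) (part l i + s i - i))%N.
  apply/eqP; rewrite -(eqn_add2r (\sum_(i < size l) i)%N) -big_split /=.
  rewrite psize_sum [X in (_ + X)%N](reindex_inj (@perm_inj _ s)) -big_split /=.
  by apply/eqP/eq_bigr => i _; rewrite subnK.
pose G (i : 'I_(size l)) := (part l i + s i - i)%N.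
have H i : (\matrix_(i0, j) hsymB (part l i0 + j) i0) i (s i) \is (G i).-homog.
  rewrite mxE /hsymB h /hsym; apply: rpred_sum => m /eqP mk.
  by rewrite dhomogX /= mk.
elim/big_ind2: _ => //; first exact: dhomog1.
by move=> *; apply: dhomogM.
Qed.

Lemma alternant_homog m : alternant m \is (mdeg m).-homog.
Proof.
rewrite alternantE; apply: rpred_sum => s _; apply: rpredZ.
by rewrite dhomogX /= mdeg_mperm.
Qed.

Let strict (m : 'X_{1..n}) := forall i j : 'I_n, (i < j)%N -> (m j < m i)%N.

Let strict_mon l : strict (part_mon l + staircase).
Proof.
move=> i j ij; rewrite !mnmDE !mnmE.
suff: (part l j <= part l i)%N by have := ltn_ord j; lia.
rewrite /part; case: (ltnP j (size l)) => jl; last by rewrite [X in (X <= _)%N]nth_default.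
have tr : transitive geq by move=> a b c ab bc; exact: leq_trans bc ab.
apply: (sorted_leq_nth tr leqnn 0%N (intpart_sorted l)) (ltnW ij) => //.
by rewrite inE (ltn_trans ij).
Qed.

Let strict_perm m m' (s : 'S_n) : strict m -> strict m' ->
  [multinom m (s i) | i < n] = m' -> s = 1%g.
Proof.
move=> sm sm' e.
have ms (i j : 'I_n) : (i < j)%N -> (s i < s j)%N.
  move=> ij; have := sm' _ _ ij; rewrite -e !mnmE.
  case: (ltngtP (s i) (s j)) => // [h|/val_inj h]; last by rewrite h ltnn.
  by move=> /ltn_trans/(_ (sm _ _ h)); rewrite ltnn.
have ge k : forall i : 'I_n, val i = k -> (k <= s i)%N.
  elim: k => // k IHk i ik.
  have kn : (k < n)%N by rewrite (leq_trans _ (ltn_ord i)) // ik.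
  apply: leq_ltn_trans (IHk (Ordinal kn) erefl) _.
  by apply: ms; rewrite ik.
have le k : forall i : 'I_n, (n - i.+1)%N = k -> (s i <= i)%N.
  elim: k => [|k IHk] i ik.
    by have := ltn_ord i; have := ltn_ord (s i); lia.
  have kn : (i.+1 < n)%N by have := ltn_ord i; lia.
  rewrite -ltnS; apply: leq_trans (IHk (Ordinal kn) _); first exact: ms.
  by rewrite /=; lia.
apply/permP => i; rewrite perm1; apply/val_inj/eqP.
by rewrite eqn_leq (le _ i erefl) (ge _ i erefl).
Qed.

Let intpart_inj (l l' : intpart) : (forall i, part l i = part l' i) -> l = l'.
Proof.
move=> e.
have sz (a b : intpart) : (forall i, part a i = part b i) -> (size a <= size b)%N.
  move=> ab; rewrite leqNgt; apply/negP => h.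
  have := ab (size b); rewrite /part [RHS]nth_default // => a0.
  by have := intpart_notin0 a; rewrite -a0 mem_nth.
have ss : size l = size l' by apply/eqP; rewrite eqn_leq !sz.
apply: val_inj; apply: (@eq_from_nth _ 0%N) => //= i _; exact: e.
Qed.

Let alternant_coef (l k : intpart) : (size l <= n)%N -> (size k <= n)%N ->
  (alternant (part_mon l + staircase))@_(part_mon k + staircase) = (l == k)%:R.
Proof.
move=> ln kn; rewrite alternantE raddf_sum /=.
under eq_bigr => s _ do rewrite mcoeffZ mcoeffX.
rewrite (bigD1 1%g) //= odd_perm1 expr0 mul1r big1 ?addr0 => [|s s1].
  congr (_%:R); rewrite mperm1; congr nat_of_bool; apply/eqP/eqP => [|->//] e.
  apply: intpart_inj => i; case: (ltnP i n) => ni; last first.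
    by rewrite /part !nth_default // (leq_trans _ ni).
  move/mnmP/(_ (Ordinal ni)): e; rewrite !mnmDE !mnmE => /eqP.
  by rewrite eqn_add2r => /eqP.
case: eqP => [e|]; last by rewrite mulr0.
by case/eqP: s1; apply: strict_perm e; apply: strict_mon.
Qed.

Let anti_coef g (m : 'X_{1..n}) (s : 'S_n) : anti g -> g@_[multinom m (s i) | i < n] = (-1) ^+ s * g@_m.
Proof. by move=> /(_ s) ag; rewrite -mcoeff_sym ag mcoeffZ. Qed.

Let nth_filter0 (s : seq nat) i : sorted geq s ->
  nth 0%N [seq x <- s | x != 0%N] i = nth 0%N s i.
Proof.
elim: s i => //= x s IHs i xs.
have ss := path_sorted xs.
case: (posnP x) => [x0|x0]; last first.
  by rewrite /=; case: i => //= i; exact: IHs.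
rewrite x0 /= IHs //.
have : all (eq_op^~ 0%N) s.
  have := order_path_min (fun b a c ab bc => leq_trans bc ab) xs.
  by rewrite x0; apply: sub_all => y /=; rewrite leqn0.
move/all_pred1P => ->; by case: i => [|i]; rewrite /= !nth_nseq !if_same.
Qed.

Let tr_geq : transitive geq.
Proof. by move=> a b c ab bc; exact: leq_trans bc ab. Qed.

Let strict_part (m : 'X_{1..n}) : strict m ->
  exists2 k : intpart, (size k <= n)%N & m = (part_mon k + staircase)%MM.
Proof.
move=> sm.
have ge t : forall i : 'I_n, (n - i.+1)%N = t -> (n - i.+1 <= m i)%N.
  elim: t => [|t IHt] i it; first by rewrite it.
  have kn : (i.+1 < n)%N by have := ltn_ord i; lia.
  have := sm i (Ordinal kn) (ltnSn _).
  have /= := IHt (Ordinal kn); lia.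
pose v (i : 'I_n) := (m i - (n - i.+1))%N.
pose s := [seq v i | i <- enum 'I_n].
have szs : size s = n by rewrite size_map size_enum_ord.
have sv (i : 'I_n) : nth 0%N s i = v i.
  by rewrite (nth_map i) ?size_enum_ord // nth_ord_enum.
have srt : sorted geq s.
  apply/(sortedP 0%N) => i; rewrite szs => i1.
  have i0 := ltnW i1.
  have := sv (Ordinal i0); have /= -> := sv (Ordinal i1); move=> /= ->.
  have := sm (Ordinal i0) (Ordinal i1) (ltnSn _); rewrite /v /=; lia.
have pk : is_part [seq x <- s | x != 0%N].
  rewrite /is_part mem_filter eqxx /= andbT.
  exact: sorted_filter tr_geq _ _ srt.
exists (IntPart pk); first by rewrite -szs size_filter count_size.
apply/mnmP => i; rewrite mnmDE !mnmE /part /= nth_filter0 // sv /v subnK //.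
exact: ge erefl.
Qed.

Lemma mdeg_part_mon (k : intpart) : (size k <= n)%N ->
  mdeg (part_mon k) = psize k.
Proof.
move=> kn; rewrite mdegE psize_sum; under eq_bigr => i _ do rewrite mnmE.
rewrite -!(big_mkord xpredT (fun i => part k i)).
rewrite (big_cat_nat (n := size k)) //= [X in (_ + X)%N]big_nat.
rewrite [X in (_ + X)%N]big1 ?addn0 // => i /andP[ki _].
by rewrite /part nth_default.
Qed.

Let anti_strict g (m : 'X_{1..n}) : anti g -> ~~ [forall i, forall j, (i != j) ==> (m i != m j)] ->
  g@_m = 0.
Proof.
move=> ag /forallPn[i /forallPn[j]]; rewrite negb_imply negbK => /andP[ij /eqP mij].
have := anti_coef m (tperm i j) ag.
have -> : [multinom m (tperm i j x) | x < n] = m.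
  by apply/mnmP => x; rewrite mnmE; case: tpermP => // ->.
rewrite odd_tperm ij expr1 mulN1r; lia.
Qed.

Let anti0 d g : anti g -> g \is (d + mdeg staircase).-homog ->
  (forall k, k \in intparts d -> g@_(part_mon k + staircase) = 0) -> g = 0.
Proof.
move=> ag hg g0; apply/mpolyP => m; rewrite mcoeff0.
case: (boolP [forall i, forall j, (i != j) ==> (m i != m j)]) => [/forallP mi|]; last first.
  exact: anti_strict.
pose w := sort_tuple geq m.
have /tuple_permP[s ws] : perm_eq (sort geq m) m by rewrite perm_sort.
have wE (i : 'I_n) : nth 0%N (sort geq m) i = m (s i).
  by rewrite ws -tnth_nth tnth_mktuple mnm_tnth.
have srt : sorted geq (sort geq m).
  by apply: sort_sorted => a b; exact: leq_total.
have sw : strict [multinom m (s i) | i < n].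
  move=> i j ij; rewrite !mnmE.
  have := mi (s i) => /forallP/(_ (s j)); rewrite (inj_eq perm_inj).
  have -> /= : i != j by rewrite neq_ltn ij.
  rewrite -!wE => ne; rewrite ltn_neqAle eq_sym ne /=.
  apply: (sorted_leq_nth tr_geq leqnn 0%N srt) (ltnW ij);
    by rewrite inE size_sort size_tuple.
have := anti_coef m s ag; have [k kn e] := strict_part sw.
rewrite e; case: (psize k =P d) => [kd|kd].
  rewrite g0 ?mem_intparts ?kd // => /esym/eqP.
  by rewrite mulf_eq0 signr_eq0 => /eqP.
rewrite (dhomog_nemf_coeff hg) => [/esym/eqP|].
  by rewrite mulf_eq0 signr_eq0 => /eqP.
rewrite /= mdegD eqn_add2r; by rewrite mdeg_part_mon //; apply/eqP.
Qed.

Lemma schur_expansion d p : (d <= n)%N -> p \is d.-homog ->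
  (forall s, msym s p = p) ->
  p = \sum_(k <- intparts d) schur_coef p k *: schur k.
Proof.
move=> dn hp sp.
have kn k : k \in intparts d -> (size k <= n)%N.
  by rewrite mem_intparts => /eqP kd; apply: leq_trans dn; rewrite -kd size_part_le.
have a0 : alternant staircase != 0.
  have := @alternant_coef part0 part0 isT isT; rewrite eqxx.
  have -> : (part_mon part0 + staircase)%MM = staircase.
    by apply/mnmP => i; rewrite mnmDE [X in (X + _)%N]mnmE /part nth_nil.
  by move=> h; apply/eqP => a0; move: h; rewrite a0 mcoeff0.
apply: (mulfI a0); rewrite mulr_sumr; apply/eqP; rewrite -subr_eq0; apply/eqP.
rewrite (eq_big_seq (fun k => schur_coef p k *: alternant (part_mon k + staircase)));
  last by move=> k /kn kd; rewrite -scalerAr alternant_schur.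
apply: (@anti0 d).
- move=> s; rewrite msymB msymM sp (alternant_anti staircase s) scalerBr -scalerAl.
  congr (_ - _); rewrite scaler_sumr (raddf_sum (msym s)); apply/eq_bigr => k _.
  by rewrite /= msymZ (alternant_anti _ s) !scalerA mulrC.
- apply: rpredB; first by rewrite addnC; apply: dhomogM => //; exact: alternant_homog.
  rewrite big_seq; apply: rpred_sum => k kd; apply: rpredZ.
  move: (alternant_homog (part_mon k + staircase)); rewrite mdegD.
  by rewrite mdeg_part_mon ?kn //; move: kd; rewrite mem_intparts => /eqP ->.
move=> k kd; rewrite mcoeffB raddf_sum /= (bigD1_seq k) ?intparts_uniq //=.
rewrite mcoeffZ alternant_coef ?kn // eqxx mulr1 big_seq_cond big1 ?addr0 ?subrr //.
by move=> l /andP[ld lk]; rewrite mcoeffZ alternant_coef ?kn // (negPf lk) mulr0.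
Qed.

End Schur.

(* The Littlewood-Richardson coefficient c^k_{l m}, i.e. the coefficient of
   s_k in s_l s_m (lemma schur_mul); |k| variables suffice. *)
Definition lr (l m k : intpart) : int :=
  schur_coef (schur (psize k) l * schur (psize k) m) k.

Lemma schur_mul (l m : intpart) (n := (psize l + psize m)%N) :
  schur n l * schur n m = \sum_(k <- intparts n) lr l m k *: schur n k.
Proof.
rewrite {1}(@schur_expansion n n (schur n l * schur n m)) //.
- apply/eq_big_seq => k; rewrite mem_intparts => /eqP kn.
  by rewrite /lr kn.
- by apply: dhomogM; apply: schur_homog.
- by move=> s; rewrite msymM !schur_sym.
Qed.

Lemma lr_eq0 (l m k : intpart) : psize k != (psize l + psize m)%N -> lr l m k = 0.
Proof.
move=> h; rewrite /lr /schur_coef.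
set n := psize k.
have hh : alternant (staircase n) * (schur n l * schur n m) \is
          (mdeg (staircase n) + (psize l + psize m)).-homog.
  by rewrite !(dhomogM, alternant_homog, schur_homog).
apply: (dhomog_nemf_coeff hh).
by rewrite /= mdegD addnC eqn_add2l mdeg_part_mon // size_part_le.
Qed.

Section Skein.
Variable K : fieldType.
Variables q a : K.

Let z : K := q - q^-1.

(* C_l(s) *)
Definition content_sum (s : K) (l : intpart) : K :=
  \sum_(b <- boxes l) s ^ content b.

(* An element of the completed skein of one solid torus is the family of its
   coefficients in the basis W_{l, mbar}, indexed by the pairs (l, m); an
   element of the completed tensor product of two of them is doubly indexed. *)
Definition skein1 := intpart * intpart -> K.
Definition skein2 := intpart * intpart -> intpart * intpart -> K.

(* Eigenvalue of P_{m,0}, m = -1, 0, 1, on W_x. *)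
Definition Peig (aL : K) (m : int) (x : intpart * intpart) : K :=
  (aL - aL^-1) / z +
  (if m == 1 then
     z * (aL * content_sum (q ^+ 2) x.1 - aL^-1 * content_sum (q ^- 2) x.2)
   else if m == -1 then
     z * (aL * content_sum (q ^+ 2) x.2 - aL^-1 * content_sum (q ^- 2) x.1)
   else 0).

Definition Pdiag (aL : K) (m : int) (F : skein1) : skein1 :=
  fun x => Peig aL m x * F x.

(* P_{0,1} and P_{0,-1}, on coefficients: the coefficient of W_{l, mbar} in
   the image collects the basis elements that are mapped to W_{l, mbar}. *)
Definition Pup (F : skein1) : skein1 := fun x =>
  \sum_(l <- intparts (psize x.1).-1 | addbox l x.1) F (l, x.2) +
  \sum_(m <- intparts (psize x.2).+1 | addbox x.2 m) F (x.1, m).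

Definition Pdown (F : skein1) : skein1 := fun x =>
  \sum_(l <- intparts (psize x.1).+1 | addbox x.1 l) F (l, x.2) +
  \sum_(m <- intparts (psize x.2).-1 | addbox m x.2) F (x.1, m).

Definition Pshift (n : int) : skein1 -> skein1 := if n == 1 then Pup else Pdown.

(* P_{m,n}, for m, n = -1, 0, 1 only. *)
Definition P (aL : K) (m n : int) (F : skein1) : skein1 := fun x =>
  if n == 0 then Pdiag aL m F x
  else if m == 0 then Pshift n F x
  else (Pdiag aL m (Pshift n F) x - Pshift n (Pdiag aL m F) x)
         / (q ^ (m * n) - q ^ (- (m * n))).

Section Operators.
Variables a1 a2 : K.

Definition P1 (m n : int) (Z : skein2) : skein2 :=
  fun x y => P a1 m n (fun x' => Z x' y) x.
Definition P2 (m n : int) (Z : skein2) : skein2 :=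
  fun x y => P a2 m n (fun y' => Z x y') y.

Definition A1 (Z : skein2) : skein2 := fun x y =>
  a2 * (P1 0 0 Z x y - P1 1 0 Z x y - a1 * P1 0 1 Z x y + a ^+ 2 * P1 1 1 Z x y)
  - a1 * (P2 0 0 Z x y - P2 1 0 Z x y - a2 * P2 0 1 Z x y
          + a ^+ 2 * P2 1 1 Z x y).

Definition A2 (Z : skein2) : skein2 := fun x y =>
  a1 * (- P1 (-1) 0 Z x y + P1 0 0 Z x y)
  + a2 ^+ 2 * (a1 * P1 (-1) 1 Z x y - a ^+ 2 * P1 0 1 Z x y)
  + a2 * (a2^-1 * P2 0 (-1) Z x y - P2 1 (-1) Z x y - P2 0 0 Z x y
          + a ^+ 2 * P2 1 0 Z x y).

Definition A3 (Z : skein2) : skein2 := fun x y =>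
  a2 * (- P2 (-1) 0 Z x y + P2 0 0 Z x y)
  + a1 ^+ 2 * (a2 * P2 (-1) 1 Z x y - a ^+ 2 * P2 0 1 Z x y)
  + a1 * (a1^-1 * P1 0 (-1) Z x y - P1 1 (-1) Z x y - P1 0 0 Z x y
          + a ^+ 2 * P1 1 0 Z x y).

(* The conditions characterizing the partition function of L_ll. *)
Record hopf_equations (Z : skein2) : Prop := HopfEquations {
  hopf_support : forall l n m r : intpart,
    (n, r) != (part0, part0) -> Z (l, n) (m, r) = 0;
  hopf_unit : Z (part0, part0) (part0, part0) = 1;
  hopf_A1 : forall x y, A1 Z x y = 0;
  hopf_A2 : forall x y, A2 Z x y = 0;
  hopf_A3 : forall x y, A3 Z x y = 0 }.

End Operators.

(* The completion of Sk_+(L_1) (x) Sk_+(L_2), in the basis W_l (x) W_m. *)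
Definition pos2 := intpart -> intpart -> K.

Definition pos_embed (F : pos2) : skein2 := fun x y =>
  if (x.2 == part0) && (y.2 == part0) then F x.1 y.1 else 0.

Definition tensor (F G : intpart -> K) : pos2 := fun l m => F l * G m.

(* Coefficient of W_n in the f-twisted product of W_l and W_m. *)
Definition star_coef (f : int) (l m n : intpart) : K :=
  (lr l m n)%:~R * q ^ (f * (kappa n - kappa l - kappa m)).

(* The f-twisted product in each factor, extended to infinite sums: the
   coefficient of W_n (x) W_r only involves partitions of size at most |n|,
   resp. |r|, by lr_eq0. *)
Definition star (f : int) (F G : pos2) : pos2 := fun n r =>
  \sum_(l <- intparts_le (psize n)) \sum_(l' <- intparts_le (psize n))
  \sum_(m <- intparts_le (psize r)) \sum_(m' <- intparts_le (psize r))
    star_coef f l l' n * star_coef f m m' r * F l m * G l' m'.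

Definition Psi_di (f : int) (xi : K) (l : intpart) : K :=
  ((-1) ^+ psize l * q ^ kappa l) ^ f *
  (\prod_(b <- boxes l) (- q ^ (- content b) / (q ^+ hook l b - q ^- hook l b))) *
  xi ^+ psize l.

Definition Psi_03 : pos2 := fun l m =>
  if l == m then
    (-1) ^+ psize l *
    \prod_(b <- boxes l)
      (a ^+ 2 * q ^ (- (2 * content b)) - q ^ (- (4 * content b)))
  else 0.

Definition hopf_rhs : pos2 :=
  star 0 (star (-1) (tensor (Psi_di 0 1) (Psi_di 0 1)) Psi_03)
         (tensor (Psi_di 1 (a ^+ 2)) (Psi_di 1 (a ^+ 2))).

End Skein.

(* The variables q, a, a_1 = a_{L_1}, a_2 = a_{L_2}. *)
Definition coef_field := {fraction {mpoly rat[4]}}.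

Definition q_ : coef_field := tofrac 'X_(inord 0).
Definition a_ : coef_field := tofrac 'X_(inord 1).
Definition a1_ : coef_field := tofrac 'X_(inord 2).
Definition a2_ : coef_field := tofrac 'X_(inord 3).

(* The ring of coefficients inside coef_field: Laurent polynomials over the
   rationals, with all q^k - q^-k, k > 0, inverted. *)
Definition coef_ring (c : coef_field) : Prop :=
  exists (p : {mpoly rat[4]}) (m : 'X_{1..4}) (s : seq nat),
    0%N \notin s /\
    c = tofrac p / (tofrac 'X_[m] * \prod_(k <- s) (q_ ^+ k - q_ ^- k)).

(* Z is the partition function of the filling L_ll by the two conormals. *)
Definition is_Z_ll (Z : skein2 coef_field) : Prop :=
  (forall x y, coef_ring (Z x y)) /\ hopf_equations q_ a_ a1_ a2_ Z.

(* The k-th factor of L_mm is the complement of the k-th component, which is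
   isotopic to the conormal of the other component. *)
Definition is_Z_mm (Z : skein2 coef_field) : Prop := is_Z_ll (fun x y => Z y x).

(* Main.v *)
(* Write M and L for adding and removing a box, T for q^kappa, M_e = T^e M T^-e and
   L_e = T^-e L T^e. Since star_f is the ordinary product conjugated by T^f, the right-hand
   side is (D (x) D) applied to sum_l prod (1 - a^2 q^(2c)) W_l (x) W_l, where
   D = G_(a^2) T^-1 G_(-1) and G_u is the multiplication by
   sum_l u^|l| prod (q^c / (q^h - q^-h)) s_l = prod_i g (x_i), with
   g (q^2 x) (1 - u q x) = g (x). The matrix entries of G_u are skew Jacobi-Trudi
   determinants in the coefficients of g; multiplying their rows and columns by powers of
   q^2 and using the functional equation of g gives the commutation relations of G_u with
   M_e, L_e and the diagonal operators C_l(q^2), C_l(q^-2). On W_(l,0) (x) W_(m,0) the A_i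
   are combinations of these operators (a_2 appearing only through 1 and a_2^2), and moving
   them through D (x) D leaves identities that are immediate on the diagonal sum.
   Conversely A_1 determines the coefficients with l <> m by induction on |l| + |m|, because
   l is determined by C_l(q^2), and A_2 at (l, l - box) determines those with l = m. *)
From Stdlib Require Import FunctionalExtensionality.
From HB Require Import structures.
Require Import Defs.
From mathcomp Require Import all_boot all_order all_algebra all_fingroup.
From mathcomp Require Import fraction mpoly zify ring.

Set Implicit Arguments.
Unset Strict Implicit.
Unset Printing Implicit Defensive.

Import Order.TTheory GRing.Theory Num.Theory.

Local Open Scope ring_scope.

(** * Adding and removing boxes *)

(** Only one power of [T] survives in [D]: [Psi_di 0 1] is [T^-1] applied to the series of [G_(-1)],
    [Psi_di 1 (a ^+ 2)] is the series of [G_(a^2)] itself, and [T (x) T] turns [Psi_03] into the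
    diagonal sum. The values [u = -1] and [u = a^2] fit the equations: [z [C_l(q^2), G_u] = u M_1
    G_u], and [M_1] becomes [M_0] when it passes to the left of [T^-1], so the commutator of
    [z C_l(q^2)] with [D] is [(a^2 M_1 - M_0) D], which matches [A_1]. All relations for [G_u] that
    come from determinants have one source: the derivative of a determinant in a direction with
    entries weighted by rows minus entries weighted by columns. The functional equation identifies
    this direction with a shifted matrix; rows then describe what happens after [G_u], columns what
    happens before it. In [A_2] the coefficients of 1 and of [a_2^2] vanish separately. In both,
    boxes are added in the first factor and removed in the second, and the ratio [1 - a^2 q^(2c)] of
    consecutive diagonal coefficients exchanges the two. [A_3] is [A_2] with the factors exchanged,
    and the right-hand side is symmetric. *)

Lemma part_default (l : intpart) i : (size l <= i)%N -> part l i = 0%N.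
Proof. exact: nth_default. Qed.

Lemma part_gt0 (l : intpart) i : (0 < part l i)%N = (i < size l)%N.
Proof.
case: (ltnP i (size l)) => [il|/part_default->//].
rewrite lt0n; apply: contraNneq (intpart_notin0 l) => <-; exact: mem_nth.
Qed.

Lemma part_anti (l : intpart) i j : (i <= j)%N -> (part l j <= part l i)%N.
Proof.
move=> ij; case: (ltnP j (size l)) => [jl|/part_default->//].
have tr : transitive geq by move=> a b c ab bc; exact: leq_trans bc ab.
have il := leq_ltn_trans ij jl.
by apply: (sorted_leq_nth tr leqnn 0%N (intpart_sorted l)) ij; rewrite inE.
Qed.

Lemma eq_intpart (l m : intpart) : part l =1 part m -> l = m.
Proof.
move=> e; have sz : size l = size m.
  have le a b : part a =1 part b -> (size a <= size b)%N.
    by move=> ab; rewrite leqNgt -part_gt0 ab part_default.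
  by apply/eqP; rewrite eqn_leq !le.
by apply/val_inj/(@eq_from_nth _ 0%N) => // i _; exact: e.
Qed.

(** Cutting at the first zero of [f], rather than at [N], keeps zero entries out of the list, as
    [is_part] demands. *)
Lemma intpart_of (f : nat -> nat) N : (forall i, f i.+1 <= f i)%N -> f N = 0%N ->
  exists l : intpart, part l =1 f.
Proof.
move=> f1 fN; have fi i j : (i <= j)%N -> (f j <= f i)%N.
  move/subnKC <-; elim: (j - i)%N => [|k IHk]; first by rewrite addn0.
  by rewrite addnS (leq_trans _ IHk).
have exN : exists n, f n == 0%N by exists N; rewrite fN.
case: (ex_minnP exN) => n /eqP fn0 nmin.
have sp : is_part (mkseq f n).
  apply/andP; split.
    apply/(sortedP 0%N) => i; rewrite size_mkseq => i1.
    by rewrite !nth_mkseq ?(ltnW i1) //; exact: f1.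
  apply/mapP => -[i]; rewrite mem_iota /= add0n => i1 /esym/eqP /nmin; lia.
exists (IntPart sp) => i; rewrite /part /=.
case: (ltnP i n) => ni; first by rewrite nth_mkseq.
by rewrite nth_default ?size_mkseq //; have := fi _ _ ni; lia.
Qed.

Lemma psizeE N (l : intpart) : (size l <= N)%N -> psize l = (\sum_(i < N) part l i)%N.
Proof.
move=> lN; rewrite /psize sumnE (big_nth 0%N).
rewrite -(big_mkord xpredT (fun i => part l i)) [RHS](big_cat_nat (n := size l)) //=.
by rewrite [X in (_ + X)%N]big_nat [X in (_ + X)%N]big1 ?addn0 // => i /andP[/part_default].
Qed.

Lemma addbox_leq l m i : addbox l m -> (part l i <= part m i)%N.
Proof.
case/andP=> _ /allP h; case: (ltnP i (size l)) => [il|/part_default->//].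
by apply: h; rewrite mem_iota.
Qed.

Lemma addbox_psize l m : addbox l m -> psize m = (psize l).+1.
Proof. by case/andP=> /eqP. Qed.

Lemma addbox_size l m : addbox l m -> (size l <= size m)%N.
Proof.
move=> lm; rewrite leqNgt -part_gt0 -leqNgt.
by rewrite -[X in (_ <= X)%N](@part_default m (size m)) // addbox_leq.
Qed.

Lemma addbox_of l m i : (forall k, part m k = (part l k + (k == i))%N) -> addbox l m.
Proof.
move=> h; apply/andP; split; last first.
  by apply/allP => k _; rewrite h leq_addr.
pose N := (size l + size m + i.+1)%N.
rewrite (@psizeE N m) ?(@psizeE N l); try (rewrite /N; lia).
have iN : (i < N)%N by rewrite /N; lia.
rewrite (eq_bigr (fun k : 'I_N => (part l k + (k == Ordinal iN))%N)) => [|k _]; last exact: h.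
rewrite big_split /= (bigD1 (Ordinal iN) (F := fun k => nat_of_bool _)) //= eqxx.
by rewrite [X in (_ + (_ + X))%N]big1 => [|k /negPf->//]; apply/eqP; lia.
Qed.

(** The row differences are nonnegative and add up to 1. A new box below an empty row would
    contradict the monotonicity of [m], hence the bound on [i]. *)
Lemma addbox_row l m : addbox l m ->
  exists2 i, (i <= size l)%N & forall k, part m k = (part l k + (k == i))%N.
Proof.
move=> lm; pose N := size m.
have lN := addbox_size lm.
have : (\sum_(k < N) (part m k - part l k) = 1)%N.
  apply/eqP; rewrite -(eqn_add2l (\sum_(k < N) part l k)%N) -big_split /= -psizeE //.
  rewrite addn1 -(addbox_psize lm) (@psizeE N m) //.
  by apply/eqP/eq_bigr => k _; rewrite subnKC // addbox_leq.
case: (pickP (fun k : 'I_N => part l k < part m k)%N) => [i li|no]; last first.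
  by rewrite big1 // => k _; have := no k; lia.
rewrite (bigD1 i) //= => s1.
have z0 : (\sum_(k < N | k != i) (part m k - part l k) = 0)%N.
  by apply/eqP; rewrite -leqn0 -(leq_add2l (part m i - part l i)) s1 addn0 subn_gt0.
have h k : part m k = (part l k + (k == i))%N.
  have := addbox_leq k lm.
  case: (ltnP k N) => kN; last first.
    have -> : (k == i) = false by apply: gtn_eqF; exact: leq_trans (ltn_ord i) kN.
    by rewrite (@part_default m k kN) leqn0 => /eqP->.
  case: eqP => [->|ki]; first by lia.
  have := z0; rewrite (bigD1 (Ordinal kN)) /= ?addn_eq0; first by lia.
  by apply/eqP => e; apply: ki; rewrite -e.
exists i => //.
rewrite leqNgt; apply/negP => il.
have := part_anti m (ltnW il).
by rewrite !h eqxx (ltn_eqF il) !part_default // ltnW.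
Qed.

Lemma addbox_rowP l m i : addbox l m -> (part l i < part m i)%N ->
  forall k, part m k = (part l k + (k == i))%N.
Proof.
move=> /addbox_row[j _ h]; rewrite h; case: (i =P j) => [->//|_]; lia.
Qed.

Section BoxSums.
Variable R : zmodType.

Lemma big_seq_unique (I : eqType) (r : seq I) (P : pred I) (F : I -> R) x :
  x \in r -> uniq r -> P x -> (forall y, P y -> y = x) ->
  \sum_(y <- r | P y) F y = F x.
Proof.
move=> xr ur Px Pu; rewrite big_mkcond (bigD1_seq x) //= Px big1 ?addr0 // => y.
by case: ifP => // /Pu-> /eqP.
Qed.

(** Writes a term indexed by a partition as a sum over rows with one nonzero contribution;
    exchanging summations then turns sums over partitions into sums over rows. *)
Lemma big_addbox_row N (l m : intpart) (x : R) : (size l < N)%N -> addbox l m ->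
  \sum_(i < N | (part l i < part m i)%N) x = x.
Proof.
move=> lN /addbox_row[i il h].
have iN : (i < N)%N by exact: leq_ltn_trans lN.
rewrite (big_pred1 (Ordinal iN)) // => k /=; rewrite h -[LHS]/(_ < _)%N.
by rewrite -val_eqE /=; case: (_ == _) => /=; lia.
Qed.

(** The determinant identities yield sums over all rows. A row from which no box can be removed has
    the length of the next row; there [Phi] will be a determinant with two equal rows or columns. *)
Lemma big_rembox N (v : intpart) (Phi : nat -> R) (F : intpart -> R) :
  (size v <= N)%N ->
  (forall l i, (i < N)%N -> (forall k, part v k = (part l k + (k == i))%N) -> Phi i = F l) ->
  (forall i, (i < N)%N -> part v i = part v i.+1 -> Phi i = 0) ->
  \sum_(i < N) Phi i = \sum_(l <- intparts (psize v).-1 | addbox l v) F l.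
Proof.
move=> vN PF P0.
transitivity (\sum_(l <- intparts (psize v).-1 | addbox l v)
    \sum_(i < N.+1 | (part l i < part v i)%N) F l); last first.
  by apply: eq_bigr => l lv; rewrite big_addbox_row // ltnS (leq_trans (addbox_size lv)).
rewrite (exchange_big_dep xpredT) //= big_ord_recr /=.
rewrite [X in _ + X]big1 ?addr0 => [|l /andP[_]]; last first.
  by rewrite (@part_default v) ?ltn0.
apply: eq_bigr => i _.
case: (leqP (part v i) (part v i.+1)) => pi.
  rewrite P0 //; last by apply/eqP; rewrite eqn_leq pi part_anti.
  rewrite big1 // => l /andP[lv /(addbox_rowP lv) h].
  have := part_anti l (leqnSn i).
  by move: pi; rewrite !h eqxx (gtn_eqF (ltnSn i)); lia.
have [l hl] : exists l : intpart, part l =1 (fun k => part v k - (k == i))%N.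
  apply: (@intpart_of _ (size v)) => [k|]; last by rewrite part_default.
  have := part_anti v (leqnSn k); case: (k =P i) pi => [->|ki] /=; first by lia.
  by case: (k.+1 =P i) => /=; lia.
have h k : part v k = (part l k + (k == i))%N.
  by rewrite hl; case: eqP => [->|]; lia.
have lv := addbox_of h.
rewrite (PF _ _ (ltn_ord i) h) (big_seq_unique _ (x := l)) ?intparts_uniq //.
- by rewrite mem_intparts (addbox_psize lv).
- by rewrite lv h eqxx addn1 ltnSn.
move=> m /andP[mv mi]; apply: eq_intpart => k.
by have := addbox_rowP mv mi k; rewrite h => /addIn.
Qed.

(** The strict bound on [size v] leaves room for a box that opens a new row. Row 0 always accepts a
    box, so vanishing is only asked at successors. *)
Lemma big_addbox N (v : intpart) (Phi : nat -> R) (F : intpart -> R) :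
  (size v < N)%N ->
  (forall m i, (i < N)%N -> (forall k, part m k = (part v k + (k == i))%N) -> Phi i = F m) ->
  (forall i, (i.+1 < N)%N -> part v i.+1 = part v i -> Phi i.+1 = 0) ->
  \sum_(i < N) Phi i = \sum_(m <- intparts (psize v).+1 | addbox v m) F m.
Proof.
move=> vN PF P0.
transitivity (\sum_(m <- intparts (psize v).+1 | addbox v m)
    \sum_(i < N | (part v i < part m i)%N) F m); last first.
  by apply: eq_bigr => l lv; rewrite big_addbox_row.
rewrite (exchange_big_dep xpredT) //=.
apply: eq_bigr => -[i iN] _ /=.
case: (boolP ((0 < i) && (part v i.-1 <= part v i))%N) => [/andP[]|].
  case: i iN => //= i iN _ pi.
  rewrite P0 //; last by apply/eqP; rewrite eqn_leq pi part_anti.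
  rewrite big1 // => l /andP[lv /(addbox_rowP lv) h].
  have := part_anti l (leqnSn i).
  by move: pi; rewrite !h eqxx (ltn_eqF (ltnSn i)); lia.
rewrite negb_and -leqNgt -ltnNge => pi.
have [m h] : exists m : intpart, part m =1 (fun k => part v k + (k == i))%N.
  apply: (@intpart_of _ N) => [k|]; last first.
    by rewrite part_default ?(ltnW vN) //; case: eqP => //; lia.
  have := part_anti v (leqnSn k).
  case: (k.+1 =P i) pi => [<- /=|_ _]; last by lia.
  by rewrite -ltnS => + _; case: eqP => //=; lia.
have lv := addbox_of h.
rewrite (PF _ _ iN h) (big_seq_unique _ (x := m)) ?intparts_uniq //.
- by rewrite mem_intparts (addbox_psize lv).
- by rewrite lv h eqxx addn1 ltnSn.
by move=> l /andP[mv mi]; apply: eq_intpart => k; rewrite (addbox_rowP mv mi) h.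
Qed.

End BoxSums.

Lemma big_boxes (R : Type) (idx : R) (op : Monoid.com_law idx) N (l : intpart)
    (f : nat * nat -> R) : (size l <= N)%N ->
  \big[op/idx]_(b <- boxes l) f b =
  \big[op/idx]_(i < N) \big[op/idx]_(j < part l i) f (val i, val j).
Proof.
move=> lN; rewrite /boxes big_allpairs_dep /=.
rewrite -(big_mkord xpredT (fun i => \big[op/idx]_(j < part l i) f (i, val j))).
rewrite [RHS](big_cat_nat (n := size l)) //= [X in _ = op _ X]big_nat.
rewrite [X in _ = op _ X]big1 ?Monoid.mulm1 => [|i /andP[/part_default-> _]]; last exact: big_ord0.
rewrite {1}/index_iota subn0; apply: eq_bigr => i _.
by rewrite -(big_mkord xpredT (fun j => f (i, j))) /index_iota subn0.
Qed.

Lemma big_boxes_addbox (R : Type) (idx : R) (op : Monoid.com_law idx) (l m : intpart) i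
    (f : nat * nat -> R) : (forall k, part m k = (part l k + (k == i))%N) ->
  \big[op/idx]_(b <- boxes m) f b = op (\big[op/idx]_(b <- boxes l) f b) (f (i, part l i)).
Proof.
move=> h; pose N := (size l + size m + i.+1)%N.
rewrite (@big_boxes _ _ _ N m) ?(@big_boxes _ _ _ N l); try (rewrite /N; lia).
have iN : (i < N)%N by rewrite /N; lia.
rewrite (bigD1 (Ordinal iN)) //= [in RHS](bigD1 (Ordinal iN)) //=.
rewrite h eqxx addn1 big_ord_recr /= Monoid.mulmAC; congr (op (op _ _) _).
by apply: eq_bigr => k /negPf; rewrite -val_eqE /= h => ->; rewrite addn0.
Qed.

(** The content of the first free place to the right of row [i]. Differences of these numbers are
    the indices in the Jacobi-Trudi matrices. *)
Definition pcontent (l : intpart) (i : nat) : int := (part l i)%:Z - i%:Z.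

Lemma kappa_addbox l m i : (forall k, part m k = (part l k + (k == i))%N) ->
  kappa m = kappa l + 2 * pcontent l i.
Proof. by move=> h; rewrite /kappa (big_boxes_addbox _ _ h) mulrDr. Qed.

Lemma content_sum_addbox (K : fieldType) (s : K) l m i :
  (forall k, part m k = (part l k + (k == i))%N) ->
  content_sum s m = content_sum s l + s ^ pcontent l i.
Proof. by move=> h; rewrite /content_sum (big_boxes_addbox _ _ h). Qed.

(** Each row is a telescoping geometric sum. This ties the eigenvalue [C_l] to the row parameters of
    the determinants, up to terms independent of [l]. *)
Lemma content_sum_rows (K : fieldType) (s : K) N (l : intpart) : s != 0 -> (size l <= N)%N ->
  (s - 1) * content_sum s l = \sum_(i < N) (s ^ pcontent l i - s ^ (- i%:Z)).
Proof.
move=> s0 lN; rewrite /content_sum (big_boxes _ _ lN) mulr_sumr; apply: eq_bigr => i _.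
rewrite /pcontent mulr_sumr /content /=.
elim: (part l i) => [|p IHp]; first by rewrite big_ord0 sub0r subrr.
rewrite big_ord_recr /= IHp.
have -> : p.+1%:Z - i%:Z = (p%:Z - i%:Z) + 1 by lia.
by rewrite (expfzDr (p%:Z - i%:Z) 1) // expr1z; ring.
Qed.

(** * Determinants of the coefficients of g *)

Section DetDerivation.
Variables (R : comPzRingType) (n : nat).
Implicit Types (A B : 'M[R]_n) (x : 'I_n -> R).

Definition rowrep A B i := \matrix_(k, l) (if k == i then B k l else A k l).
Definition colrep A B j := \matrix_(k, l) (if l == j then B k l else A k l).

(* The derivative of the determinant at A in the direction B. *)
Definition ddet A B := \sum_i \det (rowrep A B i).

Lemma det_rowrep A B i : \det (rowrep A B i) =
  \sum_(s : 'S_n) (-1) ^+ s * (B i (s i) * \prod_(k | k != i) A k (s k)).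
Proof.
apply: eq_bigr => s _; rewrite (bigD1 i) //= mxE eqxx; congr (_ * (_ * _)).
by apply: eq_bigr => k /negPf ki; rewrite mxE ki.
Qed.

Lemma det_colrep A B j : \det (colrep A B j) =
  \sum_(s : 'S_n) (-1) ^+ s *
    \sum_(i | s i == j) (B i (s i) * \prod_(k | k != i) A k (s k)).
Proof.
apply: eq_bigr => s _; congr (_ * _).
rewrite [in RHS](big_pred1 (s^-1 j)%g) => [|i]; last first.
  by rewrite /= (can2_eq (permK s) (permKV s)).
rewrite (bigD1 (s^-1 j)%g) //= mxE permKV eqxx; congr (_ * _).
apply: eq_bigr => k kj; rewrite mxE ifN //.
by apply: contraNneq kj => <-; rewrite permK.
Qed.

Lemma ddetE A B : ddet A B =
  \sum_(s : 'S_n) (-1) ^+ s * \sum_i (B i (s i) * \prod_(k | k != i) A k (s k)).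
Proof.
rewrite /ddet; under eq_bigr => i _ do rewrite det_rowrep.
by rewrite exchange_big /=; apply: eq_bigr => s _; rewrite mulr_sumr.
Qed.

(** For a fixed permutation [s] the replaced entry [(i, s i)] may be indexed by its row or by its
    column. *)
Lemma ddet_col A B : ddet A B = \sum_j \det (colrep A B j).
Proof.
rewrite ddetE; under [RHS]eq_bigr => j _ do rewrite det_colrep.
rewrite [RHS]exchange_big /=; apply: eq_bigr => s _; rewrite -mulr_sumr.
congr (_ * _); rewrite (exchange_big_dep xpredT) //=; apply: eq_bigr => i _.
by rewrite [RHS](big_pred1 (s i)) // => j; rewrite /= eq_sym.
Qed.

Lemma ddetB A B C : ddet A (B - C) = ddet A B - ddet A C.
Proof.
rewrite !ddetE -sumrB; apply: eq_bigr => s _; rewrite -mulrBr -sumrB.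
by congr (_ * _); apply: eq_bigr => i _; rewrite !mxE mulrBl.
Qed.

Lemma det_rowrepZ A B x i :
  \det (rowrep A (\matrix_(k, l) (x k * B k l)) i) = x i * \det (rowrep A B i).
Proof.
by rewrite !det_rowrep mulr_sumr; apply: eq_bigr => s _; rewrite mxE -mulrA mulrCA.
Qed.

Lemma ddet_rowZ A B x :
  ddet A (\matrix_(k, l) (x k * B k l)) = \sum_i x i * \det (rowrep A B i).
Proof. by apply: eq_bigr => i _; exact: det_rowrepZ. Qed.

Lemma ddet_colZ A B x :
  ddet A (\matrix_(k, l) (x l * B k l)) = \sum_j x j * \det (colrep A B j).
Proof.
rewrite ddet_col; apply: eq_bigr => j _; rewrite !det_colrep mulr_sumr.
apply: eq_bigr => s _; rewrite mulrCA; congr (_ * _); rewrite mulr_sumr.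
by apply: eq_bigr => i /eqP <-; rewrite mxE mulrA.
Qed.

Lemma ddet_rowZ_id A x : ddet A (\matrix_(k, l) (x k * A k l)) = (\sum_i x i) * \det A.
Proof.
rewrite ddet_rowZ mulr_suml; apply: eq_bigr => i _; congr (_ * \det _).
by apply/matrixP => k l; rewrite mxE if_same.
Qed.

Lemma ddet_colZ_id A x : ddet A (\matrix_(k, l) (x l * A k l)) = (\sum_j x j) * \det A.
Proof.
rewrite ddet_colZ mulr_suml; apply: eq_bigr => i _; congr (_ * \det _).
by apply/matrixP => k l; rewrite mxE if_same.
Qed.

End DetDerivation.

Section JacobiTrudi.
Variables (K : fieldType) (q u : K).
Hypothesis q0 : q != 0.
Hypothesis qgen : forall k, (0 < k)%N -> q ^+ k - q ^- k != 0.

Local Notation z := (q - q^-1).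
Local Notation t := (q ^+ 2).

(* The coefficients of g (x) = exp (sum_k u^k x^k / (k (q^k - q^-k))). *)
Definition gcoef (k : int) : K :=
  if k is Posz n then \prod_(j < n) (u * q ^+ j / (q ^+ j.+1 - q ^- j.+1)) else 0.

Lemma z_neq0 : z != 0. Proof. by have := @qgen 1 isT; rewrite !expr1. Qed.

Lemma t_neq0 : t != 0. Proof. exact: expf_neq0. Qed.

Lemma gcoef_neg k : k < 0 -> gcoef k = 0. Proof. by case: k. Qed.

Lemma gcoef0 : gcoef 0 = 1. Proof. exact: big_ord0. Qed.

Lemma gcoef1 : gcoef 1 = u / z.
Proof. by rewrite /= big_ord1 expr0 mulr1 !expr1. Qed.

(** The functional equation [g (q^2 x) (1 - u q x) = g (x)] on coefficients. It holds for every
    integer [k], since both sides vanish for [k <= 0]. *)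
Lemma gcoef_rec k : (t ^ k - 1) * gcoef k = u / q * t ^ k * gcoef (k - 1).
Proof.
case: k => [[|n]|n]; first by rewrite expr0z subrr mul0r [gcoef (_ - _)]gcoef_neg ?mulr0.
  have -> : n.+1%:Z - 1 = n%:Z by lia.
  rewrite /= big_ord_recr /=; set P := \prod_(_ < _) _.
  have := @qgen n.+1 isT; rewrite -[t ^ n.+1]exprM mulnC exprM.
  have -> : q ^+ n = q ^+ n.+1 / q by rewrite exprSr mulfK.
  set Q := q ^+ n.+1; have Q0 : Q != 0 by exact: expf_neq0.
  have -> : Q ^+ 2 - 1 = Q * (Q - Q^-1) by rewrite mulrBr -expr2 mulfV.
  by move: (Q - Q^-1) => D D0; field; rewrite D0 q0.
by rewrite ![gcoef _]gcoef_neg ?mulr0 //; lia.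
Qed.

Definition jt N (f h : nat -> int) : K :=
  \det (\matrix_(i < N, j < N) gcoef (f i - h j)).

Definition shift (f : nat -> int) (i : nat) (d : int) (k : nat) : int :=
  if k == i then f k + d else f k.

Lemma eq_jt N f f' h h' : (forall i, (i < N)%N -> f i = f' i) ->
  (forall i, (i < N)%N -> h i = h' i) -> jt N f h = jt N f' h'.
Proof.
move=> ff hh; congr (\det _); apply/matrixP => i j.
by rewrite !mxE ff // hh.
Qed.

Lemma jt_row_eq N f h i j : (i < N)%N -> (j < N)%N -> i != j -> f i = f j ->
  jt N f h = 0.
Proof.
move=> iN jN ij fij; apply: (@determinant_alternate _ _ _ (Ordinal iN) (Ordinal jN)) => // k.
by rewrite !mxE /= fij.
Qed.

Lemma jt_col_eq N f h i j : (i < N)%N -> (j < N)%N -> i != j -> h i = h j ->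
  jt N f h = 0.
Proof.
move=> iN jN ij hij; rewrite /jt -det_tr.
apply: (@determinant_alternate _ _ _ (Ordinal iN) (Ordinal jN)) => // k.
by rewrite !mxE /= hij.
Qed.

Lemma jtS N f h : (forall j, (j < N)%N -> f N < h j) ->
  jt N.+1 f h = gcoef (f N - h N) * jt N f h.
Proof.
move=> fh; rewrite /jt (expand_det_row _ ord_max) big_ord_recr /= mxE /=.
rewrite big1 ?add0r => [|j _]; last by rewrite mxE /= gcoef_neg ?mul0r // subr_lt0 fh.
congr (_ * _); rewrite /cofactor addnn -signr_odd odd_double expr0 mul1r.
by congr (\det _); apply/matrixP => i j; rewrite !mxE !lift_max.
Qed.

Section Shifts.
Variables (N : nat) (f h : nat -> int).
Let A := \matrix_(i < N, j < N) gcoef (f i - h j).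
Let E d := \matrix_(i < N, j < N) gcoef (f i - h j + d).

Let rowE i d : \det (rowrep A (E d) i) = jt N (shift f i d) h.
Proof.
congr (\det _); apply/matrixP => k l; rewrite !mxE /shift -val_eqE /=.
by case: eqP => // _; rewrite addrAC.
Qed.

Let colE j d : \det (colrep A (E (- d)) j) = jt N f (shift h j d).
Proof.
congr (\det _); apply/matrixP => k l; rewrite !mxE /shift -val_eqE /=.
by case: eqP => // _; rewrite opprD addrA.
Qed.

Let colE1 (j : 'I_N) : jt N f (shift h j (-1)) = \det (colrep A (E 1) j).
Proof. by rewrite -colE opprK. Qed.

(** Both sides are the derivative of the determinant in the direction [E d], expanded by rows and by
    columns. *)
Lemma jt_shift d : \sum_(i < N) jt N (shift f i d) h = \sum_(j < N) jt N f (shift h j (- d)).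
Proof.
transitivity (ddet A (E d)); first by apply: eq_bigr => i _; rewrite rowE.
by rewrite ddet_col; apply: eq_bigr => j _; rewrite -colE opprK.
Qed.

(** In the direction with entries [(t ^ f i - t ^ h j) * A i j] the derivative is a multiple of the
    determinant; by [gcoef_rec] the same entries are [u / q * t ^ f i] times entries shifted by -1.
    The next three lemmas vary this with opposite exponents, or with [gcoef_rec] applied to entries
    shifted by +1, where [A] itself appears on the right. *)
Lemma jt_shift_row_down :
  (\sum_(i < N) t ^ f i - \sum_(j < N) t ^ h j) * jt N f h =
  u / q * \sum_(i < N) t ^ f i * jt N (shift f i (-1)) h.
Proof.
rewrite [RHS]mulr_sumr mulrBl -ddet_rowZ_id -(ddet_colZ_id A (fun j => t ^ h j)) -ddetB.
under eq_bigr => i _ do rewrite mulrA -rowE.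
rewrite -ddet_rowZ; congr (ddet A _); apply/matrixP => i j; rewrite !mxE.
have e : t ^ f i = t ^ h j * t ^ (f i - h j).
  by rewrite -expfzDr ?t_neq0 //; congr (_ ^ _); lia.
rewrite -mulrBl e -[X in _ - X]mulr1 -mulrBr -mulrA gcoef_rec; ring.
Qed.

Lemma jt_shift_col_up :
  (\sum_(j < N) t ^ (- h j) - \sum_(i < N) t ^ (- f i)) * jt N f h =
  u / q * \sum_(j < N) t ^ (- h j) * jt N f (shift h j 1).
Proof.
rewrite [RHS]mulr_sumr mulrBl -(ddet_rowZ_id A (fun i => t ^ (- f i))).
rewrite -(ddet_colZ_id A (fun j => t ^ (- h j))) -ddetB.
under eq_bigr => i _ do rewrite mulrA -colE.
rewrite -(ddet_colZ A (E (-1)) (fun j => u / q * t ^ (- h j))).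
congr (ddet A _); apply/matrixP => i j; rewrite !mxE.
have e : t ^ (- h j) = t ^ (- f i) * t ^ (f i - h j).
  by rewrite -expfzDr ?t_neq0 //; congr (_ ^ _); lia.
by rewrite -mulrBl e -[X in _ - X]mulr1 -mulrBr -mulrA gcoef_rec; ring.
Qed.

Lemma jt_shift_row_up :
  \sum_(i < N) t ^ f i * jt N (shift f i 1) h -
  t^-1 * (\sum_(j < N) t ^ h j * jt N f (shift h j (-1))) =
  u / q * (\sum_(i < N) t ^ f i) * jt N f h.
Proof.
rewrite -mulrA mulr_suml [in LHS]mulr_sumr [RHS]mulr_sumr.
under eq_bigr => i _ do rewrite -rowE.
under [X in _ - X]eq_bigr => i _ do rewrite mulrA colE1.
rewrite -(ddet_rowZ A (E 1) (fun i => t ^ f i)).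
rewrite -(ddet_colZ A (E 1) (fun j => t^-1 * t ^ h j)) -ddetB.
under [RHS]eq_bigr => i _ do rewrite mulrA.
rewrite -mulr_suml -ddet_rowZ_id; congr (ddet A _); apply/matrixP => i j; rewrite !mxE.
have e : t ^ f i = t^-1 * t ^ h j * t ^ (f i - h j + 1).
  by rewrite -exprN1 -!expfzDr ?t_neq0 //; congr (_ ^ _); lia.
rewrite -mulrBl {1}e -[X in _ - X]mulr1 -mulrBr -mulrA gcoef_rec e addrK; ring.
Qed.

Lemma jt_shift_col_down :
  \sum_(j < N) t * t ^ (- h j) * jt N f (shift h j (-1)) -
  \sum_(i < N) t ^ (- f i) * jt N (shift f i 1) h =
  u / q * (\sum_(j < N) t * t ^ (- h j)) * jt N f h.
Proof.
under [X in _ - X]eq_bigr => i _ do rewrite -rowE.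
under [X in X - _]eq_bigr => j _ do rewrite colE1.
rewrite -(ddet_rowZ A (E 1) (fun i => t ^ (- f i))).
rewrite -(ddet_colZ A (E 1) (fun j => t * t ^ (- h j))) -ddetB.
rewrite [X in _ = X * _]mulr_sumr -ddet_colZ_id; congr (ddet A _); apply/matrixP => i j; rewrite !mxE.
have e : t * t ^ (- h j) = t ^ (- f i) * t ^ (f i - h j + 1).
  by rewrite -[t in LHS]expr1z -!expfzDr ?t_neq0 //; congr (_ ^ _); lia.
rewrite -mulrBl {1}e -[X in _ - X]mulr1 -mulrBr -mulrA gcoef_rec e addrK; ring.
Qed.

End Shifts.

End JacobiTrudi.

(** * The kernel of G_u *)

Lemma pcontent_default (l : intpart) i : (size l <= i)%N -> pcontent l i = - i%:Z.
Proof. by move=> li; rewrite /pcontent part_default // sub0r. Qed.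

Lemma pcontent_ge (l : intpart) i : - i%:Z <= pcontent l i.
Proof. by rewrite /pcontent; lia. Qed.

Lemma pcontent_addbox (l m : intpart) i : (forall k, part m k = (part l k + (k == i))%N) ->
  shift (pcontent l) i 1 =1 pcontent m.
Proof. by move=> h k; rewrite /shift /pcontent h; case: eqP => _; lia. Qed.

Lemma pcontent_rembox (l m : intpart) i : (forall k, part m k = (part l k + (k == i))%N) ->
  shift (pcontent m) i (-1) =1 pcontent l.
Proof. by move=> h k; rewrite /shift /pcontent h; case: eqP => _; lia. Qed.

Lemma size_addrow (l m : intpart) i N : (forall k, part m k = (part l k + (k == i))%N) ->
  (size l <= N)%N -> (i < N)%N -> (size m <= N)%N.
Proof.
move=> h lN iN; rewrite leqNgt -part_gt0 h part_default // add0n.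
by rewrite lt0b gtn_eqF.
Qed.

Lemma size_remrow (l l' : intpart) i N : (forall k, part l' k = (part l k + (k == i))%N) ->
  (size l' <= N)%N -> (size l <= N)%N.
Proof. by move=> /addbox_of/addbox_size; exact: leq_trans. Qed.

Section SkewKernel.
Variables (K : fieldType) (q u : K).
Hypothesis q0 : q != 0.
Hypothesis qgen : forall k, (0 < k)%N -> q ^+ k - q ^- k != 0.

Local Notation z := (q - q^-1).
Local Notation t := (q ^+ 2).
Local Notation jt := (jt q u).

(* The coefficient of W_v in W_m times the series of gcoef, by the Jacobi-Trudi formula
   for the skew shape v / m. *)
Definition skewk (v m : intpart) : K :=
  jt (maxn (size v) (size m)) (pcontent v) (pcontent m).

(** Beyond both lengths a further row has [gcoef 0 = 1] on the diagonal and negative indices, hence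
    zeros, to its left. *)
Lemma jt_skewk N (v m : intpart) : (size v <= N)%N -> (size m <= N)%N ->
  jt N (pcontent v) (pcontent m) = skewk v m.
Proof.
clear q0 qgen => vN mN.
have h k : jt (maxn (size v) (size m) + k) (pcontent v) (pcontent m) = skewk v m.
  elim: k => [|k IHk]; rewrite ?addn0 // addnS jtS => [|j jk].
    by rewrite !pcontent_default ?subrr ?gcoef0 ?mul1r //; lia.
  rewrite pcontent_default; last by lia.
  by apply: lt_le_trans (pcontent_ge _ _); lia.
by rewrite -(h (N - maxn (size v) (size m))%N) subnKC // geq_max vN.
Qed.

(** A box of content [c] changes [kappa] by [2 c], so the weights [t ^ pcontent] of the determinant
    identities are those of conjugation by [T]. *)
Lemma kappa_shift (l m : intpart) i (e : int) :
  (forall k, part m k = (part l k + (k == i))%N) ->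
  q ^ (e * (kappa m - kappa l)) = (t ^ pcontent l i) ^ e.
Proof.
move=> /kappa_addbox ->; rewrite addrAC subrr add0r [q ^+ 2]exprnP !exprz_exp.
by congr (q ^ _); ring.
Qed.

Section Sums.
Variables (e : int) (N : nat) (v m : intpart).
Hypotheses (vN : (size v <= N)%N) (mN : (size m <= N)%N).

Lemma sum_row_up :
  \sum_(i < N.+1) (t ^ pcontent v i) ^ e * jt N.+1 (shift (pcontent v) i 1) (pcontent m) =
  \sum_(l <- intparts (psize v).+1 | addbox v l) q ^ (e * (kappa l - kappa v)) * skewk l m.
Proof.
pose Phi i := (t ^ pcontent v i) ^ e * jt N.+1 (shift (pcontent v) i 1) (pcontent m).
rewrite (eq_bigr (fun i => Phi (val i))) //; apply: big_addbox => // [l i iN h|i iN vi].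
  rewrite (kappa_shift _ h) -(@jt_skewk N.+1) ?(leqW mN) ?(size_addrow h (leqW vN) iN) //.
  by congr (_ * _); apply: eq_jt => // k _; rewrite (pcontent_addbox h).
rewrite /Phi (@jt_row_eq _ _ _ _ _ _ i.+1 i) ?mulr0 ?(ltnW iN) ?gtn_eqF //.
by rewrite /shift eqxx (ltn_eqF (ltnSn i)) /pcontent vi; lia.
Qed.

Lemma sum_col_up :
  \sum_(j < N.+1) (t ^ pcontent m j) ^ e * jt N.+1 (pcontent v) (shift (pcontent m) j 1) =
  \sum_(l <- intparts (psize m).+1 | addbox m l) q ^ (e * (kappa l - kappa m)) * skewk v l.
Proof.
pose Phi i := (t ^ pcontent m i) ^ e * jt N.+1 (pcontent v) (shift (pcontent m) i 1).
rewrite (eq_bigr (fun i => Phi (val i))) //; apply: big_addbox => // [l i iN h|i iN vi].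
  rewrite (kappa_shift _ h) -(@jt_skewk N.+1) ?(leqW vN) ?(size_addrow h (leqW mN) iN) //.
  by congr (_ * _); apply: eq_jt => // k _; rewrite (pcontent_addbox h).
rewrite /Phi (@jt_col_eq _ _ _ _ _ _ i.+1 i) ?mulr0 ?(ltnW iN) ?gtn_eqF //.
by rewrite /shift eqxx (ltn_eqF (ltnSn i)) /pcontent vi; lia.
Qed.

(** The factor [t ^ e] arises because [pcontent l' i] is one more than the content of the last box
    of row [i]. *)
Lemma kappa_shift_down (l l' : intpart) i : (forall k, part l' k = (part l k + (k == i))%N) ->
  (t ^ pcontent l' i) ^ e = t ^ e * q ^ (e * (kappa l' - kappa l)).
Proof.
move=> h; rewrite (kappa_shift _ h) -expfzMl.
rewrite /pcontent h eqxx -{2}[t]expr1z -expfzDr ?t_neq0 //; congr ((_ ^ _) ^ _); lia.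
Qed.

Lemma sum_row_down :
  \sum_(i < N.+1) (t ^ pcontent v i) ^ e * jt N.+1 (shift (pcontent v) i (-1)) (pcontent m) =
  t ^ e * \sum_(l <- intparts (psize v).-1 | addbox l v) q ^ (e * (kappa v - kappa l)) * skewk l m.
Proof.
rewrite big_ord_recr /= jtS; last first.
  move=> j jN; rewrite /shift eqxx pcontent_default //.
  by apply: lt_le_trans (pcontent_ge _ _); lia.
rewrite gcoef_neg ?mul0r ?mulr0 ?addr0; last first.
  by rewrite /shift eqxx !pcontent_default //; lia.
pose Phi i := (t ^ pcontent v i) ^ e * jt N.+1 (shift (pcontent v) i (-1)) (pcontent m).
rewrite (eq_bigr (fun i => Phi (val i))) // mulr_sumr.
apply: big_rembox => // [l i iN h|i iN vi].
  rewrite mulrA -(kappa_shift_down h) -(@jt_skewk N.+1) ?leqW ?(size_remrow h) //.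
  by congr (_ * _); apply: eq_jt => // k _; rewrite (pcontent_rembox h).
rewrite /Phi (@jt_row_eq _ _ _ _ _ _ i i.+1) ?mulr0 ?ltn_eqF // ?ltnS ?(ltnW iN) //.
by rewrite /shift eqxx (gtn_eqF (ltnSn i)) /pcontent vi; lia.
Qed.

(** Lowering the parameter of the last, empty, column does not correspond to removing a box, but its
    term survives: the last diagonal entry becomes [gcoef 1 = u / z]. Hence the second summand, the
    origin of the scalar terms in the commutators with box removal. In [sum_row_down] that entry is
    [gcoef (-1) = 0]. *)
Lemma sum_col_down :
  \sum_(j < N.+1) (t ^ pcontent m j) ^ e * jt N.+1 (pcontent v) (shift (pcontent m) j (-1)) =
  t ^ e * \sum_(l <- intparts (psize m).-1 | addbox l m) q ^ (e * (kappa m - kappa l)) * skewk v l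
  + (t ^ (- N%:Z)) ^ e * (u / z) * skewk v m.
Proof.
rewrite big_ord_recr /= jtS; last first.
  move=> j jN; rewrite /shift ltn_eqF // pcontent_default //.
  by apply: lt_le_trans (pcontent_ge _ _); lia.
congr (_ + _); last first.
  rewrite /shift eqxx !pcontent_default // opprD opprK addrA addNr add0r gcoef1 -[RHS]mulrA.
  rewrite -(jt_skewk vN mN); congr (_ * (_ * _)).
  by apply: eq_jt => // j jN; rewrite ltn_eqF.
pose Phi i := (t ^ pcontent m i) ^ e * jt N.+1 (pcontent v) (shift (pcontent m) i (-1)).
rewrite (eq_bigr (fun i => Phi (val i))) // mulr_sumr.
apply: big_rembox => // [l i iN h|i iN vi].
  rewrite mulrA -(kappa_shift_down h) -(@jt_skewk N.+1) ?leqW ?(size_remrow h) //.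
  by congr (_ * _); apply: eq_jt => // k _; rewrite (pcontent_rembox h).
rewrite /Phi (@jt_col_eq _ _ _ _ _ _ i i.+1) ?mulr0 ?ltn_eqF // ?ltnS ?(ltnW iN) //.
by rewrite /shift eqxx (gtn_eqF (ltnSn i)) /pcontent vi; lia.
Qed.

End Sums.

(** [M_e] on coefficient families. With these weights [addop e] and [remop e] are transposes of each
    other, so an operator applied before [G_u] acts on the second index of the kernel as the
    opposite operator with the same [e]. *)
Definition addop (e : int) (F : intpart -> K) (v : intpart) : K :=
  \sum_(l <- intparts (psize v).-1 | addbox l v) q ^ (e * (kappa v - kappa l)) * F l.

Definition remop (e : int) (F : intpart -> K) (v : intpart) : K :=
  \sum_(l <- intparts (psize v).+1 | addbox v l) q ^ (e * (kappa l - kappa v)) * F l.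

Lemma addop_skewk v m : addop 0 (skewk^~ m) v = remop 0 (skewk v) m.
Proof.
pose N := (size v + size m)%N; have vN := leq_addr (size m) (size v) : (size v <= N)%N.
have mN := leq_addl (size v) (size m) : (size m <= N)%N.
have E := sum_row_down 0 vN mN; rewrite expr0z mul1r in E.
rewrite /addop -E /remop -(sum_col_up 0 vN mN).
under eq_bigr => i _ do rewrite expr0z mul1r.
under [RHS]eq_bigr => i _ do rewrite expr0z mul1r.
by rewrite jt_shift opprK.
Qed.

(** Removing a box is the derivation with respect to the power sum [p_1], and [u / z] is the
    coefficient of [p_1] in the logarithm of the series of [G_u]. *)
Lemma remop_skewk v m :
  remop 0 (skewk^~ m) v = addop 0 (skewk v) m + u / z * skewk v m.
Proof.
pose N := (size v + size m)%N; have vN := leq_addr (size m) (size v) : (size v <= N)%N.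
have mN := leq_addl (size v) (size m) : (size m <= N)%N.
have E := sum_col_down 0 vN mN; rewrite !expr0z !mul1r in E.
rewrite /addop -E /remop -(sum_row_up 0 vN mN).
under eq_bigr => i _ do rewrite expr0z mul1r.
under [RHS]eq_bigr => i _ do rewrite expr0z mul1r.
by rewrite jt_shift.
Qed.

Lemma sum_pcontent N (l : intpart) : (size l <= N)%N ->
  \sum_(i < N) t ^ pcontent l i =
  (t - 1) * content_sum t l + \sum_(i < N) t ^ (- i%:Z).
Proof. by move=> lN; rewrite (content_sum_rows _ lN) ?t_neq0 // sumrB subrK. Qed.

Lemma sum_pcontentN N (l : intpart) : (size l <= N)%N ->
  \sum_(i < N) t ^ (- pcontent l i) =
  (t^-1 - 1) * content_sum t^-1 l + \sum_(i < N) t ^+ i.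
Proof.
move=> lN; rewrite (content_sum_rows _ lN) ?invr_eq0 ?t_neq0 // sumrB.
under [X in X - _ + _]eq_bigr => i _ do rewrite exprz_inv.
by under [X in _ - X + _]eq_bigr => i _ do rewrite exprz_inv opprK; rewrite subrK.
Qed.

Lemma t_sub1 : t - 1 = q * z. Proof. by rewrite mulrBr mulfV. Qed.

Lemma tV_sub1 : t^-1 - 1 = - q^-1 * z.
Proof. by field. Qed.

(** Kernel form of [z [C, G_u] = u M_1 G_u]. The parts of the row and column sums that depend on the
    matrix size cancel. *)
Lemma addop1_skewk v m :
  z * (content_sum t v - content_sum t m) * skewk v m = u * addop 1 (skewk^~ m) v.
Proof.
pose N := (size v + size m)%N; have vN := leq_addr (size m) (size v) : (size v <= N)%N.
have mN := leq_addl (size v) (size m) : (size m <= N)%N.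
have := jt_shift_row_down u q0 qgen N.+1 (pcontent v) (pcontent m).
rewrite (@jt_skewk N.+1) ?leqW // !sum_pcontent ?leqW // opprD addrACA subrr addr0 -mulrBr t_sub1.
have := sum_row_down 1 vN mN; under eq_bigr => i _ do rewrite expr1z.
move=> ->; rewrite -/(addop 1 (skewk^~ m) v) expr1z => H.
by apply: (mulfI q0); rewrite !mulrA H; field.
Qed.

Lemma remopN1_skewk v m :
  z * (content_sum t^-1 v - content_sum t^-1 m) * skewk v m = u * remop (-1) (skewk v) m.
Proof.
pose N := (size v + size m)%N; have vN := leq_addr (size m) (size v) : (size v <= N)%N.
have mN := leq_addl (size v) (size m) : (size m <= N)%N.
have := jt_shift_col_up u q0 qgen N.+1 (pcontent v) (pcontent m).
rewrite (@jt_skewk N.+1) ?leqW // !sum_pcontentN ?leqW // opprD addrACA subrr addr0 -mulrBr tV_sub1.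
have := sum_col_up (-1) vN mN; under eq_bigr => i _ do rewrite exprz_exp mulrN1.
move=> ->; rewrite -/(remop (-1) (skewk v) m) => H.
apply: (mulfI (invr_neq0 q0)); rewrite [RHS]mulrA [_^-1 * u]mulrC -H; ring.
Qed.

Lemma remop1_skewk v m :
  remop 1 (skewk^~ m) v - u * z * content_sum t v * skewk v m =
  addop 1 (skewk v) m + u / z * skewk v m.
Proof.
pose N := (size v + size m)%N; have vN := leq_addr (size m) (size v) : (size v <= N)%N.
have mN := leq_addl (size v) (size m) : (size m <= N)%N.
have := jt_shift_row_up u q0 qgen N.+1 (pcontent v) (pcontent m).
rewrite (@jt_skewk N.+1) ?leqW // sum_pcontent ?leqW // t_sub1.
have := sum_row_up 1 vN mN; under eq_bigr => i _ do rewrite expr1z.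
move=> ->; rewrite -/(remop 1 (skewk^~ m) v).
have := sum_col_down 1 vN mN; under eq_bigr => i _ do rewrite expr1z.
move=> ->; rewrite -/(addop 1 (skewk v) m) !expr1z.
(* The part of this geometric sum containing [t ^ (- N)] cancels the boundary term of
   [sum_col_down], so the result does not depend on [N]. *)
have S : z * (\sum_(i < N.+1) t ^ (- i%:Z)) = q - q^-1 * t ^ (- N%:Z).
  elim: (N) => [|k IHk]; first by rewrite big_ord1 oppr0 expr0z !mulr1.
  rewrite big_ord_recr mulrDr IHk /=; have -> : - k.+1%:Z = - k%:Z - 1 by lia.
  by rewrite (expfzDr (- k%:Z) (-1)) ?t_neq0 // exprN1; field.
have zn := z_neq0 qgen.
rewrite (_ : \sum_(i < N.+1) _ = (q - q^-1 * t ^ (- N%:Z)) / z); last by rewrite -S mulrC mulKf.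
move: (t ^ (- N%:Z)) => T /eqP; rewrite subr_eq => /eqP ->.
move: (addop _ _ _) (skewk v m) (content_sum t v) => X Y C.
have z2 : q ^+ 2 - 1 != 0 by rewrite t_sub1 mulf_neq0.
by field; rewrite ?q0 ?z2.
Qed.

Lemma remopN1_skewk_up v m :
  remop (-1) (skewk^~ m) v =
  addop (-1) (skewk v) m + u / z * (1 + z ^+ 2 * content_sum t^-1 m) * skewk v m.
Proof.
pose N := (size v + size m)%N; have vN := leq_addr (size m) (size v) : (size v <= N)%N.
have mN := leq_addl (size v) (size m) : (size m <= N)%N.
have := jt_shift_col_down u q0 qgen N.+1 (pcontent v) (pcontent m).
rewrite (@jt_skewk N.+1) ?leqW // -mulr_sumr sum_pcontentN ?leqW // tV_sub1.
have := sum_row_up (-1) vN mN; under eq_bigr => i _ do rewrite exprz_exp mulrN1.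
move=> ->; rewrite -/(remop (-1) (skewk^~ m) v).
under eq_bigr => i _ do rewrite -mulrA.
rewrite -mulr_sumr.
have := sum_col_down (-1) vN mN; under eq_bigr => i _ do rewrite exprz_exp mulrN1.
move=> ->; rewrite -/(addop (-1) (skewk v) m) exprz_exp mulrN1 opprK exprN1.
have S : z * (\sum_(i < N.+1) t ^+ i) = q^-1 * (t * t ^ N - 1).
  elim: (N) => [|k IHk]; first by rewrite big_ord1 expr0z !mulr1 mulrBr mulKf // mulr1.
  by rewrite big_ord_recr mulrDr IHk -!exprnP /= [t ^+ k.+1]exprS; field.
have zn := z_neq0 qgen.
rewrite (_ : \sum_(i < N.+1) _ = q^-1 * (t * t ^ N - 1) / z); last by rewrite -S mulrC mulKf.
move: (t ^ N) => T; set L := (X in X - _ = _) => H; rewrite -[LHS](subKr L) {}H {}/L.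
move: (addop _ _ _) (skewk v m) (content_sum t^-1 m) => X Y C.
have z2 : q ^+ 2 - 1 != 0 by rewrite t_sub1 mulf_neq0.
by field; rewrite ?q0 ?z2.
Qed.

End SkewKernel.

(** * The hook formula *)

Lemma count_part N (l : intpart) (P : pred nat) : (size l <= N)%N -> ~~ P 0%N ->
  count P l = (\sum_(i < N) P (part l i))%N.
Proof.
move=> lN P0; rewrite -sum1_count big_mkcond (big_nth 0%N) /=.
rewrite -(big_mkord xpredT (fun i => nat_of_bool (P (part l i)))).
rewrite [RHS](big_cat_nat (n := size l)) //= [X in _ = (_ + X)%N]big_nat.
rewrite [X in _ = (_ + X)%N]big1 ?addn0 => [|i /andP[/part_default-> _]]; last by rewrite (negbTE P0).
by [].
Qed.

Lemma hook_behead (l l' : intpart) i j : (forall k, part l' k = (part l k).-1) ->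
  hook l (i, j.+1) = hook l' (i, j).
Proof.
move=> h; have l'l : (size l' <= size l)%N.
  by rewrite leqNgt -part_gt0 h part_default.
rewrite /hook /arm /leg /= h (@count_part (size l) l) // (@count_part (size l) l') //.
congr (_ + (_ - _)).+1%N; first by lia.
by apply: eq_bigr => k _; rewrite h; congr nat_of_bool; lia.
Qed.

Lemma hook_col0 (l : intpart) i : (i < size l)%N ->
  (hook l (i, 0%N))%:Z = pcontent l i + (size l)%:Z - 1.
Proof.
move=> il; rewrite /hook /arm /leg /= (@count_part (size l) l) //.
rewrite (eq_bigr (fun=> 1%N)) => [|k _]; last by rewrite part_gt0 ltn_ord.
have := part_gt0 l i; rewrite il => pi.
by rewrite sum_nat_const card_ord muln1 /pcontent; lia.
Qed.

Section HookFormula.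
Variables (K : fieldType) (q u : K).
Hypothesis q0 : q != 0.
Hypothesis qgen : forall k, (0 < k)%N -> q ^+ k - q ^- k != 0.
Hypothesis u0 : u != 0.

Local Notation z := (q - q^-1).
Local Notation t := (q ^+ 2).
Local Notation gcoef := (gcoef q u).

Definition hookprod (l : intpart) : K :=
  u ^+ psize l * \prod_(b <- boxes l) (q ^ content b / (q ^+ hook l b - q ^- hook l b)).

Lemma hookprod_behead (l l' : intpart) : (forall k, part l' k = (part l k).-1) ->
  hookprod l = hookprod l' *
    \prod_(i < size l) (u * q ^ (- i%:Z) * q ^ (part l' i)%:Z /
      (q ^ (pcontent l i + (size l)%:Z - 1) - q ^ (- (pcontent l i + (size l)%:Z - 1)))).
Proof.
move=> h; have l'l : (size l' <= size l)%N.
  by rewrite leqNgt -part_gt0 h part_default.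
rewrite /hookprod !(@big_boxes _ _ _ (size l)) //.
rewrite (@psizeE (size l) l) // (@psizeE (size l) l') //.
rewrite -!prodrXr -!big_split /=; apply: eq_bigr => i _.
have := part_gt0 l i; rewrite ltn_ord => pi.
rewrite -(prednK pi) -h big_ord_recl /= exprS /content /= sub0r -hook_col0 ?ltn_ord //.
rewrite -exprnP -exprnN.
rewrite (eq_bigr (fun j : 'I_(part l' i) => q * (q ^ content (val i, val j) /
    (q ^+ hook l' (val i, val j) - q ^- hook l' (val i, val j))))) => [|j _].
  rewrite big_split /= prodr_const card_ord; set P := \prod_(_ < _) _.
  by rewrite -exprnP; ring.
rewrite /bump /= add1n (hook_behead _ _ h) /content /=.
have -> : j.+1%:Z - i%:Z = (j%:Z - i%:Z) + 1 by lia.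
by rewrite (expfzDr (j%:Z - i%:Z) 1) // expr1z mulrA [q * _]mulrC.
Qed.

(* Expresses gcoef (k - s - 1) through (1 - t^-k) gcoef (k - r), r <= s; being triangular
   these relations give the effect of removing the first column of a diagram. *)
Fixpoint colop (s r : nat) : K :=
  (if r == s then t ^+ s else 0) +
  (if s is s'.+1 then (1 - t ^+ s) / (u / q) * colop s' r else 0).

Lemma colop_gt s r : (s < r)%N -> colop s r = 0.
Proof.
elim: s => [|s IHs] sr /=; first by rewrite gtn_eqF ?addr0.
by rewrite (gtn_eqF sr) IHs ?(ltnW sr) // mulr0 addr0.
Qed.

Lemma colop_diag s : colop s s = t ^+ s.
Proof.
case: s => [|s]; first by rewrite /= addr0.
by rewrite /= eqxx colop_gt // mulr0 addr0.
Qed.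

(** Induction on [s]: by [gcoef_rec], [u / q * gcoef (k - s - 2)] equals
    [(1 - t^(s+1-k)) * gcoef (k - s - 1)], and [1 - t^(s+1-k) = t^(s+1) (1 - t^-k) + (1 - t^(s+1))].
    The induction hypothesis rewrites the contribution of the second summand, which again brings out
    the factor [1 - t^-k]. *)
Lemma gcoef_colop s N (k : int) : (s < N)%N ->
  u / q * gcoef (k - s.+1%:Z) =
  (1 - t ^ (- k)) * \sum_(r < N) colop s r * gcoef (k - r%:Z).
Proof.
have tn := t_neq0 q0; have c0 : u / q != 0 by rewrite mulf_neq0 ?invr_eq0.
elim: s => [|s IHs] sN.
  rewrite (bigD1 (Ordinal sN)) //= big1 ?addr0 => [|r r0]; last first.
    have /negPf-> : val r != 0%N by apply: contraNneq r0 => r0; apply/eqP/val_inj.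
    by rewrite addr0 mul0r.
  rewrite expr0 ?addr0 mul1r; apply: (mulfI (expfz_neq0 k tn)).
  by rewrite mulrA [t ^ k * _]mulrC -gcoef_rec // mulrA mulrBr -expfzDr // subrr mulr1.
have -> : \sum_(r < N) colop s.+1 r * gcoef (k - r%:Z) =
    t ^+ s.+1 * gcoef (k - s.+1%:Z) +
    (1 - t ^+ s.+1) / (u / q) * \sum_(r < N) colop s r * gcoef (k - r%:Z).
  rewrite mulr_sumr -[in RHS](big_mkord xpredT (fun r => _ * (colop s r * gcoef (k - r%:Z)))).
  rewrite big_mkord (bigD1 (Ordinal sN)) // [in RHS](bigD1 (Ordinal sN)) //= eqxx.
  rewrite mulrDl !mulrA -addrA; congr (_ + (_ + _)).
  apply: eq_bigr => r /negPf; rewrite -val_eqE /= => ->.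
  by rewrite add0r mulrA.
rewrite mulrDr [X in _ = _ + X]mulrCA -IHs ?(ltnW sN) //.
have := gcoef_rec u q0 qgen (k - s.+1%:Z).
have -> : k - s.+1%:Z - 1 = k - s.+2%:Z by lia.
rewrite expfzDr // -invr_expz -[t ^ s.+1]exprnP -[t ^ (- k)]invr_expz.
have T0 : t ^ k != 0 by exact: expfz_neq0.
have S0 : t ^+ s.+1 != 0 by exact: expf_neq0.
move: (t ^ k) (t ^+ s.+1) T0 S0 => T S T0 S0.
move: (gcoef (k - s.+1%:Z)) (gcoef (k - s.+2%:Z)) => x y H.
apply: (mulfI T0); apply: (mulIf (invr_neq0 S0)).
transitivity (u / q * (T / S) * y); first by ring.
by rewrite -H; field; rewrite ?q0 ?S0 ?T0 ?u0.
Qed.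

(** The matrix of [l'], scaled by [u / q], factors as diagonal times the matrix of [l] times
    triangular. Here [k] is the hook length of the first box of row [i], and the indices of [B] are
    reversed because column [j] corresponds to [s = N - j - 1]. *)
Lemma skewk_behead (l l' : intpart) : (forall k, part l' k = (part l k).-1) ->
  skewk q u l part0 * \prod_(i < size l)
     ((1 - t ^ (- (pcontent l i + (size l)%:Z - 1))) * t ^+ (size l - i.+1)) =
  skewk q u l' part0 * (u / q) ^+ size l.
Proof.
move=> h; have l'l : (size l' <= size l)%N.
  by rewrite leqNgt -part_gt0 h part_default.
rewrite -!(@jt_skewk _ _ _ (size l)) // /jt; set N := size l.
have pN (i : 'I_N) : pcontent l' i = pcontent l i - 1.
  by have := part_gt0 l i; rewrite /pcontent h ltn_ord => pi; lia.
rewrite big_split /=.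
pose A := \matrix_(i < N, j < N) gcoef (pcontent l i - pcontent part0 j).
pose D := \row_(i < N) (1 - t ^ (- (pcontent l i + N%:Z - 1))).
pose B := \matrix_(r < N, j < N) colop (N - j.+1) (N - r.+1).
have -> : \prod_(i < N) (1 - t ^ (- (pcontent l i + N%:Z - 1))) = \det (diag_mx D).
  by rewrite det_diag; apply: eq_bigr => i _; rewrite mxE.
have -> : \prod_(i < N) t ^+ (N - i.+1) = \det B.
  rewrite det_trig; first by apply: eq_bigr => i _; rewrite mxE colop_diag.
  apply/is_trig_mxP => i j ij; rewrite mxE colop_gt //.
  by have := ltn_ord j; lia.
rewrite mulrCA [RHS]mulrC -detZ -!det_mulmx -/A.
congr (\det _); apply/matrixP => i j; rewrite mul_diag_mx !mxE.
under eq_bigr => r _ do rewrite !mxE.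
have jN := ltn_ord j.
have -> : pcontent l' i - pcontent part0 j = (pcontent l i + N%:Z - 1) - (N - j.+1).+1%:Z.
  by rewrite pN [pcontent part0 j]pcontent_default //; lia.
rewrite (gcoef_colop _ (N := N)); last by lia.
congr (_ * _); rewrite [RHS](reindex_inj rev_ord_inj) /=; apply: eq_bigr => r _.
have rN := ltn_ord r.
by rewrite [pcontent part0 r]pcontent_default // mulrC; congr (_ * gcoef _); lia.
Qed.

(** Induction by deleting the first column: the determinant and the hook product change by the same
    factor. *)
Lemma skewk_part0 (l : intpart) : skewk q u l part0 = hookprod l.
Proof.
have [n] := ubnP (psize l); elim: n l => // n IHn l; rewrite ltnS => ln.
have [l0|lN] := posnP (size l).
  have -> : l = part0 by apply: eq_intpart => k; rewrite !part_default // l0.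
  by rewrite /skewk /jt det_mx00 /hookprod big_nil mulr1.
have [l' h] : exists l' : intpart, part l' =1 (fun k => (part l k).-1).
  apply: (@intpart_of _ (size l)) => [k|]; last by rewrite part_default.
  by have := part_anti l (leqnSn k); lia.
have l'l : (size l' <= size l)%N.
  by rewrite leqNgt -part_gt0 h part_default.
have s' : (psize l' < n)%N.
  apply: leq_trans ln; rewrite (@psizeE (size l) l) // (@psizeE (size l) l') //.
  rewrite [X in (X < _)%N](bigD1 (Ordinal lN)) // [X in (_ < X)%N](bigD1 (Ordinal lN)) //=.
  rewrite -addSn leq_add //; first by rewrite h prednK // part_gt0.
  by apply: leq_sum => i _; rewrite h leq_pred.
have E := skewk_behead h; rewrite (IHn _ s') in E.
have P i : (i < size l)%N -> exists2 k, (0 < k)%N & pcontent l i + (size l)%:Z - 1 = k%:Z.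
  by move=> il; exists (hook l (i, 0%N)) => //; rewrite -hook_col0.
have tn := t_neq0 q0.
(* The exponents are hook lengths of the first column, hence positive, so no factor [1 - t ^ (- k)]
   vanishes. *)
have F0 : \prod_(i < size l)
    ((1 - t ^ (- (pcontent l i + (size l)%:Z - 1))) * t ^+ (size l - i.+1)) != 0.
  apply/prodf_neq0 => i _; rewrite mulf_neq0 ?expf_neq0 //.
  have [k k0 ->] := P _ (ltn_ord i); rewrite -invr_expz -exprnP -exprM.
  apply: contraNneq (qgen k0) => /eqP; rewrite subr_eq0 => /eqP e.
  have qk : q ^+ k != 0 by exact: expf_neq0.
  apply/eqP; apply: (mulIf (invr_neq0 qk)); rewrite mul0r mulrBl mulfV // -invfM -expr2 -exprM mulnC.
  by rewrite -e subrr.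
apply: (mulIf F0); rewrite E (hookprod_behead h) -[RHS]mulrA; congr (_ * _).
rewrite -big_split /=.
(* The inserted powers of [q] have total product 1, since [N - i - 1] and [i] run over the same
   values; with them the two sides agree row by row. *)
transitivity (\prod_(i < size l) (u / q * (q ^+ (size l - i.+1) * q ^- i))).
  rewrite big_split /= prodr_const card_ord big_split /=.
  rewrite [X in _ * (X * _)](reindex_inj rev_ord_inj) /= -big_split /= big1 ?mulr1 // => i _.
  by have -> : (size l - (size l - i.+1).+1 = i)%N; [have := ltn_ord i; lia | rewrite mulfV // expf_neq0].
apply: eq_bigr => i _; have iN := ltn_ord i.
have [k k0 e] := P _ iN; rewrite e -exprnN -!exprnP -!exprnN.
have -> : (1 - t ^- k) = q ^- k * (q ^+ k - q ^- k).
  rewrite mulrBr mulVf ?expf_neq0 // -invfM -exprD -exprM; congr (_ - _^-1); congr (_ ^+ _); lia.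
have -> : t ^+ (size l - i.+1) = q ^+ (size l - i.+1) * q ^+ (size l - i.+1).
  by rewrite -exprM -exprD; congr (_ ^+ _); lia.
have kE : q ^+ k = q * q ^+ (part l' i) * q ^+ (size l - i.+1).
  rewrite -exprS -exprD; congr (_ ^+ _).
  by have := part_gt0 l i; rewrite h iN => pi; move: e; rewrite /pcontent; lia.
move: (q ^+ k - q ^- k) (qgen k0) => D D0; rewrite kE.
field; rewrite ?D0 ?q0 ?expf_neq0 //.
Qed.

End HookFormula.

(** * Littlewood-Richardson coefficients *)

Lemma mem_intparts_le n (l : intpart) : (l \in intparts_le n) = (psize l <= n)%N.
Proof.
apply/flatten_mapP/idP => [[k]|ln]; first by rewrite mem_iota mem_intparts => + /eqP->.
by exists (psize l); rewrite ?mem_intparts // mem_iota.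
Qed.

Lemma intparts_le_uniq n : uniq (intparts_le n).
Proof.
have h s : uniq s -> uniq (flatten [seq intparts k | k <- s]).
  elim: s => //= k s IHs /andP[ks us]; rewrite cat_uniq intparts_uniq IHs // andbT.
  apply/hasPn => l /flatten_mapP[j js]; rewrite !mem_intparts => /eqP lj.
  by apply: contraNneq ks => <-; rewrite lj.
exact/h/iota_uniq.
Qed.

Lemma big_intparts_le (R : nmodType) n d (P : pred intpart) (F : intpart -> R) :
  (d <= n)%N -> (forall l, P l -> psize l != d -> F l = 0) ->
  \sum_(l <- intparts_le n | P l) F l = \sum_(l <- intparts d | P l) F l.
Proof.
move=> dn F0; rewrite (bigID (fun l => psize l == d)) /= [X in _ + X]big1 ?addr0; last first.
  by move=> l /andP[]; exact: F0.
rewrite -big_filter -[RHS]big_filter; apply: perm_big.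
apply: uniq_perm; rewrite ?filter_uniq ?intparts_le_uniq ?intparts_uniq //.
move=> l; rewrite !mem_filter mem_intparts mem_intparts_le -andbA; case: (P l) => //=.
by apply: andb_idr => /eqP->.
Qed.

Section LittlewoodRichardson.
Variables (K : fieldType) (q u : K).
Hypothesis factK : forall n, n`!%:R != 0 :> K.

Section Functional.
Variables n d : nat.
Local Notation expon := {ffun 'I_n -> 'I_d.+1}.

Let degd (f : expon) := (\sum_i f i == d)%N.
Let mon (f : expon) : 'X_{1..n} := [multinom val (f i) | i < n].
Let gprod (f : expon) : K := \prod_i gcoef q u (val (f i))%:Z.

(* The coefficient of x^e in the product of A and the degree d part of prod_i g (x_i). *)
Let pairing (A : {mpoly int[n]}) e : K :=
  \sum_(f | degd f) gprod f * ((A * 'X_[mon f])@_e)%:~R.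

(** The sum runs over all permutations, with repetitions. It is symmetric with integer coefficients,
    as [schur_expansion] requires, while the weights [gprod] lie in [K]; the repetitions produce the
    factor [n!] below. *)
Let symmon (f : expon) : {mpoly int[n]} :=
  \sum_(s : 'S_n) 'X_[[multinom mon f (s i) | i < n]].

Let symmon_sym f s : msym s (symmon f) = symmon f.
Proof.
rewrite /symmon raddf_sum (reindex_inj (mulgI s)) /=; apply: eq_bigr => t _.
rewrite msymX; congr 'X_[_]; apply/mnmP => i.
by rewrite !mnmE permM permKV.
Qed.

Let symmon_homog f : degd f -> symmon f \is d.-homog.
Proof.
move=> /eqP fd; apply: rpred_sum => s _; rewrite dhomogX /= mdeg_mperm.
by rewrite mdegE -[X in _ == X]fd; apply/eqP/eq_bigr => i _; rewrite mnmE.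
Qed.

Let sum_symmon A e :
  \sum_(f | degd f) gprod f * ((A * symmon f)@_e)%:~R = n`!%:R * pairing A e.
Proof.
transitivity (\sum_(s : 'S_n) pairing A e); last first.
  by rewrite sumr_const card_Sn mulr_natl.
under eq_bigr => f _ do rewrite /symmon mulr_sumr raddf_sum raddf_sum mulr_sumr.
rewrite exchange_big /=; apply: eq_bigr => s _; rewrite /pairing.
pose h (f : expon) : expon := [ffun i => f (s i)].
have hI : injective h.
  move=> f g fg; apply/ffunP => i; have /ffunP/(_ (s^-1%g i)) := fg.
  by rewrite !ffunE permKV.
rewrite [RHS](reindex_inj hI) /=; apply: eq_big => f.
  rewrite /degd [in RHS](eq_bigr (fun i => val (f (s i)))) => [|i _]; last by rewrite ffunE.
  by rewrite [in LHS](reindex_inj (@perm_inj _ s)).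
move=> _; congr (_ * _%:~R).
  rewrite /gprod (reindex_inj (@perm_inj _ s)) /=.
  by apply: eq_bigr => i _; rewrite ffunE.
by congr ((A * 'X_[_])@__); apply/mnmP => i; rewrite !mnmE ffunE.
Qed.

(** For each permutation [s] at most one exponent family contributes, [f i = e i - m (s i)]; its
    total degree is [d] by the hypothesis on degrees. *)
Let pairing_alternant (m e : 'X_{1..n}) : mdeg e = (mdeg m + d)%N ->
  pairing (alternant m) e =
  \det (\matrix_(i < n, j < n) gcoef q u ((e i)%:Z - (m j)%:Z)).
Proof.
move=> em; rewrite /pairing alternantE.
under eq_bigr => f _ do rewrite mulr_suml raddf_sum raddf_sum mulr_sumr.
rewrite exchange_big /=; apply: eq_bigr => s _.
have sE : ((-1) ^+ s : int)%:~R = (-1) ^+ s :> K by rewrite rmorphXn rmorphN1.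
pose ms := [multinom m (s i) | i < n].
transitivity ((-1) ^+ s * \sum_(f | degd f) gprod f * ((ms + mon f)%MM == e)%:R).
  rewrite mulr_sumr; apply: eq_bigr => f _.
  by rewrite -scalerAl mcoeffZ -mpolyXD mcoeffX rmorphM /= sE mulrCA rmorph_nat.
congr (_ * _).
have dms : mdeg e = (\sum_i m (s i) + d)%N.
  rewrite em mdegE; congr (_ + _)%N; by rewrite (reindex_inj (@perm_inj _ s)).
case: (boolP [forall i, m (s i) <= e i]%N) => [/forallP le|/forallPn[i ilt]]; last first.
  rewrite big1 => [|f _]; last first.
    case: eqP => [/mnmP/(_ i)|]; rewrite ?mulr0 // mnmDE !mnmE => ei.
    by move: ilt; rewrite -ei leq_addr.
  rewrite (bigD1 i) //= mxE gcoef_neg ?mul0r //.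
  by move: ilt; rewrite -ltnNge; lia.
have sumd : (\sum_i (e i - m (s i)) = d)%N.
  apply/eqP; rewrite -(eqn_add2l (\sum_i m (s i))%N) -dms mdegE -big_split /=.
  by apply/eqP/eq_bigr => i _; rewrite subnKC.
have fi i : (e i - m (s i) < d.+1)%N.
  by rewrite ltnS -sumd (bigD1 i) //= leq_addr.
pose f : expon := [ffun i => Ordinal (fi i)].
rewrite (bigD1 f) /=; last first.
  by rewrite /degd -[X in _ == X]sumd; apply/eqP/eq_bigr => i _; rewrite ffunE.
rewrite [X in _ + X]big1 ?addr0 => [|g /andP[_ gf]]; last first.
  case: eqP => [/mnmP ge|]; rewrite ?mulr0 //; case/eqP: gf.
  apply/ffunP => i; apply/val_inj; rewrite ffunE /=.
  by have := ge i; rewrite mnmDE !mnmE => <-; rewrite addKn.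
have -> : (ms + mon f)%MM == e.
  by apply/eqP/mnmP => i; rewrite mnmDE !mnmE ffunE /= subnKC.
rewrite mulr1; apply: eq_bigr => i _; rewrite ffunE mxE /=.
by rewrite subzn.
Qed.

(** The degree [d] part of [prod_i g (x_i)] is expanded in Schur polynomials. Each coefficient is
    itself a pairing with the staircase alternant, which [pairing_alternant] evaluates as the
    determinant [skewk k part0]. *)
Lemma schur_coef_expand (m e : 'X_{1..n}) : (d <= n)%N -> mdeg e = (mdeg m + d)%N ->
  \det (\matrix_(i < n, j < n) gcoef q u ((e i)%:Z - (m j)%:Z)) =
  \sum_(k <- intparts d) ((alternant m * schur n k)@_e)%:~R * skewk q u k part0.
Proof.
move=> dn em; rewrite -pairing_alternant //.
apply: (mulfI (factK n)); rewrite -sum_symmon mulr_sumr.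
rewrite (eq_bigr (fun f => \sum_(k <- intparts d)
    ((alternant m * schur n k)@_e)%:~R * (gprod f * (schur_coef (symmon f) k)%:~R))); last first.
  move=> f fd; rewrite {1}(schur_expansion dn (symmon_homog fd) (symmon_sym f)).
  rewrite mulr_sumr raddf_sum raddf_sum mulr_sumr; apply: eq_bigr => k _.
  by rewrite /= -scalerAr mcoeffZ intrM mulrCA [RHS]mulrC mulrAC [LHS]mulrC.
rewrite exchange_big /=; apply: eq_big_seq => k; rewrite mem_intparts => /eqP kd.
rewrite -mulr_sumr [RHS]mulrCA; congr (_ * _).
rewrite /schur_coef sum_symmon; congr (_ * _).
have st : staircase n = (part_mon n part0 + staircase n)%MM.
  by apply/mnmP => i; rewrite mnmDE [X in (X + _)%N]mnmE /part nth_nil.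
have kn : (size k <= n)%N by rewrite (leq_trans (size_part_le k)) // kd.
rewrite [in alternant _]st pairing_alternant; last first.
  by rewrite !mdegD !mdeg_part_mon // kd -[psize part0]/0%N add0n addnC.
rewrite -(@jt_skewk _ _ _ n) //.
congr (\det _); apply/matrixP => i j; rewrite !mxE !mnmDE !mnmE /pcontent.
by congr gcoef; have := ltn_ord i; have := ltn_ord j; lia.
Qed.

End Functional.

Lemma mdeg_part_mon_staircase n (l : intpart) : (size l <= n)%N ->
  mdeg (part_mon n l + staircase n) = (psize l + mdeg (staircase n))%N.
Proof. by move=> ln; rewrite mdegD mdeg_part_mon. Qed.

(** The skew Jacobi-Trudi formula: the alternant of [m] plus the staircase is the staircase
    alternant times [schur m], so the previous expansion at this alternant yields the
    Littlewood-Richardson coefficients. *)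
Lemma lr_skewk (m v : intpart) : (psize m <= psize v)%N ->
  \sum_(l <- intparts_le (psize v)) (lr m l v)%:~R * skewk q u l part0 = skewk q u v m.
Proof.
move=> mv; pose n := psize v; pose d := (n - psize m)%N.
rewrite (@big_intparts_le _ n d) ?leq_subr // => [|l _ ld]; last first.
  by rewrite lr_eq0 ?mul0r //; apply: contraNneq ld => e; rewrite /d /n e addKn.
have vn : (size v <= n)%N := size_part_le v.
have mn : (size m <= n)%N := leq_trans (size_part_le m) mv.
rewrite -(@jt_skewk _ _ _ n) //.
transitivity (\det (\matrix_(i < n, j < n)
   gcoef q u (((part_mon n v + staircase n)%MM i)%:Z - ((part_mon n m + staircase n)%MM j)%:Z))).
  rewrite (schur_coef_expand (d := d)) ?leq_subr //.
    by apply: eq_bigr => l _; rewrite /lr /schur_coef mulrA -alternant_schur.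
  by rewrite !mdeg_part_mon_staircase // addnAC subnKC.
congr (\det _); apply/matrixP => i j; rewrite !mxE !mnmDE !mnmE /pcontent.
by congr gcoef; have := ltn_ord i; have := ltn_ord j; lia.
Qed.

Lemma lrC l m v : lr l m v = lr m l v.
Proof. by rewrite /lr mulrC. Qed.

End LittlewoodRichardson.

(** A permutation with a nonzero term would satisfy [pcontent m (s i) <= pcontent v i] for all [i];
    summing over [i] contradicts the sizes. *)
Lemma skewk_eq0 (K : fieldType) (q u : K) (v m : intpart) :
  (psize v < psize m)%N -> skewk q u v m = 0.
Proof.
move=> vm; set N := maxn (size v) (size m).
rewrite /skewk /jt -/N; apply: big1 => s _.
suff [i hi] : exists i : 'I_N, pcontent v i < pcontent m (s i).
  by rewrite (bigD1 i) //= mxE gcoef_neg ?mul0r ?mulr0 // subr_lt0.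
apply/existsP; apply/contraT; rewrite negb_exists => /forallP h.
have: \sum_(i < N) pcontent m (s i) <= \sum_(i < N) pcontent v i.
  by apply: ler_sum => i _; rewrite leNgt h.
have -> : \sum_(i < N) pcontent m (s i) = \sum_(i < N) pcontent m i.
  by rewrite [RHS](reindex_inj (@perm_inj _ s)).
rewrite !sumrB.
rewrite lerD2r -!(big_morph _ PoszD (erefl 0%:Z)) -!psizeE ?leq_maxl ?leq_maxr //.
by rewrite lez_nat leqNgt vm.
Qed.

(** * Commutation relations *)

Section Operators.
Variables (K : fieldType) (q : K).
Hypothesis q0 : q != 0.
Hypothesis qgen : forall k, (0 < k)%N -> q ^+ k - q ^- k != 0.

Local Notation z := (q - q^-1).
Local Notation t := (q ^+ 2).
Local Notation addop := (addop q).
Local Notation remop := (remop q).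
Local Notation skewk := (skewk q).
Implicit Types (F G : intpart -> K) (v m l : intpart).

Lemma addopE n (e : int) F v : (psize v <= n.+1)%N ->
  addop e F v = \sum_(l <- intparts_le n | addbox l v) q ^ (e * (kappa v - kappa l)) * F l.
Proof.
move=> vn; rewrite (@big_intparts_le _ n (psize v).-1) //; first by lia.
by move=> l /addbox_psize->; rewrite eqxx.
Qed.

Lemma remopE n (e : int) F v : (psize v < n)%N ->
  remop e F v = \sum_(l <- intparts_le n | addbox v l) q ^ (e * (kappa l - kappa v)) * F l.
Proof.
move=> vn; rewrite (@big_intparts_le _ n (psize v).+1) //.
by move=> l /addbox_psize->; rewrite eqxx.
Qed.

Definition skewop (u : K) F v := \sum_(m <- intparts_le (psize v)) skewk u v m * F m.

(** A range of summation independent of [v] allows exchanging sums with operators that change the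
    size of [v]. *)
Lemma skewopE n u F v : (psize v <= n)%N ->
  skewop u F v = \sum_(m <- intparts_le n) skewk u v m * F m.
Proof.
move=> vn; rewrite /skewop [RHS](bigID (fun m => psize m <= psize v)%N) /=.
rewrite [X in _ = _ + X]big1 ?addr0 => [|m]; last first.
  by rewrite -ltnNge => /(skewk_eq0 q u)->; rewrite mul0r.
rewrite -[RHS]big_filter; apply: perm_big; apply: uniq_perm.
- exact: intparts_le_uniq.
- by rewrite filter_uniq ?intparts_le_uniq.
move=> m; rewrite mem_filter !mem_intparts_le.
by apply/esym/andb_idr => /leq_trans; exact.
Qed.

Lemma addop_skewop n e u F v : (psize v <= n)%N ->
  addop e (skewop u F) v = \sum_(m <- intparts_le n) addop e ((skewk u)^~ m) v * F m.
Proof.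
move=> vn; rewrite (@addopE n) ?leqW //.
under eq_bigr => l lv.
  rewrite (@skewopE n); last by rewrite -ltnS -(addbox_psize lv) ltnW.
  rewrite mulr_sumr; over.
rewrite exchange_big /=; apply: eq_bigr => m _.
by rewrite (@addopE n) ?leqW // mulr_suml; apply: eq_bigr => l _; rewrite mulrA.
Qed.

Lemma remop_skewop n e u F v : (psize v < n)%N ->
  remop e (skewop u F) v = \sum_(m <- intparts_le n) remop e ((skewk u)^~ m) v * F m.
Proof.
move=> vn; rewrite (@remopE n) //.
under eq_bigr => l lv.
  rewrite (@skewopE n); last by rewrite (addbox_psize lv).
  rewrite mulr_sumr; over.
rewrite exchange_big /=; apply: eq_bigr => m _.
by rewrite (@remopE n) // mulr_suml; apply: eq_bigr => l _; rewrite mulrA.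
Qed.

Lemma skewop_addop n e u F v : (psize v <= n)%N ->
  skewop u (addop e F) v = \sum_(m <- intparts_le n) remop e (skewk u v) m * F m.
Proof.
move=> vn; rewrite (@skewopE n.+1) ?leqW //.
under eq_big_seq => l.
  rewrite mem_intparts_le => ln; rewrite (@addopE n) // mulr_sumr; over.
rewrite (exchange_big_dep xpredT) //=; apply: eq_big_seq => m.
rewrite mem_intparts_le => mn; rewrite (@remopE n.+1) // mulr_suml.
by apply: eq_bigr => l _; rewrite mulrCA mulrA.
Qed.

Lemma skewop_remop n e u F v : (psize v < n)%N ->
  skewop u (remop e F) v = \sum_(m <- intparts_le n) addop e (skewk u v) m * F m.
Proof.
case: n => // n; rewrite ltnS => vn; rewrite (@skewopE n) //.
under eq_big_seq => l.
  rewrite mem_intparts_le => ln; rewrite (@remopE n.+1) // mulr_sumr; over.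
rewrite (exchange_big_dep xpredT) //=; apply: eq_big_seq => m.
rewrite mem_intparts_le => mn; rewrite (@addopE n) // mulr_suml.
by apply: eq_bigr => l _; rewrite mulrCA mulrA.
Qed.

Lemma addop_lin e a b F G v :
  addop e (fun m => a * F m + b * G m) v = a * addop e F v + b * addop e G v.
Proof.
rewrite /addop !mulr_sumr -big_split /=; apply: eq_bigr => l _; ring.
Qed.

Lemma skewop_lin u a b F G v :
  skewop u (fun m => a * F m + b * G m) v = a * skewop u F v + b * skewop u G v.
Proof.
rewrite /skewop !mulr_sumr -big_split /=; apply: eq_bigr => l _; ring.
Qed.

Let qq1 : q ^+ 2 - 1 != 0.
Proof. by rewrite t_sub1 // mulf_neq0 // z_neq0. Qed.

Definition csop F v := content_sum t v * F v.
Definition csVop F v := content_sum t^-1 v * F v.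

Lemma skewop_add u F v : addop 0 (skewop u F) v = skewop u (addop 0 F) v.
Proof.
rewrite (@addop_skewop (psize v)) // (@skewop_addop (psize v)) //.
by apply: eq_bigr => m _; rewrite addop_skewk.
Qed.

Lemma skewop_rem u F v :
  remop 0 (skewop u F) v = skewop u (remop 0 F) v + u / z * skewop u F v.
Proof.
rewrite (@remop_skewop (psize v).+1) // (@skewop_remop (psize v).+1) //.
rewrite (@skewopE (psize v).+1) // mulr_sumr -big_split /=; apply: eq_bigr => m _.
by rewrite remop_skewk // mulrDl mulrA.
Qed.

Lemma skewop_cs u F v :
  z * csop (skewop u F) v = z * skewop u (csop F) v + u * addop 1 (skewop u F) v.
Proof.
rewrite (@addop_skewop (psize v)) // /csop {1 2}/skewop !mulr_sumr -big_split /=.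
apply: eq_bigr => m _; rewrite [X in _ = _ + X]mulrA -addop1_skewk //; ring.
Qed.

Lemma skewop_csV u F v :
  z * csVop (skewop u F) v = z * skewop u (csVop F) v + u * skewop u (addop (-1) F) v.
Proof.
rewrite (@skewop_addop (psize v)) // /csVop {1 2}/skewop !mulr_sumr -big_split /=.
apply: eq_bigr => m _; rewrite [X in _ = _ + X]mulrA -remopN1_skewk //; ring.
Qed.

Lemma skewop_remN1 u F v :
  remop (-1) (skewop u F) v =
  skewop u (remop (-1) F) v + u / z * (skewop u F v + z ^+ 2 * skewop u (csVop F) v).
Proof.
rewrite (@remop_skewop (psize v).+1) // (@skewop_remop (psize v).+1) //.
rewrite !(@skewopE (psize v).+1) // !mulr_sumr -big_split /= mulr_sumr -big_split /=.
by apply: eq_bigr => m _; rewrite remopN1_skewk_up // /csVop; ring.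
Qed.

Lemma skewop_rem1 u F v :
  remop 1 (skewop u F) v =
  skewop u (remop 1 F) v + u / z * skewop u F v + u * z * csop (skewop u F) v.
Proof.
rewrite (@remop_skewop (psize v).+1) // (@skewop_remop (psize v).+1) // /csop.
rewrite !(@skewopE (psize v).+1) // !mulr_sumr -!big_split /=.
apply: eq_bigr => m _; have /eqP := remop1_skewk u q0 qgen v m.
by rewrite subr_eq => /eqP->; ring.
Qed.

Lemma addbox_cs l v : addbox l v -> content_sum t v - content_sum t l = q ^ (kappa v - kappa l).
Proof.
move=> /addbox_row[i _ h].
by rewrite (content_sum_addbox _ h) addrAC subrr add0r -[_ - _]mul1r (kappa_shift _ _ h) // expr1z.
Qed.

Lemma addbox_csV l v :
  addbox l v -> content_sum t^-1 v - content_sum t^-1 l = q ^ (- (kappa v - kappa l)).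
Proof.
move=> /addbox_row[i _ h].
rewrite (content_sum_addbox _ h) addrAC subrr add0r -[- _]mulN1r (kappa_shift _ _ h) //.
by rewrite exprN1 exprz_inv invr_expz.
Qed.

Lemma addop1E F v : addop 1 F v = csop (addop 0 F) v - addop 0 (csop F) v.
Proof.
rewrite /csop /addop mulr_sumr -sumrB; apply: eq_bigr => l /addbox_cs e.
by rewrite mul0r expr0z !mul1r -mulrBl e.
Qed.

Lemma addopN1E F v : addop (-1) F v = csVop (addop 0 F) v - addop 0 (csVop F) v.
Proof.
rewrite /csVop /addop mulr_sumr -sumrB; apply: eq_bigr => l /addbox_csV e.
by rewrite mul0r expr0z !mul1r -mulrBl e mulN1r.
Qed.

(** Follows without a new determinant identity from [M_(-1) = [C_l(q^-2), M_0]], since [M_0]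
    commutes with [G_u] and the relation for [C_l(q^-2)] is known. *)
Lemma skewop_addN1 u F v :
  z * addop (-1) (skewop u F) v = z * skewop u (addop (-1) F) v +
    u * (skewop u (addop (-1) (addop 0 F)) v - skewop u (addop 0 (addop (-1) F)) v).
Proof.
have zn := z_neq0 qgen.
have E : csVop (skewop u F) = fun m => 1 * skewop u (csVop F) m + u / z * skewop u (addop (-1) F) m.
  apply: functional_extensionality => m; apply: (mulfI zn).
  by rewrite skewop_csV mul1r; field; rewrite ?q0 ?qq1.
have A : addop 0 (skewop u F) = skewop u (addop 0 F).
  by apply: functional_extensionality => m; rewrite skewop_add.
have B : addop (-1) F = fun m => 1 * csVop (addop 0 F) m + -1 * addop 0 (csVop F) m.
  by apply: functional_extensionality => m; rewrite addopN1E mul1r mulN1r.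
by rewrite [in LHS]addopN1E mulrBr A skewop_csV E addop_lin !skewop_add {2}B skewop_lin; field; rewrite ?q0 ?qq1.
Qed.

Lemma skewop_add1 u F v :
  z * addop 1 (skewop u F) v = z * skewop u (addop 1 F) v +
    u * (addop 1 (addop 0 (skewop u F)) v - addop 0 (addop 1 (skewop u F)) v).
Proof.
have zn := z_neq0 qgen.
have E : csop (skewop u F) = fun m => 1 * skewop u (csop F) m + u / z * addop 1 (skewop u F) m.
  apply: functional_extensionality => m; apply: (mulfI zn).
  by rewrite skewop_cs mul1r; field; rewrite ?q0 ?qq1.
have A : addop 0 (skewop u F) = skewop u (addop 0 F).
  by apply: functional_extensionality => m; rewrite skewop_add.
have B : addop 1 F = fun m => 1 * csop (addop 0 F) m + -1 * addop 0 (csop F) m.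
  by apply: functional_extensionality => m; rewrite addop1E mul1r mulN1r.
by rewrite [in LHS]addop1E mulrBr A skewop_cs E addop_lin !skewop_add {1}B skewop_lin; field; rewrite ?q0 ?qq1.
Qed.

Definition untwist F v := q ^ (- kappa v) * F v.

Lemma addop_untwist e F v : addop e (untwist F) v = untwist (addop (e + 1) F) v.
Proof.
rewrite /untwist /addop mulr_sumr; apply: eq_bigr => l _.
rewrite !mulrA -!expfzDr //; congr (q ^ _ * _); ring.
Qed.

Lemma remop_untwist e F v : remop e (untwist F) v = untwist (remop (e - 1) F) v.
Proof.
rewrite /untwist /remop mulr_sumr; apply: eq_bigr => l _.
rewrite !mulrA -!expfzDr //; congr (q ^ _ * _); ring.
Qed.

(** * Moving operators through [D = G_(a^2) T^-1 G_(-1)] *)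

Section Dressing.
Variable a : K.

Definition dress F := skewop (a ^+ 2) (untwist (skewop (-1) F)).

Lemma dress_lin b c F G v :
  dress (fun m => b * F m + c * G m) v = b * dress F v + c * dress G v.
Proof.
rewrite /dress -skewop_lin; congr (skewop _ _ _); apply: functional_extensionality => m.
by rewrite /untwist skewop_lin; ring.
Qed.

Lemma addop0_dress F v : addop 0 (dress F) v = skewop (a ^+ 2) (untwist (addop 1 (skewop (-1) F))) v.
Proof.
rewrite skewop_add; congr (skewop _ _ _); apply: functional_extensionality => m.
by rewrite addop_untwist.
Qed.

(** The outer [G_(a^2)] contributes [a^2 M_1]. The inner [G_(-1)] contributes [- M_1] to the right
    of [T^-1], which is [- M_0] to its left and commutes with [G_(a^2)]. *)
Lemma dress_A1 F v :
  z * csop (dress F) v + addop 0 (dress F) v - a ^+ 2 * addop 1 (dress F) v =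
  z * dress (csop F) v.
Proof.
rewrite skewop_cs addop0_dress.
have E : csop (untwist (skewop (-1) F)) =
    fun m => 1 * untwist (skewop (-1) (csop F)) m + - z^-1 * untwist (addop 1 (skewop (-1) F)) m.
  apply: functional_extensionality => m; apply: (mulfI (z_neq0 qgen)).
  transitivity (q ^ (- kappa m) * (z * csop (skewop (-1) F) m)).
    by rewrite /csop /untwist; ring.
  by rewrite skewop_cs /untwist; field; rewrite ?q0 ?qq1.
by rewrite E skewop_lin /dress; field; rewrite ?q0 ?qq1.
Qed.

Lemma dress_csV F v :
  z * csVop (dress F) v =
  z * dress (csVop F) v - dress (addop (-1) F) v + a ^+ 2 * dress (addop 0 F) v.
Proof.
rewrite skewop_csV.
have E : csVop (untwist (skewop (-1) F)) = fun m =>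
    1 * untwist (skewop (-1) (csVop F)) m + - z^-1 * untwist (skewop (-1) (addop (-1) F)) m.
  apply: functional_extensionality => m; apply: (mulfI (z_neq0 qgen)).
  transitivity (q ^ (- kappa m) * (z * csVop (skewop (-1) F) m)).
    by rewrite /csVop /untwist; ring.
  by rewrite skewop_csV /untwist; field; rewrite ?q0 ?qq1.
have A : addop (-1) (untwist (skewop (-1) F)) = untwist (skewop (-1) (addop 0 F)).
  apply: functional_extensionality => m.
  by rewrite addop_untwist /untwist skewop_add.
by rewrite E A skewop_lin /dress; field; rewrite ?q0 ?qq1.
Qed.

(** The term in [csVop] comes from moving [L_(-1)] through [G_(-1)]; it will cancel the one in
    [dress_csV] on the diagonal sum. *)
Lemma dress_rem F v :
  remop 0 (dress F) v - (a ^+ 2 - 1) / z * dress F v =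
  dress (remop (-1) F) v - z * dress (csVop F) v.
Proof.
have zn := z_neq0 qgen.
rewrite skewop_rem.
have E : remop 0 (untwist (skewop (-1) F)) = fun m =>
    1 * untwist (skewop (-1) (remop (-1) F)) m +
    -1 * (fun m => z^-1 * untwist (skewop (-1) F) m + z * untwist (skewop (-1) (csVop F)) m) m.
  apply: functional_extensionality => m.
  rewrite remop_untwist sub0r /untwist skewop_remN1; field; rewrite ?q0 ?qq1.
  by [].
by rewrite E !skewop_lin /dress; field; rewrite ?q0 ?qq1.
Qed.

(** Passing [G_(a^2)] creates a multiple of [[M_(-1), M_0]], which becomes [[M_0, M_1]] to the right
    of [T^-1]; passing [M_1] through [G_(-1)] creates [[M_1, M_0]] with the same factor [a^2 / z],
    and the two cancel. *)
Lemma dress_add F v :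
  addop (-1) (dress F) v - a ^+ 2 * addop 0 (dress F) v =
  dress (addop 0 F) v - a ^+ 2 * dress (addop 1 F) v.
Proof.
have zn := z_neq0 qgen.
rewrite addop0_dress; apply: (mulfI zn).
rewrite mulrBr skewop_addN1.
set Y := skewop (-1) F.
have A1 : addop (-1) (untwist Y) = untwist (skewop (-1) (addop 0 F)).
  apply: functional_extensionality => m.
  by rewrite addop_untwist /untwist skewop_add.
have A2 : addop 0 (untwist Y) = untwist (addop 1 Y).
  by apply: functional_extensionality => m; rewrite addop_untwist.
have A3 : addop (-1) (addop 0 (untwist Y)) = untwist (addop 0 (addop 1 Y)).
  by rewrite A2; apply: functional_extensionality => m; rewrite addop_untwist.
have A4 : addop 0 (addop (-1) (untwist Y)) = untwist (addop 1 (addop 0 Y)).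
  rewrite A1; apply: functional_extensionality => m; rewrite addop_untwist /untwist.
  by congr (_ * addop _ _ _); apply: functional_extensionality => l; rewrite -skewop_add.
have E : untwist (addop 1 Y) = fun m => 1 * untwist (skewop (-1) (addop 1 F)) m +
    - z^-1 * (fun m => 1 * untwist (addop 1 (addop 0 Y)) m + -1 * untwist (addop 0 (addop 1 Y)) m) m.
  apply: functional_extensionality => m; rewrite /untwist; apply: (mulfI zn).
  rewrite mulrCA skewop_add1 -/Y; field; rewrite ?q0 ?qq1.
  by [].
by rewrite A3 A4 A1 E !skewop_lin /dress; field; rewrite ?q0 ?qq1.
Qed.

Lemma dress_rem1 F v :
  remop 1 (dress F) v - a ^+ 2 * z * csop (dress F) v =
  dress (remop 0 F) v + (a ^+ 2 - 1) / z * dress F v.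
Proof.
have zn := z_neq0 qgen.
rewrite skewop_rem1 addrK.
have E : remop 1 (untwist (skewop (-1) F)) = fun m =>
    1 * untwist (skewop (-1) (remop 0 F)) m + - z^-1 * untwist (skewop (-1) F) m.
  apply: functional_extensionality => m.
  rewrite remop_untwist subrr /untwist skewop_rem; field; rewrite ?q0 ?qq1.
  by [].
by rewrite E !skewop_lin /dress; field; rewrite ?q0 ?qq1.
Qed.

End Dressing.

End Operators.

(** * The right-hand side *)

Section TwoFactors.
Variables (K : fieldType) (q a : K).
Hypothesis q0 : q != 0.
Hypothesis qgen : forall k, (0 < k)%N -> q ^+ k - q ^- k != 0.

Local Notation z := (q - q^-1).
Local Notation t := (q ^+ 2).
Local Notation addop := (addop q).
Local Notation remop := (remop q).
Local Notation skewop := (skewop q).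
Local Notation csop := (csop q).
Local Notation csVop := (csVop q).
Local Notation dress := (dress q a).
Implicit Types (F G : intpart -> K) (X : intpart -> intpart -> K) (v w l m : intpart).

(** Each coefficient of the image depends on finitely many coefficients of the argument. Operators
    on different factors then commute even on infinite families. *)
Definition locfin (A : (intpart -> K) -> intpart -> K) :=
  forall v, exists s : seq (K * intpart), forall F, A F v = \sum_(p <- s) p.1 * F p.2.

Lemma locfin_exchange A B X v w : locfin A -> locfin B ->
  A (fun v' => B (X v') w) v = B (fun w' => A (X^~ w') v) w.
Proof.
move=> /(_ v)[s As] /(_ w)[s' Bs]; rewrite As Bs.
under eq_bigr => p _ do rewrite Bs mulr_sumr.
rewrite exchange_big /=; apply: eq_bigr => p _; rewrite As mulr_sumr.
by apply: eq_bigr => p' _; rewrite mulrCA.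
Qed.

Lemma locfin_sum A (r : intpart -> seq intpart) (P : intpart -> pred intpart)
    (k : intpart -> intpart -> K) :
  (forall F v, A F v = \sum_(l <- r v | P v l) k v l * F l) -> locfin A.
Proof.
move=> AE v; exists [seq (k v l, l) | l <- r v & P v l] => F.
by rewrite AE big_map big_filter.
Qed.

Lemma locfin_addop e : locfin (addop e).
Proof. exact: (locfin_sum (fun F v => erefl)). Qed.

Lemma locfin_remop e : locfin (remop e).
Proof. exact: (locfin_sum (fun F v => erefl)). Qed.

Lemma locfin_skewop u : locfin (skewop u).
Proof. exact: (locfin_sum (P := fun _ => xpredT) (fun F v => erefl)). Qed.

Lemma locfin_scale (c : intpart -> K) : locfin (fun F v => c v * F v).
Proof. by move=> v; exists [:: (c v, v)] => F; rewrite big_seq1. Qed.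

Lemma locfin_comp A B : locfin A -> locfin B -> locfin (fun F => A (B F)).
Proof.
move=> Al Bl v; have [s As] := Al v.
suff [s' E] : exists s', forall F, \sum_(p <- s) p.1 * B F p.2 = \sum_(p <- s') p.1 * F p.2.
  by exists s' => F; rewrite As E.
elim: s {As} => [|[c m] s [s' E]]; first by exists [::] => F; rewrite !big_nil.
have [r Br] := Bl m; exists ([seq (c * p.1, p.2) | p <- r] ++ s') => F.
rewrite big_cons big_cat -E big_map Br mulr_sumr; congr (_ + _).
by apply: eq_bigr => p _; rewrite mulrA.
Qed.

Lemma locfin_undress : locfin (fun F => untwist q (skewop (-1) F)).
Proof. exact/locfin_comp/locfin_skewop/locfin_scale. Qed.

Lemma locfin_dress : locfin dress.
Proof. exact/locfin_comp/locfin_undress/locfin_skewop. Qed.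

Definition dress2 X v w := dress (fun v' => dress (X v') w) v.

Lemma dress2_sym X v w : dress2 X v w = dress (fun w' => dress (X^~ w') v) w.
Proof. exact: locfin_exchange locfin_dress locfin_dress. Qed.

Lemma dress2_op1 B X v w : locfin B ->
  dress (B (fun v' => dress (X v') w)) v = dress2 (fun v' w' => B (X^~ w') v') v w.
Proof.
move=> Bl; rewrite /dress2; congr (dress _ _); apply: functional_extensionality => v'.
exact: locfin_exchange Bl locfin_dress.
Qed.

Lemma dress2_op2 B X v w : locfin B ->
  dress (B (fun w' => dress (X^~ w') v)) w = dress2 (fun v' w' => B (X v') w') v w.
Proof.
move=> Bl; rewrite dress2_sym; congr (dress _ _); apply: functional_extensionality => w'.
exact: (locfin_exchange (fun w'' v'' => X v'' w'') _ _ Bl locfin_dress).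
Qed.

Lemma dress2_row X v : dress2 X v = dress (fun w' => dress (X^~ w') v).
Proof. by apply: functional_extensionality => w; exact: dress2_sym. Qed.

Lemma dress2_lin b c X Y v w :
  dress2 (fun v' w' => b * X v' w' + c * Y v' w') v w = b * dress2 X v w + c * dress2 Y v w.
Proof.
rewrite /dress2 -dress_lin; congr (dress _ _); apply: functional_extensionality => v'.
exact: dress_lin.
Qed.

(* Psi_03 with both factors multiplied by q^kappa. *)
Definition diag03 l m : K :=
  if l == m then \prod_(b <- boxes l) (1 - a ^+ 2 * t ^ content b) else 0.

Lemma diag03_addbox l v : addbox l v ->
  diag03 v v = diag03 l l * (1 - a ^+ 2 * q ^ (kappa v - kappa l)).
Proof.
move=> /addbox_row[i _ h]; rewrite /diag03 !eqxx (big_boxes_addbox _ _ h).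
by rewrite -[kappa v - _]mul1r (kappa_shift _ _ h) ?expr1z.
Qed.

Lemma addop_diag03 e v w :
  addop e (diag03^~ w) v = if addbox w v then q ^ (e * (kappa v - kappa w)) * diag03 w w else 0.
Proof.
rewrite /addop big_mkcond; case: ifP => wv.
  rewrite (bigD1_seq w) ?intparts_uniq ?mem_intparts ?(addbox_psize wv) //= wv.
  rewrite big1 ?addr0 // => l lw; case: ifP => // _.
  by rewrite /diag03 (negPf lw) mulr0.
rewrite big1 // => l _; case: ifP => // lv; rewrite /diag03; case: eqP => [e'|_].
  by rewrite -e' lv in wv.
by rewrite mulr0.
Qed.

Lemma remop_diag03 e v w :
  remop e (diag03 v) w = if addbox w v then q ^ (e * (kappa v - kappa w)) * diag03 v v else 0.
Proof.
rewrite /remop big_mkcond; case: ifP => wv.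
  rewrite (bigD1_seq v) ?intparts_uniq ?mem_intparts ?(addbox_psize wv) //= wv.
  rewrite big1 ?addr0 // => l lw; case: ifP => // _.
  by rewrite /diag03 eq_sym (negPf lw) mulr0.
rewrite big1 // => l _; case: ifP => // lv; rewrite /diag03; case: eqP => [e'|_].
  by rewrite e' lv in wv.
by rewrite mulr0.
Qed.

(** Both sides live on pairs where [v] is [w] plus a box. The left side reads the diagonal at [v],
    the right side at [w], and [diag03_addbox] gives the ratio. *)
Lemma diag03_rem v w :
  remop 0 (diag03 v) w = addop 0 (diag03^~ w) v - a ^+ 2 * addop 1 (diag03^~ w) v.
Proof.
rewrite !addop_diag03 remop_diag03; case: ifP => wv; last by rewrite mulr0 subr0.
by rewrite (diag03_addbox wv) !mul0r expr0z !mul1r; ring.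
Qed.

Lemma diag03_remN1 v w :
  remop (-1) (diag03 v) w = addop (-1) (diag03^~ w) v - a ^+ 2 * addop 0 (diag03^~ w) v.
Proof.
rewrite !addop_diag03 remop_diag03; case: ifP => wv; last by rewrite mulr0 subr0.
rewrite (diag03_addbox wv) mul0r expr0z mul1r mulN1r -invr_expz.
by have := expfz_neq0 (kappa v - kappa w) q0; move: (q ^ _) => x x0; field.
Qed.

Definition hopf03 := dress2 diag03.

Lemma hopf03_sym v w : hopf03 v w = hopf03 w v.
Proof.
rewrite /hopf03 dress2_sym /dress2; congr (dress _ _); apply: functional_extensionality => w'.
congr (dress _ _); apply: functional_extensionality => v'.
by rewrite /diag03 eq_sym; case: eqP => // ->.
Qed.

Lemma hopf03_A1_side v w :
  z * csop (hopf03^~ w) v + addop 0 (hopf03^~ w) v - a ^+ 2 * addop 1 (hopf03^~ w) v =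
  z * dress2 (fun v w => content_sum t v * diag03 v w) v w.
Proof.
by rewrite [LHS]dress_A1 // (dress2_op1 _ _ _ (locfin_scale _)).
Qed.

Lemma hopf03_col v : hopf03^~ v = hopf03 v.
Proof. by apply: functional_extensionality => w; exact: hopf03_sym. Qed.

Lemma hopf03_A1 v w :
  z * csop (hopf03^~ w) v + addop 0 (hopf03^~ w) v - a ^+ 2 * addop 1 (hopf03^~ w) v =
  z * csop (hopf03 v) w + addop 0 (hopf03 v) w - a ^+ 2 * addop 1 (hopf03 v) w.
Proof.
rewrite hopf03_A1_side -hopf03_col hopf03_A1_side; congr (_ * _).
rewrite [RHS]dress2_sym /dress2; congr (dress _ _); apply: functional_extensionality => v'.
congr (dress _ _); apply: functional_extensionality => w'.
by rewrite /diag03 [w' == v']eq_sym; case: eqP => [->|_]; rewrite ?mulr0.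
Qed.

(** The part of [A_2] free of [a_2]. After [C_l(q^-2)] is moved through the first [D] and [L_0]
    through the second, the two [C_l(q^-2)] agree on the diagonal and cancel, and [diag03_remN1]
    settles the rest. *)
Lemma hopf03_rem v w :
  z * csVop (hopf03^~ w) v + remop 0 (hopf03 v) w - (a ^+ 2 - 1) / z * hopf03 v w = 0.
Proof.
have E1 := dress_csV q0 qgen a (fun v' => dress (diag03 v') w) v.
have E2 := dress_rem q0 qgen a (fun w' => dress (diag03^~ w') v) w.
rewrite -dress2_row !dress2_op2 in E2; try exact: locfin_remop; last exact: locfin_scale.
rewrite !dress2_op1 in E1; try exact: locfin_addop; last exact: locfin_scale.
rewrite -addrA {}E2 [X in X + _]E1 {E1}.
have -> : (fun v' => remop (-1) (diag03 v')) = fun v' w' =>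
    1 * addop (-1) (diag03^~ w') v' + - a ^+ 2 * addop 0 (diag03^~ w') v'.
  apply: functional_extensionality => v'; apply: functional_extensionality => w'.
  by rewrite diag03_remN1; ring.
have -> : (fun v' w' => csVop (diag03^~ w') v') = (fun v' w' => csVop (diag03 v') w').
  apply: functional_extensionality => v'; apply: functional_extensionality => w'.
  by rewrite /csVop /diag03; case: eqP => [->|_]; rewrite ?mulr0.
by rewrite dress2_lin; ring.
Qed.

(** The coefficient of [a_2^2] in [A_2]; box additions are moved through the first [D], [L_1]
    through the second, leaving [diag03_rem]. *)
Lemma hopf03_add v w :
  addop (-1) (hopf03^~ w) v - a ^+ 2 * addop 0 (hopf03^~ w) v - remop 1 (hopf03 v) w
  + a ^+ 2 * z * csop (hopf03 v) w + (a ^+ 2 - 1) / z * hopf03 v w = 0.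
Proof.
have E1 := dress_add q0 qgen a (fun v' => dress (diag03 v') w) v.
have E2 := dress_rem1 q0 qgen a (fun w' => dress (diag03^~ w') v) w.
rewrite -dress2_row dress2_op2 in E2; last exact: locfin_remop.
rewrite !dress2_op1 in E1; try exact: locfin_addop.
have -> : forall x y u s h : K, x - y - u + s + h = (x - y) - (u - s) + h by move=> *; ring.
rewrite [X in X - _ + _]E1 E2 -/hopf03 {E1 E2}.
have -> : (fun v' => remop 0 (diag03 v')) = fun v' w' =>
    1 * addop 0 (diag03^~ w') v' + - a ^+ 2 * addop 1 (diag03^~ w') v'.
  apply: functional_extensionality => v'; apply: functional_extensionality => w'.
  by rewrite diag03_rem; ring.
by rewrite dress2_lin; ring.
Qed.

Hypothesis factK : forall n, n`!%:R != 0 :> K.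
Hypothesis a0 : a != 0.

Lemma lr_hookprod u m v : u != 0 -> (psize m <= psize v)%N ->
  \sum_(l <- intparts_le (psize v)) (lr m l v)%:~R * hookprod q u l = skewk q u v m.
Proof.
move=> u0 mv; rewrite -lr_skewk //; apply: eq_bigr => l _.
by rewrite skewk_part0.
Qed.

Lemma prod_boxes_const (x : K) l : \prod_(b <- boxes l) x = x ^+ psize l.
Proof.
rewrite (@big_boxes _ _ _ (size l)) // (@psizeE (size l)) // -prodrXr.
by apply: eq_bigr => i _; rewrite prodr_const card_ord.
Qed.

Lemma expz_kappa l : q ^ kappa l = \prod_(b <- boxes l) t ^ content b.
Proof.
rewrite /kappa -exprz_exp -exprnP.
by rewrite (big_morph (exprz t) (id1 := 1) (op1 := *%R)) // => x y; rewrite expfzDr ?t_neq0.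
Qed.

Lemma Psi_di1 l : Psi_di q 1 (a ^+ 2) l = hookprod q (a ^+ 2) l.
Proof.
rewrite /Psi_di /hookprod expr1z mulrC; congr (_ * _).
rewrite expz_kappa -prod_boxes_const -!big_split /=; apply: eq_bigr => b _.
rewrite -invr_expz [t]exprnP exprz_exp -(mulrC (content b)) -exprz_exp -exprnP.
have := expfz_neq0 (content b) q0; move: (q ^ content b) => x x0.
have := @qgen (hook l b) isT; move: (_ - _) => D D0.
by field; rewrite D0.
Qed.

Lemma Psi_di0 l : Psi_di q 0 1 l = q ^ (- kappa l) * hookprod q (-1) l.
Proof.
rewrite /Psi_di /hookprod expr0z mul1r expr1n mulr1 -invr_expz.
rewrite expz_kappa -prod_boxes_const -prodfV -!big_split /=; apply: eq_bigr => b _.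
rewrite -invr_expz [t]exprnP exprz_exp -(mulrC (content b)) -exprz_exp -exprnP.
have := expfz_neq0 (content b) q0; move: (q ^ content b) => x x0.
have := @qgen (hook l b) isT; move: (_ - _) => D D0.
by field; rewrite D0.
Qed.

Lemma Psi_03E l m : Psi_03 q a l m = q ^ (- kappa l) * q ^ (- kappa m) * diag03 l m.
Proof.
rewrite /Psi_03 /diag03; case: eqP => [<-|_]; last by rewrite mulr0.
rewrite -!invr_expz expz_kappa -prod_boxes_const -!prodfV -!big_split /=; apply: eq_bigr => b _.
have e2 : q ^ (- (2 * content b)) = (q ^ content b) ^- 2
  by rewrite -invr_expz mulrC natz -exprz_exp.
have e4 : q ^ (- (4 * content b)) = (q ^ content b) ^- 4
  by rewrite -invr_expz mulrC natz -exprz_exp.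
have et : t ^ content b = (q ^ content b) ^+ 2
  by rewrite [t]exprnP exprz_exp mulrC -exprz_exp.
rewrite e2 e4 et; have := expfz_neq0 (content b) q0; move: (q ^ content b) => x x0.
by field.
Qed.

Lemma starE (f : int) X Y v w : star q f X Y v w =
  \sum_(l <- intparts_le (psize v)) \sum_(m <- intparts_le (psize w))
  \sum_(l' <- intparts_le (psize v)) \sum_(m' <- intparts_le (psize w))
    star_coef q f l l' v * star_coef q f m m' w * X l m * Y l' m'.
Proof. by apply: eq_bigr => l _; rewrite exchange_big. Qed.

(** The twisted product by [Psi_di 0 1] is [T^-1 G_(-1) T]: its own factor [q ^ (- kappa l1)]
    cancels the twist. *)
Lemma star_coefN1_Psi_di l l' : (psize l' <= psize l)%N ->
  \sum_(l1 <- intparts_le (psize l)) star_coef q (-1) l1 l' l * Psi_di q 0 1 l1 =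
  q ^ (- kappa l) * skewk q (-1) l l' * q ^ kappa l'.
Proof.
move=> ll'; have N10 : (-1 : K) != 0 by rewrite oppr_eq0 oner_eq0.
rewrite -lr_hookprod // mulr_sumr mulr_suml; apply: eq_bigr => l1 _.
rewrite Psi_di0 /star_coef lrC mulN1r.
have -> : - (kappa l - kappa l1 - kappa l') = - kappa l + kappa l1 + kappa l' by ring.
rewrite !expfzDr // -[q ^ (- kappa l1)]invr_expz.
by have := expfz_neq0 (kappa l1) q0; move: (q ^ kappa l1) => x x0; field.
Qed.

Lemma star_Psi_03 l m :
  star q (-1) (tensor (Psi_di q 0 1) (Psi_di q 0 1)) (Psi_03 q a) l m =
  untwist q (skewop (-1) (fun l' => untwist q (skewop (-1) (diag03 l')) m)) l.
Proof.
transitivity (\sum_(l2 <- intparts_le (psize l)) \sum_(m2 <- intparts_le (psize m))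
  (\sum_(l1 <- intparts_le (psize l)) star_coef q (-1) l1 l2 l * Psi_di q 0 1 l1) *
  ((\sum_(m1 <- intparts_le (psize m)) star_coef q (-1) m1 m2 m * Psi_di q 0 1 m1) *
    Psi_03 q a l2 m2)).
  rewrite /star exchange_big; apply: eq_bigr => l2 _.
  under [RHS]eq_bigr => m2 _ do rewrite mulr_suml.
  rewrite [RHS]exchange_big; apply: eq_bigr => l1 _.
  rewrite exchange_big; apply: eq_bigr => m2 _.
  by rewrite mulr_suml mulr_sumr; apply: eq_bigr => m1 _; rewrite /tensor; ring.
rewrite /untwist /skewop mulr_sumr; apply: eq_big_seq => l2; rewrite mem_intparts_le => ll2.
rewrite !mulr_sumr; apply: eq_big_seq => m2; rewrite mem_intparts_le => mm2.
rewrite !star_coefN1_Psi_di // Psi_03E -[q ^ (- kappa l2)]invr_expz -[q ^ (- kappa m2)]invr_expz.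
have := expfz_neq0 (kappa l2) q0; move: (q ^ kappa l2) => x x0.
have := expfz_neq0 (kappa m2) q0; move: (q ^ kappa m2) => y y0.
by field; rewrite x0 y0.
Qed.

Lemma hopf_rhsE : hopf_rhs q a = hopf03.
Proof.
apply: functional_extensionality => v; apply: functional_extensionality => w.
have a20 : a ^+ 2 != 0 by exact: expf_neq0.
have N10 : (-1 : K) != 0 by rewrite oppr_eq0 oner_eq0.
rewrite /hopf_rhs starE.
pose S := star q (-1) (tensor (Psi_di q 0 1) (Psi_di q 0 1)) (Psi_03 q a).
rewrite -/S.
transitivity (skewop (a ^+ 2) (fun l => skewop (a ^+ 2) (S l) w) v).
  apply: eq_big_seq => l; rewrite mem_intparts_le => lv.
  rewrite /skewop mulr_sumr; apply: eq_big_seq => m; rewrite mem_intparts_le => mw.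
  rewrite -!lr_hookprod // mulr_suml.
  apply: eq_bigr => l' _; rewrite mulr_suml mulr_sumr.
  apply: eq_bigr => m' _; rewrite /star_coef /tensor !Psi_di1 !mul0r !expr0z !mulr1.
  ring.
have -> : S = fun l m => untwist q (skewop (-1) (fun l' => untwist q (skewop (-1) (diag03 l')) m)) l.
  by do 2 apply: functional_extensionality => ?; exact: star_Psi_03.
congr (skewop _ _ _); apply: functional_extensionality => l.
exact: (locfin_exchange (fun m l' => untwist q (skewop (-1) (diag03 l')) m) _ _
  (locfin_skewop _) locfin_undress).
Qed.

End TwoFactors.

(** * The operators on the positive part *)

Section HopfEquations.
Variables (K : fieldType) (q : K).
Hypothesis q0 : q != 0.
Hypothesis qgen : forall k, (0 < k)%N -> q ^+ k - q ^- k != 0.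

Local Notation z := (q - q^-1).
Local Notation t := (q ^+ 2).
Local Notation addop := (addop q).
Local Notation remop := (remop q).
Local Notation csop := (csop q).
Local Notation csVop := (csVop q).
Local Notation p0 aL := ((aL - aL^-1) / z).
Implicit Types (F : intpart -> K) (l m : intpart) (x y : intpart * intpart).

Lemma addbox_part0 l : addbox l part0 = false.
Proof. by apply/negP => /addbox_psize. Qed.

Lemma content_sum_part0 (s : K) : content_sum s part0 = 0.
Proof. exact: big_nil. Qed.

Definition pos1 F : skein1 K := fun x => if x.2 == part0 then F x.1 else 0.

Lemma Pup_pos1 F l : Pup (pos1 F) (l, part0) = addop 0 F l.
Proof.
rewrite /Pup /= [X in _ + X]big1 ?addr0 => [|m part0m]; last first.
  rewrite /pos1; case: eqP => //= m0; by rewrite m0 addbox_part0 in part0m.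
by apply: eq_bigr => m _; rewrite /pos1 /= mul0r expr0z mul1r.
Qed.

Lemma Pdown_pos1 F l : Pdown (pos1 F) (l, part0) = remop 0 F l.
Proof.
rewrite /Pdown /= [X in _ + X]big1 ?addr0 => [|m part0m]; last first.
  by rewrite addbox_part0 in part0m.
by apply: eq_bigr => m _; rewrite /pos1 /= mul0r expr0z mul1r.
Qed.

Lemma P00_pos1 aL F x : P q aL 0 0 (pos1 F) x = p0 aL * pos1 F x.
Proof. by rewrite /P /Pdiag /Peig /= addr0. Qed.

Lemma P10_pos1 aL F l :
  P q aL 1 0 (pos1 F) (l, part0) = p0 aL * F l + aL * (z * csop F l).
Proof.
rewrite /P /Pdiag /Peig /pos1 /= content_sum_part0 mulr0 subr0 /csop; ring.
Qed.

Lemma PN10_pos1 aL F l :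
  P q aL (-1) 0 (pos1 F) (l, part0) = p0 aL * F l - aL^-1 * (z * csVop F l).
Proof.
rewrite /P /Pdiag /Peig /pos1 /= content_sum_part0 mulr0 sub0r /csVop; ring.
Qed.

Lemma P01_pos1 aL F l : P q aL 0 1 (pos1 F) (l, part0) = addop 0 F l.
Proof. exact: Pup_pos1. Qed.

Lemma P0N1_pos1 aL F l : P q aL 0 (-1) (pos1 F) (l, part0) = remop 0 F l.
Proof. exact: Pdown_pos1. Qed.

Lemma Pdiag_pos1 aL n F : Pdiag q aL n (pos1 F) = pos1 (fun l => Peig q aL n (l, part0) * F l).
Proof.
apply: functional_extensionality => -[l m]; rewrite /Pdiag /pos1 /=.
by case: eqP => [->|]; rewrite ?mulr0.
Qed.

Lemma Peig1 aL l : Peig q aL 1 (l, part0) = p0 aL + aL * z * content_sum t l.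
Proof. rewrite /Peig /= content_sum_part0; ring. Qed.

Lemma PeigN1 aL l : Peig q aL (-1) (l, part0) = p0 aL - aL^-1 * z * content_sum t^-1 l.
Proof. rewrite /Peig /= content_sum_part0; ring. Qed.

(** A box of content [c] raises the eigenvalue of [P_(1,0)] by [aL z q^(2c)]; division by [z] leaves
    the weight of [M_1]. The next two lemmas are analogous. *)
Lemma P11_pos1 aL F l : P q aL 1 1 (pos1 F) (l, part0) = aL * addop 1 F l.
Proof.
have zn := z_neq0 qgen.
rewrite /P /= Pdiag_pos1 /Pdiag /Pshift /= !Pup_pos1 mul1r expr1z exprN1.
rewrite /addop !mulr_sumr -sumrB mulr_suml; apply: eq_bigr => m /(addbox_cs q).
rewrite !Peig1 mul0r expr0z !mul1r => <-.
by move: (p0 aL) => p; move: z zn => zz zn; field.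
Qed.

Lemma PN11_pos1 aL F l : P q aL (-1) 1 (pos1 F) (l, part0) = aL^-1 * addop (-1) F l.
Proof.
have zn := z_neq0 qgen.
rewrite /P /= Pdiag_pos1 /Pdiag /Pshift /= !Pup_pos1 mulN1r opprK expr1z exprN1.
rewrite /addop !mulr_sumr -sumrB mulr_suml; apply: eq_bigr => m /(addbox_csV q).
rewrite !PeigN1 mul0r expr0z !mul1r mulN1r => <-; rewrite -[q^-1 - q]opprB invrN.
by move: (p0 aL) (aL^-1) => p b; move: z zn => zz zn; field.
Qed.

Lemma P1N1_pos1 aL F l : P q aL 1 (-1) (pos1 F) (l, part0) = aL * remop 1 F l.
Proof.
have zn := z_neq0 qgen.
rewrite /P /= Pdiag_pos1 /Pdiag /Pshift /= !Pdown_pos1 mul1r opprK expr1z exprN1.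
rewrite /remop !mulr_sumr -sumrB mulr_suml; apply: eq_bigr => m /(addbox_cs q).
rewrite !Peig1 mul0r expr0z !mul1r => <-; rewrite -[q^-1 - q]opprB invrN.
by move: (p0 aL) => p; move: z zn => zz zn; field.
Qed.

Section Negative.
Variables (aL : K) (F : intpart -> K) (l m : intpart).
Hypothesis m0 : m != part0.

Lemma Pdiag_neg n : Pdiag q aL n (pos1 F) (l, m) = 0.
Proof. by rewrite Pdiag_pos1 /pos1 /= (negPf m0). Qed.

Lemma Pup_neg G : Pup (pos1 G) (l, m) = 0.
Proof.
rewrite /Pup !big1 ?addr0 //= => m' am; rewrite /pos1 /= ?(negPf m0) //.
by case: eqP => // m'0; rewrite m'0 addbox_part0 in am.
Qed.

Lemma P0_neg n : P q aL n 0 (pos1 F) (l, m) = 0.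
Proof. exact: Pdiag_neg. Qed.

Lemma P1_neg n : P q aL n 1 (pos1 F) (l, m) = 0.
Proof.
by rewrite /P /=; case: eqP => _; rewrite ?Pdiag_pos1 /Pshift /= ?/Pdiag Pup_neg // mulr0 Pup_neg subr0 mul0r.
Qed.

(** Nonzero only when [m] is a single box, of content 0, created from the empty partition; the
    eigenvalue of [P_(1,0)] then drops by [z / aL]. *)
Lemma P1N1_neg : P q aL 1 (-1) (pos1 F) (l, m) = aL^-1 * P q aL 0 (-1) (pos1 F) (l, m).
Proof.
have zn := z_neq0 qgen.
have D G : Pdown (pos1 G) (l, m) = if addbox part0 m then G l else 0.
  rewrite /Pdown /= big1 ?add0r => [|l' _]; last by rewrite /pos1 /= (negPf m0).
  rewrite big_mkcond; case: ifP => am.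
    rewrite (bigD1_seq part0) ?intparts_uniq ?mem_intparts ?(addbox_psize am) //= am.
    rewrite big1 ?addr0 //= => m' m'0; case: ifP => // _.
    by rewrite /pos1 /= (negPf m'0).
  rewrite big1 // => m' _; case: ifP => // am'; rewrite /pos1; case: eqP => //= m'0.
  by rewrite -m'0 am' in am.
rewrite /P /= Pdiag_pos1 /Pdiag /Pshift /= !D; case: ifP => am; last by rewrite !(mulr0, subr0, mul0r).
have [i i0 h] := addbox_row am; move: i0; rewrite leqn0 => /eqP i0.
have cm : content_sum (q ^- 2) m = 1.
  by rewrite (content_sum_addbox _ h) content_sum_part0 add0r i0.
rewrite mul1r opprK expr1z exprN1 -[q^-1 - q]opprB invrN -mulrBl Peig1 /Peig /= cm.
by move: (p0 aL) (aL^-1) => p b; move: z zn => zz zn; field.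
Qed.

End Negative.

Lemma P_zero aL n k x : P q aL n k (fun=> 0) x = 0.
Proof.
have u0 : Pshift k (fun=> 0 : K) = fun=> 0.
  apply: functional_extensionality => y; rewrite /Pshift.
  by case: ifP => _; rewrite /Pup /Pdown !big1 ?addr0.
have d0 : Pdiag q aL n (fun=> 0) = fun=> 0.
  by apply: functional_extensionality => y; rewrite /Pdiag mulr0.
by rewrite /P !(u0, d0) subr0 mul0r !if_same.
Qed.

Section TwoTori.
Variables a a1 a2 : K.
Hypotheses (a10 : a1 != 0) (a20 : a2 != 0).
Implicit Types (H : intpart -> intpart -> K) (v w : intpart).

Lemma pos_embed_row H y :
  (fun x => pos_embed H x y) = if y.2 == part0 then pos1 (H^~ y.1) else fun=> 0.
Proof.
apply: functional_extensionality => x; rewrite /pos_embed andbC.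
by case: eqP.
Qed.

Lemma pos_embed_col H x :
  pos_embed H x = if x.2 == part0 then pos1 (H x.1) else fun=> 0.
Proof. by apply: functional_extensionality => y; rewrite /pos_embed; case: eqP. Qed.

Definition A1_side1 H v w := z * csop (H^~ w) v + addop 0 (H^~ w) v - a ^+ 2 * addop 1 (H^~ w) v.
Definition A1_side2 H v w := z * csop (H v) w + addop 0 (H v) w - a ^+ 2 * addop 1 (H v) w.

Lemma A1_pos_embed H v w :
  A1 q a a1 a2 (pos_embed H) (v, part0) (w, part0) = - (a1 * a2) * (A1_side1 H v w - A1_side2 H v w).
Proof.
rewrite /A1 /P1 /P2 pos_embed_row pos_embed_col /=.
rewrite !P00_pos1 !P10_pos1 !P01_pos1 !P11_pos1 /pos1 /= /A1_side1 /A1_side2; ring.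
Qed.

Lemma A1_pos_embed_neg H x y :
  (x.2 != part0) || (y.2 != part0) -> A1 q a a1 a2 (pos_embed H) x y = 0.
Proof.
case: x y => [v v'] [w w'] /=; rewrite /A1 /P1 /P2 pos_embed_row pos_embed_col /=.
case: (eqVneq v' part0) (eqVneq w' part0) => [->|v0] [->|w0] //= _;
  rewrite ?P_zero ?P0_neg ?P1_neg //; ring.
Qed.

Lemma A2_pos_embed H v w :
  A2 q a a1 a2 (pos_embed H) (v, part0) (w, part0) =
  z * csVop (H^~ w) v + remop 0 (H v) w - (a ^+ 2 - 1) / z * H v w +
  a2 ^+ 2 * (addop (-1) (H^~ w) v - a ^+ 2 * addop 0 (H^~ w) v - remop 1 (H v) w
    + a ^+ 2 * z * csop (H v) w + (a ^+ 2 - 1) / z * H v w).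
Proof.
rewrite /A2 /P1 /P2 pos_embed_row pos_embed_col /=.
rewrite !P00_pos1 !P10_pos1 !PN10_pos1 !P01_pos1 !PN11_pos1 !P0N1_pos1 !P1N1_pos1 /pos1 /=.
have zn := z_neq0 qgen; move: z zn => zz zn; field; by rewrite ?a10 ?a20 ?zn.
Qed.

(** Barred boxes are created only by [P_(0,-1)] and [P_(1,-1)] on the second factor, and their
    coefficients [1] and [- a2] make them cancel by [P1N1_neg]. *)
Lemma A2_pos_embed_neg H x y :
  (x.2 != part0) || (y.2 != part0) -> A2 q a a1 a2 (pos_embed H) x y = 0.
Proof.
case: x y => [v v'] [w w'] /=; rewrite /A2 /P1 /P2 pos_embed_row pos_embed_col /=.
case: (eqVneq v' part0) (eqVneq w' part0) => [->|v0] [->|w0] //= _;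
  rewrite ?P_zero ?P0_neg ?P1_neg ?P1N1_neg //; ring.
Qed.

End TwoTori.
End HopfEquations.

(** * Existence and uniqueness *)

Lemma psize0 (l : intpart) : (psize l == 0%N) = (l == part0).
Proof.
apply/eqP/eqP => [l0|->] //; apply: eq_intpart => k.
by rewrite !part_default // -?l0 (leq_trans (size_part_le l)) // l0.
Qed.

Lemma exists_addbox (v : intpart) : v != part0 -> exists l, addbox l v.
Proof.
rewrite -psize0 => v0; have sv : (0 < size v)%N.
  by rewrite lt0n; apply: contraNneq v0 => s0; rewrite (@psizeE 0%N) ?s0 // big_ord0.
pose i := (size v).-1.
have iv : (0 < part v i)%N by rewrite part_gt0 /i prednK.
have [l h] : exists l : intpart, part l =1 (fun k => part v k - (k == i))%N.
  apply: (@intpart_of _ (size v)) => [k|]; last by rewrite part_default.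
  have := part_anti v (leqnSn k); case: (k =P i) => [->|_] /=; last by case: eqP; lia.
  by rewrite (@part_default v i.+1) // /i prednK.
exists l; apply: (@addbox_of _ _ i) => k; rewrite h.
by case: eqP => [->|_]; rewrite ?subnK ?subn0 ?addn0.
Qed.

Section Characterization.
Variables (K : fieldType) (q a a1 a2 : K).
Hypothesis q0 : q != 0.
Hypothesis qgen : forall k, (0 < k)%N -> q ^+ k - q ^- k != 0.
Hypotheses (a10 : a1 != 0) (a20 : a2 != 0).

Local Notation z := (q - q^-1).
Local Notation t := (q ^+ 2).
Local Notation addop := (addop q).
Local Notation remop := (remop q).
Local Notation skewop := (skewop q).
Local Notation hopf03 := (hopf03 q a).
Implicit Types (H : intpart -> intpart -> K) (v w l m : intpart).

Lemma skewop_part0 u F : skewop u F part0 = F part0.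
Proof.
rewrite /skewop (perm_big [:: part0]) /=.
  by rewrite big_seq1 /skewk /jt det_mx00 mul1r.
apply: uniq_perm; rewrite ?intparts_le_uniq // => l.
by rewrite mem_intparts_le inE leqn0 psize0.
Qed.

Lemma hopf03_part0 : hopf03 part0 part0 = 1.
Proof.
have k0 : kappa part0 = 0 by rewrite /kappa big_nil mulr0.
rewrite /hopf03 /dress2 /dress.
do 2 rewrite skewop_part0 /untwist skewop_part0 k0 oppr0 expr0z mul1r.
by rewrite /diag03 eqxx big_nil.
Qed.

Lemma A3_swap (b b1 b2 : K) (Z : skein2 K) x y :
  A3 q b b1 b2 Z x y = A2 q b b2 b1 (fun y x => Z x y) y x.
Proof. by []. Qed.

Lemma pos_embed_swap H : (fun y x => pos_embed H x y) = pos_embed (fun w v => H v w).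
Proof.
apply: functional_extensionality => y; apply: functional_extensionality => x.
by rewrite /pos_embed andbC.
Qed.

Lemma hopf03_swap : (fun w v => hopf03 v w) = hopf03.
Proof.
apply: functional_extensionality => w; apply: functional_extensionality => v.
exact: hopf03_sym.
Qed.

(** The parameters are kept free so that exchanging [a1] and [a2] yields the third equation as
    well. *)
Lemma hopf03_A2 b1 b2 x y : b1 != 0 -> b2 != 0 -> A2 q a b1 b2 (pos_embed hopf03) x y = 0.
Proof.
move=> b10 b20; have [|] := boolP ((x.2 != part0) || (y.2 != part0)).
  exact: A2_pos_embed_neg.
rewrite negb_or !negbK => /andP[/eqP x0 /eqP y0].
case: x y x0 y0 => [v _] [w _] /= -> ->.
by rewrite A2_pos_embed // hopf03_rem // hopf03_add // mulr0 addr0.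
Qed.

Lemma hopf_equations_hopf03 : hopf_equations q a a1 a2 (pos_embed hopf03).
Proof.
split=> [l n m r|||x y|x y].
- by rewrite xpair_eqE /pos_embed /= => /negPf->.
- by rewrite /pos_embed /= hopf03_part0.
- move=> x y; have [|] := boolP ((x.2 != part0) || (y.2 != part0)).
    exact: A1_pos_embed_neg.
  rewrite negb_or !negbK => /andP[/eqP x0 /eqP y0].
  case: x y x0 y0 => [v _] [w _] /= -> ->.
  by rewrite A1_pos_embed // /A1_side1 /A1_side2 hopf03_A1 // subrr mulr0.
- exact: hopf03_A2.
- by rewrite A3_swap pos_embed_swap hopf03_swap hopf03_A2.
Qed.

Hypothesis content_sum_inj : injective (content_sum t).
Hypothesis a2gen : forall k : int, 1 - a2 ^+ 2 * q ^ k != 0.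

Section Uniqueness.
Variables G H : intpart -> intpart -> K.
Hypotheses (G0 : G part0 part0 = 1) (H0 : H part0 part0 = 1).
Hypotheses (G1 : forall v w, A1 q a a1 a2 (pos_embed G) (v, part0) (w, part0) = 0)
           (H1 : forall v w, A1 q a a1 a2 (pos_embed H) (v, part0) (w, part0) = 0).
Hypotheses (G2 : forall v w, A2 q a a1 a2 (pos_embed G) (v, part0) (w, part0) = 0)
           (H2 : forall v w, A2 q a a1 a2 (pos_embed H) (v, part0) (w, part0) = 0).

Let agree n := forall v w, (psize v + psize w < n)%N -> G v w = H v w.

Let eq_addop_row n v w e : agree n -> (psize v + psize w <= n)%N ->
  addop e (G^~ w) v = addop e (H^~ w) v.
Proof.
move=> IH vw; apply: eq_bigr => l /addbox_psize vl; rewrite IH //.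
by rewrite vl addSn in vw.
Qed.

Let eq_addop_col n v w e : agree n -> (psize v + psize w <= n)%N ->
  addop e (G v) w = addop e (H v) w.
Proof.
move=> IH vw; apply: eq_bigr => l /addbox_psize vl; rewrite IH //.
by rewrite vl addnS in vw.
Qed.

(** In the equation [A1] at [(v, w)] the value there has coefficient [z (C_v - C_w)], up to a
    nonzero factor; every other term has one box less. *)
Let agree_offdiag n v w : agree n -> (psize v + psize w <= n)%N -> v != w -> G v w = H v w.
Proof.
move=> IH vwn vw.
have red X : A1 q a a1 a2 (pos_embed X) (v, part0) (w, part0) = 0 ->
    z * (content_sum t v - content_sum t w) * X v w =
    addop 0 (X v) w - a ^+ 2 * addop 1 (X v) w -
    (addop 0 (X^~ w) v - a ^+ 2 * addop 1 (X^~ w) v).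
  rewrite A1_pos_embed // => /eqP; rewrite mulf_eq0 oppr_eq0 mulf_eq0 (negPf a10) (negPf a20) /=.
  rewrite subr_eq0 /A1_side1 /A1_side2 /csop => /eqP E.
  have -> : z * (content_sum t v - content_sum t w) * X v w =
    (z * (content_sum t v * X v w) + addop 0 (X^~ w) v - a ^+ 2 * addop 1 (X^~ w) v)
    - z * (content_sum t w * X v w) - (addop 0 (X^~ w) v - a ^+ 2 * addop 1 (X^~ w) v) by ring.
  by rewrite E; ring.
have c0 : z * (content_sum t v - content_sum t w) != 0.
  by rewrite mulf_neq0 ?z_neq0 // subr_eq0 (inj_eq content_sum_inj).
apply: (mulfI c0); rewrite !red //.
by rewrite !(eq_addop_row _ IH vwn) !(eq_addop_col _ IH vwn).
Qed.

(** [A1] says nothing about the value at [(v, v)]. In [A2] at [(v, l)], with [l] one box smaller,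
    the terms of top size are the values at [(v, m)] for [m] equal to [l] plus a box: all but
    [m = v] are off the diagonal, hence known, and the coefficient of the last is [1 - a2^2 q^k] for
    some integer [k]. *)
Let agree_diag n v : agree n -> (psize v + psize v <= n)%N -> G v v = H v v.
Proof.
move=> IH vn; have [->|v0] := eqVneq v part0; first by rewrite G0 H0.
have [l lv] := exists_addbox v0; have vl := addbox_psize lv.
have small : (psize v + psize l < n)%N by rewrite (leq_trans _ vn) // -addnS -vl.
have red X : A2 q a a1 a2 (pos_embed X) (v, part0) (l, part0) = 0 ->
    remop 0 (X v) l - a2 ^+ 2 * remop 1 (X v) l =
    (a ^+ 2 - 1) / z * X v l - z * (content_sum t^-1 v * X v l) -
    a2 ^+ 2 * (addop (-1) (X^~ l) v - a ^+ 2 * addop 0 (X^~ l) v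
      + a ^+ 2 * z * (content_sum t l * X v l) + (a ^+ 2 - 1) / z * X v l).
  rewrite A2_pos_embed // /csVop /csop => E.
  by apply/eqP; rewrite -subr_eq0 -[X in _ == X]E; apply/eqP; ring.
have : remop 0 (G v) l - a2 ^+ 2 * remop 1 (G v) l =
       remop 0 (H v) l - a2 ^+ 2 * remop 1 (H v) l.
  by rewrite !red // !(eq_addop_row _ IH (ltnW small)) IH.
have rem X : remop 0 (X v) l - a2 ^+ 2 * remop 1 (X v) l =
    \sum_(m <- intparts (psize l).+1 | addbox l m) (1 - a2 ^+ 2 * q ^ (kappa m - kappa l)) * X v m.
  rewrite /remop mulr_sumr -sumrB; apply: eq_bigr => m _.
  by rewrite mul0r expr0z !mul1r; ring.
rewrite !rem big_mkcond [RHS]big_mkcond.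
have vin : v \in intparts (psize l).+1 by rewrite mem_intparts vl.
rewrite (bigD1_seq v) ?intparts_uniq //= [RHS](bigD1_seq v) ?intparts_uniq //= lv.
rewrite [X in _ + X = _](eq_bigr (fun m => if addbox l m then
    (1 - a2 ^+ 2 * q ^ (kappa m - kappa l)) * H v m else 0)).
  by move=> /addIr /(mulfI (a2gen _)).
move=> m mv; case: ifP => // lm; rewrite (@agree_offdiag n) 1?eq_sym //.
by rewrite (addbox_psize lm) -vl.
Qed.

Lemma agree_all : G =2 H.
Proof.
move=> v w; have [n] := ubnP (psize v + psize w); elim: n v w => // n IHn v w; rewrite ltnS => vwn.
have [e|vw] := eqVneq v w; last exact: agree_offdiag IHn vwn vw.
by rewrite -e in vwn *; exact: agree_diag IHn vwn.
Qed.

End Uniqueness.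

Lemma hopf_equations_unique (Z : skein2 K) : hopf_equations q a a1 a2 Z -> Z = pos_embed hopf03.
Proof.
move=> hZ; pose G v w := Z (v, part0) (w, part0).
have ZG : Z = pos_embed G.
  apply: functional_extensionality => -[l n]; apply: functional_extensionality => -[m r].
  rewrite /pos_embed /=; case: ifP => [/andP[/eqP-> /eqP->] //|/negbT nr].
  by rewrite (hopf_support hZ) ?xpair_eqE.
have hH := hopf_equations_hopf03.
rewrite ZG in hZ *; congr pos_embed.
apply: functional_extensionality => v; apply: functional_extensionality => w.
apply: agree_all; first exact: hopf_unit hZ.
- exact: hopf03_part0.
- by move=> *; apply: hopf_A1 hZ _ _.
- by move=> *; apply: hopf_A1 hH _ _.
- by move=> *; apply: hopf_A2 hZ _ _.
- by move=> *; apply: hopf_A2 hH _ _.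
Qed.

End Characterization.

(** * The field of coefficients *)

Section CoefField.
Local Notation R := {mpoly rat[4]}.
Local Notation X0 := ('X_(inord 0) : R).

Lemma X_neq0 (i : 'I_4) : ('X_i : R) != 0.
Proof. by rewrite -msize_poly_eq0 msizeX. Qed.

Lemma tofrac_X_inj (m m' : 'X_{1..4}) :
  tofrac ('X_[m] : R) = tofrac 'X_[m'] -> m = m'.
Proof.
move/eqP; rewrite tofrac_eq => /eqP /(congr1 (fun p : R => p@_m)).
by rewrite !mcoeffX eqxx; case: eqP => // _ /eqP; rewrite oner_eq0.
Qed.

Lemma q_E k : q_ ^+ k = tofrac ('X_[U_(inord 0) *+ k] : R).
Proof. by rewrite -mpolyXn rmorphXn. Qed.

Lemma q_neq0 : q_ != 0. Proof. by rewrite tofrac_eq0 X_neq0. Qed.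
Lemma a_neq0 : a_ != 0. Proof. by rewrite tofrac_eq0 X_neq0. Qed.
Lemma a1_neq0 : a1_ != 0. Proof. by rewrite tofrac_eq0 X_neq0. Qed.
Lemma a2_neq0 : a2_ != 0. Proof. by rewrite tofrac_eq0 X_neq0. Qed.

Lemma q_expr_inj j k : q_ ^+ j = q_ ^+ k -> j = k.
Proof.
rewrite !q_E => /tofrac_X_inj /mnmP/(_ (inord 0)).
by rewrite !mulmnE mnm1E eqxx !mul1n.
Qed.

Lemma q_generic k : (0 < k)%N -> q_ ^+ k - q_ ^- k != 0.
Proof.
move=> k0; rewrite subr_eq0; apply/eqP => e.
have : q_ ^+ (k + k) = q_ ^+ 0.
  by rewrite exprD {2}e mulfV ?expf_neq0 ?q_neq0.
by move/q_expr_inj; lia.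
Qed.

Lemma coef_field_fact n : n`!%:R != 0 :> coef_field.
Proof.
have -> : n`!%:R = tofrac (n`!%:R : R) by rewrite rmorph_nat.
by rewrite tofrac_eq0 -mpolyC_nat mpolyC_eq0 pnatr_eq0 -lt0n fact_gt0.
Qed.

Lemma a2_generic (k : int) : 1 - a2_ ^+ 2 * q_ ^ k != 0.
Proof.
have a2E : a2_ ^+ 2 = tofrac ('X_[U_(inord 3) *+ 2] : R) by rewrite -mpolyXn rmorphXn.
have i30 : (inord 3 == inord 0 :> 'I_4) = false by rewrite -val_eqE /= !inordK.
rewrite subr_eq0; apply/eqP; case: k => k.
  rewrite -exprnP a2E q_E -rmorphM -mpolyXD -(rmorph1 (@tofrac R)) -mpolyX0.
  move/tofrac_X_inj/mnmP/(_ (inord 3)).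
  by rewrite mnmDE !mulmnE !mnm1E eqxx eq_sym i30 mnm0E.
rewrite NegzE -invr_expz => /(congr1 (fun x => x * q_ ^+ k.+1)).
rewrite -mulrA mulVf ?expf_neq0 ?q_neq0 // mul1r mulr1 a2E q_E.
move/tofrac_X_inj/mnmP/(_ (inord 3)).
by rewrite !mulmnE !mnm1E eqxx eq_sym i30.
Qed.

(** The coefficient of a power of [q] is its multiplicity in the list, and in characteristic 0 the
    multiplicities can be compared as numbers. *)
Lemma sum_q_mem (s s' : seq nat) :
  \sum_(k <- s) q_ ^+ k = \sum_(k <- s') q_ ^+ k -> s =i s'.
Proof.
have E r : \sum_(k <- r) q_ ^+ k = tofrac (\sum_(k <- r) 'X_[U_(inord 0) *+ k] : R).
  by rewrite rmorph_sum; apply: eq_bigr => k _; rewrite q_E.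
have C r k : (\sum_(k <- r) 'X_[U_(inord 0) *+ k] : R)@_(U_(inord 0) *+ k) = (count_mem k r)%:R.
  rewrite raddf_sum /= -sum1_count natr_sum [RHS]big_mkcond /=; apply: eq_bigr => j _.
  rewrite mcoeffX; have -> : (U_(inord 0 : 'I_4) *+ j == U_(inord 0) *+ k)%MM = (j == k).
    apply/idP/idP => [/eqP/mnmP/(_ (inord 0))|/eqP->//].
    by rewrite !mulmnE mnm1E eqxx !mul1n => ->.
  by case: eqP.
rewrite !E => /eqP; rewrite tofrac_eq => /eqP e k.
have /eqP := congr1 (fun p : R => p@_(U_(inord 0) *+ k)) e.
by rewrite !C eqr_nat -!has_pred1 !has_count => /eqP->.
Qed.

(** By [content_sum_rows], [C_l(q^2)] determines the sum of the [t ^ pcontent l i]. Multiplied by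
    [t ^+ N] it has nonnegative, strictly decreasing exponents [part l i + N - i], which can be read
    off as a set and then sorted. *)
Lemma q_content_sum_inj : injective (content_sum (q_ ^+ 2)).
Proof.
move=> v w e; pose N := (size v + size w)%N.
have t0 : q_ ^+ 2 != 0 by rewrite expf_neq0 ?q_neq0.
have vN : (size v <= N)%N by rewrite leq_addr.
have wN : (size w <= N)%N by rewrite leq_addl.
pose es (l : intpart) := [seq (part l i + (N - i))%N | i <- iota 0 N].
have E (l : intpart) : (size l <= N)%N -> \sum_(k <- [seq (2 * k)%N | k <- es l]) q_ ^+ k =
    (q_ ^+ 2) ^+ N * ((q_ ^+ 2 - 1) * content_sum (q_ ^+ 2) l + \sum_(i < N) (q_ ^+ 2) ^ (- i%:Z)).
  move=> lN; rewrite (content_sum_rows t0 lN) sumrB subrK mulr_sumr !big_map.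
  rewrite -{1}(subn0 N) -/(index_iota 0 N) big_mkord; apply: eq_bigr => i _.
  rewrite exprM [(_ ^+ 2) ^+ N]exprnP -expfzDr // [LHS]exprnP; congr (_ ^ _).
  by have := ltn_ord i; rewrite /pcontent; lia.
have m2 : [seq (2 * k)%N | k <- es v] =i [seq (2 * k)%N | k <- es w].
  by apply: sum_q_mem; rewrite !E // e.
have m1 : es v =i es w.
  have i2 : injective (muln 2) by move=> x y; lia.
  by move=> k; have := m2 (2 * k)%N; rewrite !(mem_map i2).
have srt (l : intpart) : sorted (fun x y => y < x)%N (es l).
  apply/(sortedP 0%N) => i; rewrite size_map size_iota => iN.
  rewrite !(nth_map 0%N) ?size_iota ?(ltnW iN) // !nth_iota ?(ltnW iN) // !add0n.
  by have := part_anti l (leqnSn i); lia.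
have ee : es v = es w.
  apply: irr_sorted_eq (srt v) (srt w) m1; last by move=> x; exact: ltnn.
  by move=> x y u xy yu; exact: ltn_trans yu xy.
apply: eq_intpart => i; case: (ltnP i N) => iN; last first.
  by rewrite !part_default // (leq_trans _ iN).
have := congr1 (fun s => nth 0%N s i) ee.
by rewrite !(nth_map 0%N) ?size_iota // !nth_iota // !add0n => /addIn.
Qed.

(** * Membership in the ring of coefficients *)

Let den (m : 'X_{1..4}) (s : seq nat) : R := 'X_[m] * \prod_(k <- s) (X0 ^+ (2 * k) - 1).

Let den_neq0 m s : 0%N \notin s -> tofrac (den m s) != 0.
Proof.
move=> s0; rewrite tofrac_eq0 mulf_neq0 //; first by rewrite -msize_poly_eq0 msizeX.
apply: contraNneq s0 => /eqP; rewrite prodf_seq_eq0 => /hasP[k ks /=].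
rewrite subr_eq0 -tofrac_eq rmorphXn rmorph1 -/q_ => /eqP e.
have : q_ ^+ (2 * k) = q_ ^+ 0 by rewrite e.
by move/q_expr_inj => k0; have -> : 0%N = k by lia.
Qed.

(** A version of [coef_ring] with polynomial denominators: [q^k - q^-k] is replaced by [q^(2k) - 1],
    which differs from it by the unit [q^k]. *)
Let localized (c : coef_field) := exists p m s, 0%N \notin s /\ c = tofrac p / tofrac (den m s).

Let den_mul m m' s s' : den m s * den m' s' = den (m + m')%MM (s ++ s').
Proof. by rewrite /den big_cat mpolyXD /= mulrACA. Qed.

Let localizedD c d : localized c -> localized d -> localized (c + d).
Proof.
move=> [p [m [s [s0 ->]]]] [p' [m' [s' [s0' ->]]]].
exists (p * den m' s' + p' * den m s), (m + m')%MM, (s ++ s').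
rewrite mem_cat negb_or s0; split=> //; rewrite -den_mul.
by rewrite addf_div ?den_neq0 // rmorphD !rmorphM.
Qed.

Let localizedM c d : localized c -> localized d -> localized (c * d).
Proof.
move=> [p [m [s [s0 ->]]]] [p' [m' [s' [s0' ->]]]].
exists (p * p'), (m + m')%MM, (s ++ s').
rewrite mem_cat negb_or s0; split=> //; rewrite -den_mul.
by rewrite mulf_div !rmorphM.
Qed.

Let localized_poly p : localized (tofrac p).
Proof.
exists p, 0%MM, [::]; split=> //.
by rewrite /den big_nil mpolyX0 mulr1 rmorph1 divr1.
Qed.

Let localized_q k : localized (q_ ^ k).
Proof.
case: k => k; first by rewrite -exprnP -rmorphXn; exact: localized_poly.
exists 1, (U_(inord 0) *+ k.+1)%MM, [::]; split=> //.
by rewrite NegzE -invr_expz /den big_nil mulr1 rmorph1 div1r -q_E.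
Qed.

Let localized_qV k : (0 < k)%N -> localized (q_ ^+ k - q_ ^- k)^-1.
Proof.
move=> k0; exists (X0 ^+ k), 0%MM, [:: k]; rewrite inE eq_sym -lt0n k0; split=> //.
rewrite /den big_seq1 mpolyX0 mul1r rmorphB rmorph1 !rmorphXn -/q_.
have -> : q_ ^+ (2 * k) - 1 = q_ ^+ k * (q_ ^+ k - q_ ^- k).
  by rewrite mulrBr mulfV ?expf_neq0 ?q_neq0 // -exprD addnn -mul2n.
by rewrite invfM mulrA mulfV ?expf_neq0 ?q_neq0 // mul1r.
Qed.

Let localized_sum (I : Type) (r : seq I) (P : pred I) (F : I -> coef_field) :
  (forall i, localized (F i)) -> localized (\sum_(i <- r | P i) F i).
Proof.
move=> h; apply: big_ind => [|c d|i _]; [|exact: localizedD|exact: h].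
by rewrite -(rmorph0 (@tofrac R)); exact: localized_poly.
Qed.

Let localized_prod (I : Type) (r : seq I) (P : pred I) (F : I -> coef_field) :
  (forall i, localized (F i)) -> localized (\prod_(i <- r | P i) F i).
Proof.
move=> h; apply: big_ind => [|c d|i _]; [|exact: localizedM|exact: h].
by rewrite -(rmorph1 (@tofrac R)); exact: localized_poly.
Qed.

Let localized_star f (F G : pos2 coef_field) : (forall l m, localized (F l m)) ->
  (forall l m, localized (G l m)) -> forall l m, localized (star q_ f F G l m).
Proof.
move=> hF hG l m; do 4 apply: localized_sum => ?.
have hs l1 l2 l3 : localized (star_coef q_ f l1 l2 l3).
  rewrite /star_coef; apply: localizedM (localized_q _).
  by rewrite -(rmorph_int (@tofrac R)); exact: localized_poly.
by apply: localizedM => //; apply: localizedM => //; exact: localizedM.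
Qed.

Let localized_Psi_di p l : localized (Psi_di q_ 0 (tofrac p) l) /\ localized (Psi_di q_ 1 (tofrac p) l).
Proof.
suff h : localized (\prod_(b <- boxes l) (- q_ ^ (- content b) / (q_ ^+ hook l b - q_ ^- hook l b))).
  have hp : localized (tofrac p ^+ psize l) by rewrite -rmorphXn; exact: localized_poly.
  rewrite /Psi_di expr0z expr1z mul1r; split; first exact: localizedM.
  apply: localizedM hp; apply: localizedM h; apply: localizedM (localized_q _).
  by rewrite -(rmorphN1 (@tofrac R)) -rmorphXn; exact: localized_poly.
apply: localized_prod => b; rewrite mulNr -mulN1r; apply: localizedM.
  by rewrite -(rmorphN1 (@tofrac R)); exact: localized_poly.
exact: localizedM (localized_q _) (localized_qV _).
Qed.

Let localized_Psi_03 l m : localized (Psi_03 q_ a_ l m).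
Proof.
rewrite /Psi_03; case: ifP => _; last by rewrite -(rmorph0 (@tofrac R)); exact: localized_poly.
apply: localizedM; first by rewrite -(rmorphN1 (@tofrac R)) -rmorphXn; exact: localized_poly.
apply: localized_prod => b; apply: localizedD.
  by apply: localizedM (localized_q _); rewrite -rmorphXn; exact: localized_poly.
rewrite -mulN1r; apply: localizedM (localized_q _).
by rewrite -(rmorphN1 (@tofrac R)); exact: localized_poly.
Qed.

Let localized_coef_ring c : localized c -> coef_ring c.
Proof.
(* The extra monomial [q ^ sumn s] collects the powers [q^k] lost in passing from [q^(2k) - 1] back
   to [q^k - q^-k]. *)
move=> [p [m [s [s0 ->]]]]; exists p, (m + U_(inord 0) *+ sumn s)%MM, s; split=> //.
rewrite /den mpolyXD !rmorphM -mulrA; congr (_ / (_ * _)).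
rewrite /= -q_E; elim: s {s0} => [|k s IHs]; first by rewrite !big_nil rmorph1 mulr1.
rewrite !big_cons rmorphM /= {}IHs rmorphB rmorph1 rmorphXn /= -/q_.
have -> : q_ ^+ (2 * k) - 1 = q_ ^+ k * (q_ ^+ k - q_ ^- k).
  by rewrite mulrBr mulfV ?expf_neq0 ?q_neq0 // -exprD addnn -mul2n.
by rewrite exprD mulrACA.
Qed.

Lemma coef_ring_hopf_rhs l m : coef_ring (hopf_rhs q_ a_ l m).
Proof.
have h1 k : localized (Psi_di q_ 0 1 k).
  by rewrite -(rmorph1 (@tofrac R)); case: (localized_Psi_di 1 k).
have h2 k : localized (Psi_di q_ 1 (a_ ^+ 2) k).
  by rewrite -rmorphXn; case: (localized_Psi_di ('X_(inord 1) ^+ 2) k).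
apply: localized_coef_ring; apply: localized_star => {l m} l m; last exact: localizedM.
by apply: localized_star => {l m} l m; [exact: localizedM | exact: localized_Psi_03].
Qed.

End CoefField.

(** For the converse, membership in [coef_ring] is read off the explicit formula [hopf_rhs], while
    the equations are checked on its other form [hopf03]. *)
Lemma is_Z_ll_iff Z : is_Z_ll Z <-> Z =2 pos_embed (hopf_rhs q_ a_).
Proof.
have rhsE := hopf_rhsE q_neq0 q_generic coef_field_fact a_neq0.
split=> [[_ hZ] x y|e].
  rewrite (hopf_equations_unique q_neq0 q_generic a1_neq0 a2_neq0 q_content_sum_inj a2_generic hZ).
  by rewrite rhsE.
have -> : Z = pos_embed (hopf_rhs q_ a_).
  by apply: functional_extensionality => x; apply: functional_extensionality => y.
split=> [x y|]; last first.
  by rewrite rhsE; apply: hopf_equations_hopf03 q_neq0 q_generic a1_neq0 a2_neq0.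
rewrite /pos_embed; case: ifP => _; first exact: coef_ring_hopf_rhs.
exists 0, 0%MM, [::]; split=> //.
by rewrite rmorph0 mul0r.
Qed.

Theorem theorem8p1 :
  (forall Z : skein2 coef_field,
     is_Z_ll Z <-> Z =2 pos_embed (hopf_rhs q_ a_)) /\
  (forall Z : skein2 coef_field,
     is_Z_mm Z <-> Z =2 pos_embed (hopf_rhs q_ a_)).
Proof.
have sym x y : pos_embed (hopf_rhs q_ a_) x y = pos_embed (hopf_rhs q_ a_) y x.
  rewrite (hopf_rhsE q_neq0 q_generic coef_field_fact a_neq0).
  by rewrite /pos_embed andbC hopf03_sym.
split=> Z; first exact: is_Z_ll_iff.
by rewrite /is_Z_mm is_Z_ll_iff; split=> e x y; rewrite sym; exact: e.
Qed.
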